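(* Let $\mathcal U,\mathcal Y$ be Hilbert spaces, let $S\in\mathcal S(\mathcal U,\mathcal Y)$ be a Schur-class function on the open unit disk $\mathbb D$, and let $\mathcal H(S)$ be the associated de Branges-Rovnyak space. Then: (1) $\mathcal H(S)$ is a linear space, indeed a reproducing kernel Hilbert space (of $\mathcal Y$-valued functions on $\mathbb D$) with reproducing kernel $$K_S(z,w)=\frac{I-S(z)S(w)^*}{1-z\overline w}.$$ (2) $\mathcal H(S)$ is invariant under the backward-shift operator $R_0\colon f(z)\mapsto [f(z)-f(0)]/z$, and for all $f\in\mathcal H(S)$ $$\|R_0f\|^2_{\mathcal H(S)}\le \|f\|^2_{\mathcal H(S)}-\|f(0)\|^2_{\mathcal Y}.$$ Moreover, equality holds here for all $f\in\mathcal H(S)$ if and only if the following property holds for $u\in\mathcal U$: if the function $z\mapsto S(z)u$ belongs to $\mathcal H(S)$, then $S(z)u\equiv 0$. (3) For any $u\in\mathcal U$ the function $R_0(Su)$ is in $\mathcal H(S)$. Let $\tau\colon\mathcal U\to\mathcal H(S)$ be the operator $\tau\colon u\mapsto R_0(Su)=\frac{S(z)-S(0)}{z}u$. Then the adjoint of the operator $R_0$ on $\mathcal H(S)$ is given by $$R_0^*\colon f(z)\mapsto zf(z)-S(z)\,\tau^*(f),$$ and $\|R_0^*f\|^2_{\mathcal H(S)}=\|f\|^2_{\mathcal H(S)}-\|\tau^*(f)\|^2_{\mathcal U}$ for all $f\in\mathcal H(S)$. (4) Let $$\mathbf U_S=\begin{bmatrix}A_S&B_S\\ C_S&D_S\end{bmatrix}:=\begin{bmatrix}R_0&\tau\\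 \mathbf e(0)&S(0)\end{bmatrix}\colon\begin{bmatrix}\mathcal H(S)\\ \mathcal U\end{bmatrix}\to\begin{bmatrix}\mathcal H(S)\\ \mathcal Y\end{bmatrix},$$ where $\mathbf e(0)\colon\mathcal H(S)\to\mathcal Y$, $\mathbf e(0)\colon f\mapsto f(0)$. Then $\mathbf U_S$ is coisometric, and $S(z)=D_S+zC_S(I-zA_S)^{-1}B_S$ for $z\in\mathbb D$. (5) An operator $T$ on a Hilbert space $\mathcal X$ is unitarily equivalent to an operator of the form $R_0$ on a space $\mathcal H(S)$ for some contractive operator-valued analytic function $S$ on $\mathbb D$ if and only if $T$ is a completely non-isometric contraction, i.e., $$\|T\|\le1\quad\text{and}\quad \bigcap_{n\ge0}\{x\in\mathcal X\colon\|T^nx\|=\|x\|\}=\{0\}.$$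
   Context: For a Hilbert space $\mathcal Y$, $H^2(\mathcal Y)$ is the Hardy space of analytic $\mathcal Y$-valued functions $f(z)=\sum_{n\ge0}f_nz^n$ on the open unit disk $\mathbb D$ with $\|f\|^2_{H^2(\mathcal Y)}=\sum\|f_n\|^2<\infty$. The Schur class $\mathcal S(\mathcal U,\mathcal Y)$ is the set of analytic functions on $\mathbb D$ whose values are contractive operators from $\mathcal U$ to $\mathcal Y$. For $S\in\mathcal S(\mathcal U,\mathcal Y)$ the de Branges-Rovnyak space is $$\mathcal H(S)=\Big\{f\in H^2(\mathcal Y)\colon \|f\|^2_{\mathcal H(S)}:=\sup_{g\in H^2(\mathcal U)}\big\{\|f+Sg\|^2_{H^2(\mathcal Y)}-\|g\|^2_{H^2(\mathcal U)}\big\}<\infty\Big\}.$$ A Hilbert space $\mathcal H$ of $\mathcal Y$-valued functions on a set $\Omega$ is a reproducing kernel Hilbert space with reproducing kernel $K\colon\Omega\times\Omega\to\mathcal L(\mathcal Y)$ if $K(\cdot,\zeta)y\in\mathcal H$ and $\langle f,K(\cdot,\zeta)y\rangle_{\mathcal H}=\langle f(\zeta),y\rangle_{\mathcal Y}$ for all $f\in\mathcal H$, $\zeta\in\Omega$, $y\in\mathcal Y$. An operator $\mathbf U$ is coisometric if $\mathbf U\mathbf U^*=I$. *)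

(* Defs.v *)
From Stdlib Require Import Reals Lra.
From Coquelicot Require Import Coquelicot.

Set Implicit Arguments.
Unset Strict Implicit.
Open Scope R_scope.

(** The inner product is linear in its first argument.  The uniform structure
    of a Coquelicot [NormedModule] is equivalent to the one given by the norm,
    so that completeness is metric completeness. *)
Record HilbertSpace := {
  hilbert_car :> CompleteNormedModule C_AbsRing;
  inner : hilbert_car -> hilbert_car -> C;
  inner_plus_l : forall x y z,
    inner (plus x y) z = Cplus (inner x z) (inner y z);
  inner_scal_l : forall (a : C) x y, inner (scal a x) y = Cmult a (inner x y);
  inner_conj : forall x y, inner y x = Cconj (inner x y);
  inner_norm : forall x, inner x x = RtoC (norm x ^ 2) }.

Section HilbertFacts.
Variable H : HilbertSpace.
Implicit Types x y z : H.

Lemma hilbert_plus_minus x y : plus y (minus x y) = x.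
Proof.
  unfold minus; rewrite plus_comm, <- plus_assoc.
  exact (eq_trans (f_equal (plus x) (plus_opp_l y)) (plus_zero_r x)).
Qed.

Lemma inner_plus_r x y z : inner x (plus y z) = Cplus (inner x y) (inner x z).
Proof.
  now rewrite inner_conj, inner_plus_l, Cplus_conj, <- !inner_conj.
Qed.

Lemma inner_scal_r (a : C) x y :
  inner x (scal a y) = Cmult (Cconj a) (inner x y).
Proof.
  now rewrite inner_conj, inner_scal_l, Cmult_conj, <- inner_conj.
Qed.

Lemma scal_m1 x : opp x = scal (RtoC (-1)) x.
Proof.
  replace (RtoC (-1)) with (opp one : C_Ring).
  - symmetry; exact (scal_opp_one (V := CompleteNormedModule.ModuleSpace _ H) x).
  - apply injective_projections; simpl; unfold opp; simpl; ring.
Qed.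

Lemma inner_minus_l x y z : inner (minus x y) z = Cminus (inner x z) (inner y z).
Proof.
  unfold minus; rewrite inner_plus_l, scal_m1, inner_scal_l.
  apply injective_projections; simpl; ring.
Qed.

Lemma inner_minus_r x y z : inner x (minus y z) = Cminus (inner x y) (inner x z).
Proof.
  unfold minus; rewrite inner_plus_r, scal_m1, inner_scal_r.
  apply injective_projections; simpl; ring.
Qed.

Lemma norm2_inner x : norm x ^ 2 = Re (inner x x).
Proof. now rewrite inner_norm. Qed.

Lemma Re_inner_sym x y : Re (inner y x) = Re (inner x y).
Proof. now rewrite inner_conj. Qed.

Lemma norm2_plus x y :
  norm (plus x y) ^ 2 = norm x ^ 2 + norm y ^ 2 + 2 * Re (inner x y).
Proof.
  rewrite !norm2_inner, inner_plus_l, !inner_plus_r.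
  generalize (Re_inner_sym x y); unfold Re; simpl; lra.
Qed.

Lemma norm2_minus x y :
  norm (minus x y) ^ 2 = norm x ^ 2 + norm y ^ 2 - 2 * Re (inner x y).
Proof.
  rewrite !norm2_inner, inner_minus_l, !inner_minus_r.
  generalize (Re_inner_sym x y); unfold Re; simpl; lra.
Qed.

Lemma norm2_scal (a : C) x : norm (scal a x) ^ 2 = Cmod a ^ 2 * norm x ^ 2.
Proof.
  rewrite norm2_inner, inner_scal_l, inner_scal_r, inner_norm, Cmod2_alt.
  unfold Re, Im; simpl; ring.
Qed.

Lemma hilbert_norm0 x : norm x = 0 -> x = zero.
Proof. exact (norm_eq_zero (V := CompleteNormedModule.NormedModule _ H) x). Qed.

Lemma inner_zero_r x : inner x zero = 0.
Proof.
  assert (Z : scal (RtoC 0) x = (zero : H))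
    by exact (scal_zero_l (V := CompleteNormedModule.ModuleSpace _ H) x).
  rewrite <- Z, inner_scal_r.
  apply injective_projections; simpl; ring.
Qed.

Lemma Cauchy_Schwarz x y : Cmod (inner x y) <= norm x * norm y.
Proof.
  assert (E := norm2_minus (scal (RtoC (norm y ^ 2)) x) (scal (inner x y) y)).
  rewrite !norm2_scal, inner_scal_l, inner_scal_r, Cmod_R in E.
  set (c := inner x y) in *.
  replace (Re (RtoC (norm y ^ 2) * (Cconj c * c))%C)
    with (norm y ^ 2 * Cmod c ^ 2) in E
    by (rewrite Cmod2_alt; unfold Re, Im; simpl; ring).
  rewrite Rabs_pos_eq in E by apply pow2_ge_0.
  match type of E with ?a ^ 2 = _ =>
    assert (P := pow2_ge_0 a); rewrite E in P end.
  assert (Nx := norm_ge_0 x); assert (Ny := norm_ge_0 y).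
  destruct Ny as [Ny | Ny].
  - apply Rsqr_incr_0_var; [| apply Rmult_le_pos; lra ].
    unfold Rsqr.
    apply Rmult_le_reg_l with (norm y ^ 2); [apply pow_lt; lra |].
    nra.
  - unfold c; rewrite (hilbert_norm0 (x := y)), inner_zero_r by easy.
    rewrite Cmod_0; apply Rmult_le_pos; apply norm_ge_0.
Qed.

End HilbertFacts.

Section Riesz.
Variable H : HilbertSpace.
Variable phi : H -> C.
Hypothesis phi_lin : is_linear (V := C_NormedModule) phi.

Let J (x : H) := norm x ^ 2 - 2 * Re (phi x).

Lemma phi_plus x y : phi (plus x y) = Cplus (phi x) (phi y).
Proof. exact (linear_plus _ phi_lin x y). Qed.

Lemma phi_scal (a : C) x : phi (scal a x) = Cmult a (phi x).
Proof. exact (linear_scal _ phi_lin a x). Qed.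

Lemma J_parallelogram x y :
  norm (minus x y) ^ 2
  = 2 * J x + 2 * J y - 4 * J (scal (RtoC (/ 2)) (plus x y)).
Proof.
  unfold J.
  rewrite norm2_minus, norm2_scal, norm2_plus, phi_scal, phi_plus.
  rewrite Cmod_R, Rabs_pos_eq by lra.
  unfold Re; simpl; lra.
Qed.

Lemma J_bounded : exists m, is_glb_Rbar (fun t => exists x, t = J x) (Finite m).
Proof.
  destruct (ex_glb_Rbar (fun t => exists x, t = J x)) as [l [Hl Hg]].
  destruct phi_lin as [_ _ [M [M0 HM]]].
  assert (B : Rbar_le (Finite (- M ^ 2)) l).
  { apply Hg; intros t [x ->]; simpl.
    specialize (HM x); unfold J.
    assert (D := Rle_trans _ _ _ (Rle_abs _) (Rle_trans _ _ _ (Rmax_l _ _)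
      (Rmax_Cmod (phi x)))).
    change (Cmod (phi x) <= M * norm x) in HM.
    unfold Re; generalize (pow2_ge_0 (norm x - M)); simpl in *; nra. }
  assert (B' := Hl (J zero) (ex_intro _ zero eq_refl)).
  destruct l as [m | |]; simpl in *; try tauto.
  exists m; split; auto.
Qed.

Lemma J_attained : exists y, forall x, J y <= J x.
Proof.
  destruct J_bounded as [m [Hm Hg]].
  destruct phi_lin as [_ _ [M [M0 HM]]].
  assert (Near : forall e, 0 < e -> exists x, J x < m + e).
  { intros e He; apply Classical_Prop.NNPP; intro N.
    assert (A : Rbar_le (Finite (m + e)) (Finite m)).
    { apply Hg; intros t [x ->]; simpl.
      destruct (Rle_or_lt (m + e) (J x)); trivial; elim N; now exists x. }
    simpl in A; lra. }
  set (F := fun P : H -> Prop =>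
    exists e, 0 < e /\ forall x, J x < m + e -> P x).
  assert (PF : ProperFilter F).
  { split.
    - intros P [e [He HP]]; destruct (Near e He) as [x Hx]; exists x; auto.
    - split.
      + exists 1; split; [lra | trivial].
      + intros P Q [e [He HP]] [d [Hd HQ]]; exists (Rmin e d); split.
        * now apply Rmin_pos.
        * intros x Hx; generalize (Rmin_l e d) (Rmin_r e d); intros.
          split; [apply HP | apply HQ]; lra.
      + intros P Q PQ [e [He HP]]; exists e; auto. }
  assert (CF : cauchy F).
  { intros e.
    assert (He := cond_pos e).
    set (d := e ^ 2 / 4).
    assert (Hd : 0 < d) by (unfold d; generalize (pow_lt e 2 He); lra).
    destruct (Near d Hd) as [x Hx].
    exists x, d; split; trivial; intros y Hy.
    apply (norm_compat1 (V := CompleteNormedModule.NormedModule _ H)).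
    assert (E := J_parallelogram y x).
    assert (L := Hm _ (ex_intro _ (scal (RtoC (/ 2)) (plus y x)) eq_refl)).
    simpl Rbar_le in L.
    apply Rsqr_incrst_0; [| apply norm_ge_0 | lra].
    rewrite !Rsqr_pow2; unfold d in *.
    apply Rle_lt_trans with (2 * J y + 2 * J x - 4 * J (scal (RtoC (/ 2)) (plus y x))).
    - right; exact E.
    - lra. }
  exists (lim F : H); intros z.
  set (y := lim F : H).
  apply Rle_trans with m; [| apply (Hm (J z)); now exists z].
  apply le_epsilon; intros e He.
  set (k := 2 * (norm y + M)).
  assert (Ny := norm_ge_0 y).
  assert (Hk : 0 < k) by (unfold k; lra).
  set (nf := norm_factor (V := CompleteNormedModule.NormedModule _ H)).
  assert (Hnf : 0 < nf) by apply norm_factor_gt_0.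
  assert (Hd : 0 < e / 2 / k / nf) by (repeat apply Rdiv_lt_0_compat; lra).
  destruct (complete_cauchy F PF CF (mkposreal _ Hd)) as [e' [He' HF]].
  destruct (Near (Rmin e' (e / 2))) as [x Hx]; [apply Rmin_pos; lra |].
  assert (B : norm (minus x y) < nf * (e / 2 / k / nf)).
  { apply (norm_compat2 (V := CompleteNormedModule.NormedModule _ H) y x
             (mkposreal _ Hd)).
    apply HF; generalize (Rmin_l e' (e / 2)); lra. }
  replace (nf * (e / 2 / k / nf)) with (e / 2 / k) in B by (field; lra).
  set (d := minus x y) in *.
  assert (Ex : x = plus y d).
  { symmetry; apply hilbert_plus_minus. }
  assert (EJ : J x = J y + norm d ^ 2 + 2 * Re (inner y d) - 2 * Re (phi d)).
  { unfold J; rewrite Ex, norm2_plus, phi_plus; unfold Re; simpl; lra. }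
  assert (CS := Cauchy_Schwarz y d).
  assert (Pd : Cmod (phi d) <= M * norm d) by exact (HM d).
  assert (R1 := Rle_trans _ _ _ (Rmax_l _ _) (Rmax_Cmod (phi d))).
  assert (R2 := Rle_trans _ _ _ (Rmax_l _ _) (Rmax_Cmod (inner y d))).
  assert (R1' := Rle_abs (fst (phi d))).
  assert (R2' := Rle_abs (- fst (inner y d))).
  rewrite Rabs_Ropp in R2'.
  unfold Re in EJ.
  assert (Nd := pow2_ge_0 (norm d)).
  assert (Kd : k * norm d <= e / 2).
  { apply Rlt_le in B; apply (Rmult_le_compat_l k) in B; [| lra].
    replace (k * (e / 2 / k)) with (e / 2) in B by (field; lra); lra. }
  unfold k in Kd; generalize (Rmin_r e' (e / 2)); lra.
Qed.

Lemma Riesz : exists! y, forall x, phi x = inner x y.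
Proof.
  destruct J_attained as [y Hy].
  assert (V : forall x, 0 <= norm x ^ 2 + 2 * Re (Cminus (inner x y) (phi x))).
  { intros x; generalize (Hy (plus y x)); unfold J.
    rewrite norm2_plus, phi_plus; generalize (Re_inner_sym x y).
    unfold Re; simpl; lra. }
  assert (E : forall x, phi x = inner x y).
  { intros x; set (c := Cminus (inner x y) (phi x)).
    assert (Z : Cmod c = 0).
    { apply Classical_Prop.NNPP; intro N.
      assert (C0 := Cmod_ge_0 c).
      set (s := / (norm x ^ 2 + 1)).
      assert (Nx := pow2_ge_0 (norm x)).
      assert (Hs : 0 < s) by (apply Rinv_0_lt_compat; lra).
      assert (Hs' : s * (norm x ^ 2 + 1) = 1) by (unfold s; field; lra).
      specialize (V (scal (Cmult (RtoC (- s)) (Cconj c)) x)).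
      rewrite norm2_scal, inner_scal_l, phi_scal in V.
      rewrite Cmod_mult, Cmod_conj, Cmod_R, Rabs_Ropp, Rabs_pos_eq in V by lra.
      assert (D : Re (Cminus (Cmult (Cmult (RtoC (- s)) (Cconj c)) (inner x y))
                    (Cmult (Cmult (RtoC (- s)) (Cconj c)) (phi x)))
                  = - s * Cmod c ^ 2).
      { rewrite Cmod2_alt; unfold c, Re, Im; simpl; ring. }
      rewrite D in V.
      assert (P : 0 < Cmod c ^ 2) by (apply pow_lt; lra).
      assert (Q : 0 < s * Cmod c ^ 2) by now apply Rmult_lt_0_compat.
      nra. }
    apply Cmod_eq_0 in Z; unfold c in Z.
    replace (inner x y) with (Cplus (Cminus (inner x y) (phi x)) (phi x)) by ring.
    rewrite Z; ring. }
  exists y; split; trivial; intros y' Hy'.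
  assert (N : norm (minus y y') ^ 2 = 0).
  { rewrite norm2_inner, inner_minus_r, <- E, <- Hy'; unfold Re; simpl; ring. }
  assert (N' : norm (minus y y') = 0)
    by (generalize (norm_ge_0 (minus y y')); nra).
  apply hilbert_norm0 in N'.
  rewrite <- (hilbert_plus_minus y y'), N'.
  exact (plus_zero_r (G := CompleteNormedModule.AbelianGroup _ H) y').
Qed.

End Riesz.

(** The unique vector [x] with [<A z, y> = <z, x>] for all [z]; it exists
    whenever [A] is bounded and linear, see [adjP]. *)
Definition adj (H K : HilbertSpace) (A : H -> K) (y : K) : H :=
  iota (fun x : H => forall z : H, inner (A z) y = inner z x).

Lemma adjP (H K : HilbertSpace) (A : H -> K) (z : H) (y : K) :
  is_linear A -> inner (A z) y = inner z (adj A y).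
Proof.
  intros L.
  assert (R : exists! x, forall z, inner (A z) y = inner z x).
  { apply Riesz with (phi := fun z => inner (A z) y).
    destruct L as [Lp Ls [M [M0 HM]]]; split.
    - intros u v; rewrite Lp; apply inner_plus_l.
    - intros a u; rewrite Ls; apply inner_scal_l.
    - assert (Ny := norm_ge_0 y).
      exists (M * (norm y + 1)); split; [apply Rmult_lt_0_compat; lra |].
      intros u; apply Rle_trans with (norm (A u) * norm y).
      + apply Cauchy_Schwarz.
      + specialize (HM u); assert (Nu := norm_ge_0 u).
        apply Rle_trans with (M * norm u * norm y).
        * now apply Rmult_le_compat_r.
        * generalize (Rmult_le_pos _ _ (Rlt_le _ _ M0) Nu); nra. }
  exact (iota_correct _ R z).
Qed.

Section DirectSum.
Variables H K : HilbertSpace.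

Let N := prod_NormedModule C_AbsRing H K.

Definition hsum_lim (F : (N -> Prop) -> Prop) : N :=
  (lim (filtermap (fst : N -> H) F), lim (filtermap (snd : N -> K) F)).

Lemma hsum_ax1 (F : (N -> Prop) -> Prop) :
  ProperFilter F -> cauchy F ->
  forall eps : posreal, F (ball (hsum_lim F) eps).
Proof.
  intros PF CF eps.
  assert (F1 : filtermap (fst : N -> H) F (ball (lim (filtermap (fst : N -> H) F)) eps)).
  { apply complete_cauchy; [now apply filtermap_proper_filter |].
    intros e; destruct (CF e) as [x Hx]; exists (fst x).
    now apply filter_imp with (2 := Hx); intros y []. }
  assert (F2 : filtermap (snd : N -> K) F (ball (lim (filtermap (snd : N -> K) F)) eps)).
  { apply complete_cauchy; [now apply filtermap_proper_filter |].
    intros e; destruct (CF e) as [x Hx]; exists (snd x).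
    now apply filter_imp with (2 := Hx); intros y []. }
  apply filter_imp
    with (2 := filter_and (fun x : N => ball (fst (hsum_lim F)) eps (fst x))
                          (fun x : N => ball (snd (hsum_lim F)) eps (snd x))
                          F1 F2).
  now intros y []; split.
Qed.

Lemma hsum_ax2 (F1 F2 : (N -> Prop) -> Prop) :
  filter_le F1 F2 -> filter_le F2 F1 -> close (hsum_lim F1) (hsum_lim F2).
Proof.
  intros L1 L2 eps; split.
  - exact (close_lim (filtermap (fst : N -> H) F1) (filtermap (fst : N -> H) F2)
             (fun P => L1 (fun x => P (fst x))) (fun P => L2 (fun x => P (fst x)))
             eps).
  - exact (close_lim (filtermap (snd : N -> K) F1) (filtermap (snd : N -> K) F2)
             (fun P => L1 (fun x => P (snd x))) (fun P => L2 (fun x => P (snd x)))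
             eps).
Qed.

Definition hsum_CompleteNormedModule : CompleteNormedModule C_AbsRing :=
  CompleteNormedModule.Pack C_AbsRing (H * K)
    (CompleteNormedModule.Class C_AbsRing (H * K) (NormedModule.class _ N)
       (CompleteSpace.Mixin N hsum_lim hsum_ax1 hsum_ax2)) (H * K).

Definition hsum_inner (p q : hsum_CompleteNormedModule) : C :=
  Cplus (inner (fst p) (fst q)) (inner (snd p) (snd q)).

Definition hsum : HilbertSpace.
Proof.
  refine (@Build_HilbertSpace hsum_CompleteNormedModule hsum_inner _ _ _ _).
  - intros x y z; unfold hsum_inner; simpl.
    rewrite 2!inner_plus_l; ring.
  - intros a x y; unfold hsum_inner; simpl.
    rewrite 2!inner_scal_l; ring.
  - intros x y; unfold hsum_inner.
    now rewrite Cplus_conj, <- !inner_conj.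
  - intros x; unfold hsum_inner; rewrite !inner_norm, <- RtoC_plus; f_equal.
    symmetry; apply pow2_sqrt.
    apply Rplus_le_le_0_compat; apply pow2_ge_0.
Defined.

End DirectSum.

Definition coisometric (H K : HilbertSpace) (A : H -> K) : Prop :=
  is_linear A /\ forall y : K, A (adj A y) = y.

Definition unitary (H K : HilbertSpace) (V : H -> K) : Prop :=
  is_linear V /\
  (forall x y : H, inner (V x) (V y) = inner x y) /\
  (forall y : K, exists x : H, V x = y).

Definition is_inverse (H : HilbertSpace) (A B : H -> H) : Prop :=
  is_linear B /\ (forall x : H, B (A x) = x) /\ (forall x : H, A (B x) = x).

Definition block (H1 H2 K1 K2 : HilbertSpace)
    (A : H1 -> K1) (B : H2 -> K1) (C : H1 -> K2) (D : H2 -> K2)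
    (p : hsum H1 H2) : hsum K1 K2 :=
  (plus (A (fst p)) (B (snd p)), plus (C (fst p)) (D (snd p))).

Definition contraction (H K : HilbertSpace) (A : H -> K) : Prop :=
  is_linear A /\ forall x : H, norm (A x) <= norm x.

Definition completely_nonisometric (H : HilbertSpace) (T : H -> H) : Prop :=
  forall x : H,
    (forall n : nat, norm (Nat.iter n T x) = norm x) -> x = zero.

(** A Hilbert space of [Y]-valued functions on [Omega]: an element is
    identified with its function of values. *)
Record FunHilbert (Omega : Type) (Y : HilbertSpace) := {
  fh_space :> HilbertSpace;
  ev : fh_space -> Omega -> Y;
  ev_plus : forall f g z, ev (plus f g) z = plus (ev f z) (ev g z);
  ev_scal : forall (a : C) f z, ev (scal a f) z = scal a (ev f z);
  ev_inj : forall f g, (forall z, ev f z = ev g z) -> f = g }.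

Arguments ev {Omega Y f} _ _ : rename.

(** The element of [H] whose function of values is [f], if there is one. *)
Definition of_fun (Omega : Type) (Y : HilbertSpace) (H : FunHilbert Omega Y)
    (f : Omega -> Y) : H :=
  iota (fun h : H => forall z, ev h z = f z).

Definition reproducing_kernel (Omega : Type) (Y : HilbertSpace)
    (H : FunHilbert Omega Y) (K : Omega -> Omega -> Y -> Y) : Prop :=
  (forall z w, is_linear (K z w)) /\
  forall (w : Omega) (y : Y), exists k : H,
    (forall z, ev k z = K z w y) /\
    forall f : H, inner f k = inner (ev f w) y.

Definition disk : Type := {z : C | Cmod z < 1}.

Definition disk_val (z : disk) : C := proj1_sig z.
Coercion disk_val : disk >-> C.

Lemma Cmod_0_lt_1 : Cmod 0 < 1.
Proof. rewrite Cmod_0; lra. Qed.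

Definition disk0 : disk := exist _ (RtoC 0) Cmod_0_lt_1.

Section Hardy.
Variable Y : HilbertSpace.
Implicit Types f : disk -> Y.

Definition is_taylor f (a : nat -> Y) : Prop :=
  forall z : disk, is_pseries a (z : C) (f z).

(** The [n]-th Taylor coefficient at the origin of an analytic function. *)
Definition taylor f (n : nat) : Y :=
  iota (fun c : Y => exists a, is_taylor f a /\ a n = c).

Definition H2 f : Prop :=
  exists a, is_taylor f a /\ ex_series (fun n => norm (a n) ^ 2).

(** The squared norm of [H^2(Y)]. *)
Definition H2norm2 f : R := Series (fun n => norm (taylor f n) ^ 2).

(** [z |-> (f z - f 0) / z]; the value at the removable singularity is the
    derivative of [f] at [0]. *)
Definition backward_shift f (z : disk) : Y :=
  if Ceq_dec z 0 then taylor f 1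
  else scal (/ (z : C))%C (minus (f z) (f disk0)).

End Hardy.

(** An operator-valued function is analytic on the disk when it is the sum of
    a power series with bounded operator coefficients, converging in operator
    norm at each point of the disk. *)
Definition op_analytic (U Y : HilbertSpace) (S : disk -> U -> Y) : Prop :=
  exists Sn : nat -> U -> Y,
    (forall n, is_linear (Sn n)) /\
    forall (z : disk) (eps : posreal), eventually (fun N =>
      forall u : U,
        norm (minus (sum_n (fun n => scal (pow_n (z : C) n) (Sn n u)) N)
                    (S z u)) <= eps * norm u).

Definition Schur (U Y : HilbertSpace) (S : disk -> U -> Y) : Prop :=
  op_analytic S /\ forall z : disk, contraction (S z).

Section DeBrangesRovnyak.
Variables U Y : HilbertSpace.
Variable S : disk -> U -> Y.

(** The squared norm of [H(S)]. *)
Definition HSnorm2 (f : disk -> Y) : Rbar :=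
  Lub_Rbar (fun t : R => exists g : disk -> U,
    H2 g /\ t = H2norm2 (fun z => plus (f z) (S z (g z))) - H2norm2 g).

Definition HS (f : disk -> Y) : Prop :=
  H2 f /\ Rbar_lt (HSnorm2 f) p_infty.

(** [H] is the set [HS] with its squared norm [HSnorm2]; by polarization there
    is at most one such Hilbert space of functions. *)
Definition is_deBranges_Rovnyak (H : FunHilbert disk Y) : Prop :=
  (forall f : disk -> Y, HS f <-> exists h : H, forall z, ev h z = f z) /\
  (forall h : H, HSnorm2 (ev h) = Finite (norm h ^ 2)).

Definition deBranges_Rovnyak_kernel (z w : disk) (y : Y) : Y :=
  scal (/ (1 - z * Cconj w))%C (minus y (S z (adj (S w) y))).

End DeBrangesRovnyak.

(** The operator [R_0] on [H]; it has its meaning when [H] is invariant under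
    the backward shift.  Likewise for [tau] below. *)
Definition shift_op (Y : HilbertSpace) (H : FunHilbert disk Y) (f : H) : H :=
  of_fun H (backward_shift (ev f)).

Arguments shift_op {Y} H f.

Definition ev0 (Y : HilbertSpace) (H : FunHilbert disk Y) (f : H) : Y :=
  ev f disk0.

Arguments ev0 {Y} H f.

Definition tau (U Y : HilbertSpace) (S : disk -> U -> Y)
    (H : FunHilbert disk Y) (u : U) : H :=
  of_fun H (backward_shift (fun z => S z u)).

Arguments tau {U Y} S H u.

Definition canonical_colligation (U Y : HilbertSpace) (S : disk -> U -> Y)
    (H : FunHilbert disk Y) : hsum H U -> hsum H Y :=
  block (shift_op H) (tau S H) (ev0 H) (S disk0).

Arguments canonical_colligation {U Y} S H _.

(* Main.v *)
Require Import Defs.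
From Stdlib Require Import Reals Lra Lia.
From Stdlib Require Import ClassicalEpsilon FunctionalExtensionality PropExtensionality ProofIrrelevance.
From Coquelicot Require Import Coquelicot.
Open Scope R_scope.
Set Bullet Behavior "Strict Subproofs".

(** In Taylor coefficients, multiplication by [S] is a contraction [T] from l2(U) to l2(Y).
    If [c] sends an element of H(S) to its coefficients, the supremum defining the norm
    gives c c^* = I - T T^*; conversely, every injective operator [c] with this property
    identifies its domain with H(S).  One choice is the square root of I - T T^* on the
    orthogonal complement of its kernel, whence H(S) is a Hilbert space.  Since [c] is
    injective, the identities between R_0, tau, e(0), S(0) and their adjoints can be checked
    after applying [c], where they reduce to the commutation of [T] with the shift.

    A completely non-isometric contraction A is completed to a coisometric colligation
    [A B; C D] with C^2 = I - A^* A.  Its transfer function is a Schur function, and the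
    observability operator x |-> (C A^n x)_n, injective because A is completely
    non-isometric, is another choice of [c]. *)

(** * Vectors, sequences and operators in Hilbert spaces *)

(* The structure is pinned so that equal vector expressions are syntactically equal. *)
Notation vplus := (@plus (CompleteNormedModule.AbelianMonoid C_AbsRing (hilbert_car _))).
Notation vzero := (@zero (CompleteNormedModule.AbelianMonoid C_AbsRing (hilbert_car _))).
Notation vopp := (@opp (CompleteNormedModule.AbelianGroup C_AbsRing (hilbert_car _))).
Notation vminus := (@minus (CompleteNormedModule.AbelianGroup C_AbsRing (hilbert_car _))).
Notation vscal := (@scal C_Ring (CompleteNormedModule.ModuleSpace C_AbsRing (hilbert_car _))).

(** Pointwise contractivity of [S] says nothing directly about Taylor coefficients. The link is made
    by means over the roots of z^(2^p) = w with |w| = 1, for which the mean of |q|^2 is exactly the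
    sum of the squared coefficients of q when q has degree below 2^p. The definition of H(S) gives a
    supremum and no inner product. What makes it quadratic is that the gain |f + T g|^2 - |g|^2
    changes by an affine function of f when f moves by (I - T T^* ) v and g by T^* v; using both v
    and - v turns inequalities into an equality. Conversely, to put f in the range of [c], the test
    functions g = T^* v bound 2 Re <f, v> - |c^* v|^2, and a variational argument finds the
    preimage; the same argument inverts I - z A. In the realization, c c^* = I - T T^* is an energy
    balance: for a coisometric colligation |c^* v|^2 + |T^* v|^2 - |v|^2 does not change when v is
    replaced by its backward shift, and the iterated shifts of v tend to zero. *)

Section Vectors.
Variable H : HilbertSpace.
Implicit Types x y z : H.

Lemma inner_zero_l x : inner (vzero : H) x = 0.
Proof. rewrite inner_conj, inner_zero_r; apply injective_projections; simpl; ring. Qed.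

Lemma inner_opp_l x y : inner (vopp x) y = Copp (inner x y).
Proof. rewrite scal_m1, inner_scal_l; apply injective_projections; simpl; ring. Qed.

Lemma inner_opp_r x y : inner x (vopp y) = Copp (inner x y).
Proof. rewrite scal_m1, inner_scal_r; apply injective_projections; simpl; ring. Qed.

Lemma norm_sq_eq0 x : norm x ^ 2 = 0 -> x = vzero.
Proof.
  intros E; apply hilbert_norm0.
  generalize (norm_ge_0 x); intros; nra.
Qed.

Lemma minus_eq0 x y : vminus x y = vzero -> x = y.
Proof.
  intros E. rewrite <- (hilbert_plus_minus x y), E.
  exact (plus_zero_r (G := CompleteNormedModule.AbelianGroup _ H) y).
Qed.

Lemma inner_ext x y : (forall w, inner x w = inner y w) -> x = y.
Proof.
  intros E; apply minus_eq0, norm_sq_eq0.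
  rewrite norm2_inner, inner_minus_l, E; unfold Re; simpl; ring.
Qed.

Lemma inner_scal_0 x : inner x x = 0 -> x = vzero.
Proof. intros E; apply norm_sq_eq0; rewrite norm2_inner, E; reflexivity. Qed.

Lemma norm_sqrt_inner x : norm x = sqrt (Re (inner x x)).
Proof. rewrite <- norm2_inner, sqrt_pow2; trivial; apply norm_ge_0. Qed.

Lemma norm_opp' x : norm (vopp x) = norm x.
Proof.
  rewrite !norm_sqrt_inner, inner_opp_l, inner_opp_r; f_equal.
  unfold Re; simpl; ring.
Qed.

Lemma norm_zero' : norm (vzero : H) = 0.
Proof. rewrite norm_sqrt_inner, inner_zero_r; simpl; apply sqrt_0. Qed.

Lemma norm_scal' (a : C) x : norm (vscal a x) = Cmod a * norm x.
Proof.
  rewrite <- (sqrt_pow2 (norm (vscal a x))), norm2_scal by apply norm_ge_0.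
  rewrite <- Rpow_mult_distr; apply sqrt_pow2.
  apply Rmult_le_pos; [apply Cmod_ge_0 | apply norm_ge_0].
Qed.

Lemma norm_triangle' x y : norm (vplus x y) <= norm x + norm y.
Proof. exact (norm_triangle (V := CompleteNormedModule.NormedModule _ H) x y). Qed.

Lemma norm_minus_le x y : norm (vminus x y) <= norm x + norm y.
Proof. unfold vminus; rewrite <- (norm_opp' y); apply norm_triangle'. Qed.

Lemma Re_inner_le x y : Rabs (Re (inner x y)) <= norm x * norm y.
Proof.
  apply Rle_trans with (2 := Cauchy_Schwarz x y).
  unfold Re; generalize (Rmax_Cmod (inner x y)); generalize (Rmax_l (Rabs (fst (inner x y))) (Rabs (snd (inner x y)))); lra.
Qed.

Lemma Re_inner_am x y : 2 * Re (inner x y) <= norm x ^ 2 + norm y ^ 2.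
Proof. generalize (norm2_minus x y) (pow2_ge_0 (norm (vminus x y))); lra. Qed.

End Vectors.

#[global] Hint Rewrite inner_plus_l inner_plus_r inner_scal_l inner_scal_r inner_minus_l
  inner_minus_r inner_opp_l inner_opp_r inner_zero_l inner_zero_r : hil.
(** Vector identities are proved weakly: pairing with an arbitrary vector turns them into identities
    in C, where [ring] applies. *)
Ltac vec := apply inner_ext; intro; autorewrite with hil; try ring.

Section VectorIdentities.
Variable H : HilbertSpace.
Implicit Types x y z : H.
Lemma v_minus_self x : vminus x x = vzero. Proof. vec. Qed.
Lemma v_plus0l x : vplus vzero x = x. Proof. vec. Qed.
Lemma v_plus0r x : vplus x vzero = x. Proof. vec. Qed.
Lemma v_scal0r (a : C) : vscal a (vzero : H) = vzero. Proof. vec. Qed.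
Lemma v_minus_zero_r x : vminus x vzero = x. Proof. vec. Qed.

Lemma norm_minus_sym x y : norm (vminus x y) = norm (vminus y x).
Proof. rewrite <- norm_opp'; f_equal; vec. Qed.

Lemma norm_minus_trans x y z :
  norm (vminus x z) <= norm (vminus x y) + norm (vminus y z).
Proof.
  replace (vminus x z) with (vplus (vminus x y) (vminus y z)) by vec.
  apply norm_triangle'.
Qed.
End VectorIdentities.

(** Spelled out with real inequalities so that [lra] can use it; [tends_filterlim] relates it to
    filters. *)
Definition tends (H : HilbertSpace) (u : nat -> H) (l : H) : Prop :=
  forall eps, 0 < eps -> exists N, forall n, (N <= n)%nat -> norm (vminus (u n) l) < eps.

Section Sequences.
Variable H : HilbertSpace.
Implicit Types (u : nat -> H) (l : H).

Lemma tends_unique u l l' : tends H u l -> tends H u l' -> l = l'.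
Proof.
  intros A B; apply minus_eq0, hilbert_norm0.
  apply Rle_antisym; [| apply norm_ge_0].
  apply le_epsilon; intros e He.
  destruct (A (e / 2)) as [N HN]; [lra |].
  destruct (B (e / 2)) as [M HM]; [lra |].
  specialize (HN (N + M)%nat ltac:(lia)); specialize (HM (N + M)%nat ltac:(lia)).
  generalize (norm_minus_trans H l (u (N + M)%nat) l'); rewrite (norm_minus_sym H l (u _)); lra.
Qed.

Lemma tends_filterlim u l :
  tends H u l <-> filterlim u eventually (locally l).
Proof.
  rewrite (filterlim_locally_ball_norm (U := CompleteNormedModule.NormedModule _ H) u l).
  unfold ball_norm, eventually; split.
  - intros A eps; destruct (A eps (cond_pos eps)) as [N HN]; exists N; exact HN.
  - intros A eps He; destruct (A (mkposreal _ He)) as [N HN]; exists N; exact HN.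
Qed.

(** Completeness is given for Cauchy filters; it is applied to the image of [eventually] under the
    sequence. *)
Lemma cauchy_tends u :
  (forall eps, 0 < eps -> exists N, forall n m, (N <= n)%nat -> (N <= m)%nat ->
     norm (vminus (u n) (u m)) < eps) -> exists l, tends H u l.
Proof.
  intros A.
  set (F := filtermap u eventually).
  assert (PF : ProperFilter F) by (apply filtermap_proper_filter; apply eventually_filter).
  assert (CF : cauchy F).
  { intros eps; destruct (A eps (cond_pos eps)) as [N HN].
    exists (u N), N; intros n Hn.
    apply (norm_compat1 (V := CompleteNormedModule.NormedModule _ H)).
    now apply HN. }
  exists (lim F); apply tends_filterlim.
  apply filterlim_locally; intros eps.
  exact (complete_cauchy F PF CF eps).
Qed.

Lemma tends_error u l (e : nat -> R) :
  (forall n, norm (vminus (u n) l) <= e n) -> is_lim_seq e 0 -> tends H u l.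
Proof.
  intros A B eps He.
  apply is_lim_seq_spec in B; destruct (B (mkposreal _ He)) as [N HN]; exists N.
  intros n Hn; specialize (HN n Hn); simpl in HN.
  generalize (A n) (Rle_abs (e n - 0)); lra.
Qed.

End Sequences.

Section Linear.
Variables H K : HilbertSpace.
Implicit Types A B : H -> K.

Lemma lin_plus A : is_linear A -> forall x y : H, A (vplus x y) = vplus (A x) (A y).
Proof. intros L x y; exact (linear_plus A L x y). Qed.

Lemma lin_scal A : is_linear A -> forall (a : C) (x : H), A (vscal a x) = vscal a (A x).
Proof. intros L a x; exact (linear_scal A L a x). Qed.

Lemma lin_bound A : is_linear A -> exists M, 0 < M /\ forall x, norm (A x) <= M * norm x.
Proof. intros [_ _ L]; exact L. Qed.

Lemma lin_minus A : is_linear A -> forall x y : H, A (vminus x y) = vminus (A x) (A y).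
Proof. intros L x y; exact (linear_minus A x y L). Qed.

Lemma lin_zero A : is_linear A -> A vzero = vzero.
Proof. intros L; exact (linear_zero A L). Qed.

Lemma linear_of A (M : R) :
  (forall x y : H, A (vplus x y) = vplus (A x) (A y)) ->
  (forall (a : C) (x : H), A (vscal a x) = vscal a (A x)) ->
  (forall x, norm (A x) <= M * norm x) -> is_linear A.
Proof.
  intros P S B; split.
  - exact P.
  - exact S.
  (* [is_linear] asks for a strictly positive bound. *)
  - exists (Rabs M + 1); split; [generalize (Rabs_pos M); lra |].
    intros x; change (norm (A x) <= (Rabs M + 1) * norm x).
    generalize (B x) (norm_ge_0 x) (Rle_abs M); intros; nra.
Qed.

Lemma lin_tends A u l : is_linear A -> tends H u l -> tends K (fun n => A (u n)) (A l).
Proof.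
  intros L T eps He; destruct (lin_bound A L) as [M [HM B]].
  destruct (T (eps / M)) as [N HN]; [now apply Rdiv_lt_0_compat |].
  exists N; intros n Hn; rewrite <- lin_minus by trivial.
  apply Rle_lt_trans with (1 := B _).
  apply Rlt_le_trans with (M * (eps / M)).
  - apply Rmult_lt_compat_l; auto.
  - right; field; lra.
Qed.

Lemma lin_comp_plus A B : is_linear A -> is_linear B -> is_linear (fun x => vplus (A x) (B x)).
Proof.
  intros LA LB; destruct (lin_bound A LA) as [M [HM BA]], (lin_bound B LB) as [N [HN BB]].
  apply linear_of with (M + N).
  - intros x y; rewrite !lin_plus by trivial; vec.
  - intros a x; rewrite !lin_scal by trivial; vec.
  - intros x; generalize (norm_triangle' K (A x) (B x)) (BA x) (BB x); lra.
Qed.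

Lemma lin_comp_scal (a : C) A : is_linear A -> is_linear (fun x => vscal a (A x)).
Proof.
  intros LA; destruct (lin_bound A LA) as [M [HM BA]].
  apply linear_of with (Cmod a * M).
  - intros x y; rewrite !lin_plus by trivial; vec.
  - intros b x; rewrite !lin_scal by trivial; vec.
  - intros x; rewrite norm_scal', Rmult_assoc.
    apply Rmult_le_compat_l; [apply Cmod_ge_0 | trivial].
Qed.

Lemma lin_comp_minus A B : is_linear A -> is_linear B -> is_linear (fun x => vminus (A x) (B x)).
Proof.
  intros LA LB; destruct (lin_bound A LA) as [M [HM BA]], (lin_bound B LB) as [N [HN BB]].
  apply linear_of with (M + N).
  - intros x y; rewrite !lin_plus by trivial; vec.
  - intros a x; rewrite !lin_scal by trivial; vec.
  - intros x; generalize (norm_minus_le K (A x) (B x)) (BA x) (BB x); lra.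
Qed.

Lemma lin_comp (L : HilbertSpace) A (B : K -> L) :
  is_linear A -> is_linear B -> is_linear (fun x => B (A x)).
Proof. exact (is_linear_comp A B). Qed.

Lemma adj_unique A y x : is_linear A -> (forall z, inner (A z) y = inner z x) -> adj A y = x.
Proof.
  intros L E.
  apply inner_ext; intros w.
  now rewrite inner_conj, <- adjP, E, <- inner_conj.
Qed.

Lemma adjPr A z y : is_linear A -> inner y (A z) = inner (adj A y) z.
Proof. intros L; now rewrite inner_conj, (adjP _ _ L), <- inner_conj. Qed.

(** From |A^* y|^2 = <A A^* y, y> <= M |A^* y| |y|, dividing by |A^* y|; hence the separate case
    where it vanishes. *)
Lemma adj_bound A M : is_linear A -> 0 <= M -> (forall x, norm (A x) <= M * norm x) ->
  forall y, norm (adj A y) <= M * norm y.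
Proof.
  intros L M0 B y.
  assert (E : norm (adj A y) ^ 2 <= M * norm (adj A y) * norm y).
  { rewrite norm2_inner, <- adjP by trivial.
    generalize (Re_inner_le K (A (adj A y)) y) (Rle_abs (Re (inner (A (adj A y)) y))) (B (adj A y)) (norm_ge_0 y); nra. }
  generalize (norm_ge_0 (adj A y)) (norm_ge_0 y); intros.
  destruct (Req_dec (norm (adj A y)) 0) as [Z | Z]; [rewrite Z; apply Rmult_le_pos; lra |].
  apply Rmult_le_reg_l with (norm (adj A y)); nra.
Qed.

Lemma adj_linear A : is_linear A -> is_linear (adj A).
Proof.
  intros L; destruct (lin_bound A L) as [M [HM B]].
  assert (N := adj_bound A M L (Rlt_le _ _ HM) B).
  assert (P : forall x y : K, adj A (vplus x y) = vplus (adj A x) (adj A y)).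
  { intros x y; apply adj_unique; trivial; intros z.
    autorewrite with hil; now rewrite <- !adjP. }
  assert (S : forall (a : C) (x : K), adj A (vscal a x) = vscal a (adj A x)).
  { intros a x; apply adj_unique; trivial; intros z.
    autorewrite with hil; now rewrite <- !adjP. }
  split; [exact P | exact S | exists M; split; trivial].
Qed.

End Linear.
Arguments tends {H} u l.

(** * Hilbert spaces from inner products *)

Section MakeHilbert.
Variables (V : Type) (v0 : V) (vadd : V -> V -> V) (vneg : V -> V)
  (vmul : C -> V -> V) (ip : V -> V -> C).
Hypothesis vaddC : forall x y, vadd x y = vadd y x.
Hypothesis vaddA : forall x y z, vadd x (vadd y z) = vadd (vadd x y) z.
Hypothesis vadd0 : forall x, vadd x v0 = x.
Hypothesis vaddN : forall x, vadd x (vneg x) = v0.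
Hypothesis vmulA : forall a b x, vmul a (vmul b x) = vmul (Cmult a b) x.
Hypothesis vmul1 : forall x, vmul (RtoC 1) x = x.
Hypothesis vmulDr : forall a x y, vmul a (vadd x y) = vadd (vmul a x) (vmul a y).
Hypothesis vmulDl : forall a b x, vmul (Cplus a b) x = vadd (vmul a x) (vmul b x).
Hypothesis ipD : forall x y z, ip (vadd x y) z = Cplus (ip x z) (ip y z).
Hypothesis ipZ : forall a x y, ip (vmul a x) y = Cmult a (ip x y).
Hypothesis ipC : forall x y, ip y x = Cconj (ip x y).
Hypothesis ip_ge0 : forall x, 0 <= Re (ip x x).
Hypothesis ip_def : forall x, Re (ip x x) = 0 -> x = v0.

Let q x := Re (ip x x).
Let nrm x := sqrt (q x).
Let dst x y := nrm (vadd x (vneg y)).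

Hypothesis seq_complete : forall u : nat -> V,
  (forall eps, 0 < eps -> exists N, forall n m, (N <= n)%nat -> (N <= m)%nat ->
     dst (u n) (u m) < eps) ->
  exists l, forall eps, 0 < eps -> exists N, forall n, (N <= n)%nat -> dst (u n) l < eps.

Let qD x y : q (vadd x y) = q x + q y + 2 * Re (ip x y).
Proof.
  unfold q; rewrite ipD, (ipC (vadd x y)), ipD, (ipC (vadd x y)), ipD, (ipC x y).
  rewrite (ipC x x) at 1. unfold Re; simpl. 
  assert (E : fst (ip y x) = fst (ip x y)) by (rewrite (ipC x y); reflexivity).
  lra.
Qed.

Let qZ a x : q (vmul a x) = Cmod a ^ 2 * q x.
Proof.
  assert (I : Im (ip x x) = 0).
  { assert (E := ipC x x); apply (f_equal Im) in E; unfold Im in *; simpl in E; lra. }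
  unfold q; rewrite ipZ, (ipC (vmul a x)), ipZ, Cmod2_alt.
  unfold Re, Im in *; simpl; rewrite I; ring.
Qed.

Let nrm_ge0 x : 0 <= nrm x. Proof. apply sqrt_pos. Qed.
Let nrm_sq x : nrm x * nrm x = q x. Proof. apply sqrt_sqrt, ip_ge0. Qed.

Let ip0 z : ip v0 z = 0.
Proof.
  assert (E := ipD v0 v0 z); rewrite vadd0 in E.
  replace (ip v0 z) with (Cminus (Cplus (ip v0 z) (ip v0 z)) (ip v0 z)) at 1 by ring.
  rewrite <- E; ring.
Qed.

(** Expand the square of |y| x - |x| y, then cancel |x| |y|; vanishing norms are treated apart. *)
Let ip_CS x y : Re (ip x y) <= nrm x * nrm y.
Proof.
  assert (P : 0 <= nrm y ^ 2 * q x + nrm x ^ 2 * q y - 2 * (nrm y * nrm x * Re (ip x y))).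
  { assert (A := ip_ge0 (vadd (vmul (RtoC (nrm y)) x) (vmul (RtoC (- nrm x)) y))).
    fold (q (vadd (vmul (RtoC (nrm y)) x) (vmul (RtoC (- nrm x)) y))) in A.
    rewrite qD, !qZ, !Cmod_R, Rabs_Ropp, !Rabs_pos_eq in A by apply nrm_ge0.
    replace (Re (ip (vmul (RtoC (nrm y)) x) (vmul (RtoC (- nrm x)) y)))
      with (- (nrm y * nrm x * Re (ip x y))) in A; [lra |].
    rewrite ipZ, (ipC (vmul (RtoC (- nrm x)) y)), ipZ, (ipC x y); unfold Re; simpl; ring. }
  generalize (nrm_ge0 x) (nrm_ge0 y) (nrm_sq x) (nrm_sq y); intros nx ny ex ey.
  destruct (Req_dec (nrm x) 0) as [Zx | Zx].
  - rewrite Zx, Rmult_0_l in *.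
    rewrite (ip_def x) by auto; rewrite ip0; simpl; lra.
  - destruct (Req_dec (nrm y) 0) as [Zy | Zy].
    + rewrite Zy, Rmult_0_r in *.
      rewrite (ipC y x), (ip_def y) by auto; rewrite ip0; simpl; lra.
    + rewrite <- ex, <- ey in P.
      assert (0 < nrm y * nrm x) by (apply Rmult_lt_0_compat; lra).
      apply Rmult_le_reg_l with (nrm y * nrm x); nra.
Qed.

Let nrm_triangle x y : nrm (vadd x y) <= nrm x + nrm y.
Proof.
  apply Rsqr_incr_0_var; [| generalize (nrm_ge0 x) (nrm_ge0 y); lra].
  unfold Rsqr; rewrite nrm_sq, qD.
  generalize (ip_CS x y) (nrm_sq x) (nrm_sq y); nra.
Qed.

Let nrmZ a x : nrm (vmul a x) = Cmod a * nrm x.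
Proof.
  unfold nrm; rewrite qZ, sqrt_mult_alt by apply pow2_ge_0.
  rewrite sqrt_pow2; trivial; apply Cmod_ge_0.
Qed.

Let vadd0l x : vadd v0 x = x. Proof. now rewrite vaddC. Qed.

Let vmul0 x : vmul (RtoC 0) x = v0.
Proof.
  apply ip_def; fold (q (vmul (RtoC 0) x)); rewrite qZ, Cmod_0; ring.
Qed.

Let vneg_unique x y : vadd x y = v0 -> y = vneg x.
Proof.
  intros E; rewrite <- (vadd0 (vneg x)), <- E, vaddA, (vaddC (vneg x)), vaddN.
  now rewrite vadd0l.
Qed.

Let vnegE x : vneg x = vmul (RtoC (-1)) x.
Proof.
  symmetry; apply vneg_unique.
  rewrite <- (vmul1 x) at 1; rewrite <- vmulDl.
  replace (Cplus (RtoC 1) (RtoC (-1))) with (RtoC 0); [apply vmul0 |].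
  apply injective_projections; simpl; ring.
Qed.

Let dst_refl x : dst x x = 0.
Proof.
  unfold dst; rewrite vaddN, <- (vmul0 v0), nrmZ, Cmod_0; ring.
Qed.

Let dst_sym x y : dst x y = dst y x.
Proof.
  unfold dst.
  replace (vadd y (vneg x)) with (vmul (RtoC (-1)) (vadd x (vneg y))).
  - rewrite nrmZ, Cmod_R, Rabs_left; lra.
  - rewrite vmulDr, !vnegE, vmulA, vaddC; f_equal.
    rewrite <- (vmul1 y) at 2; f_equal.
    apply injective_projections; simpl; ring.
Qed.

Let dst_triangle x y z : dst x z <= dst x y + dst y z.
Proof.
  unfold dst.
  replace (vadd x (vneg z)) with (vadd (vadd x (vneg y)) (vadd y (vneg z))).
  - apply nrm_triangle.
  - rewrite <- vaddA, (vaddA (vneg y)), (vaddC (vneg y)), vaddN, vadd0l; trivial.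
Qed.

Let Gm := AbelianMonoid.Mixin V vadd v0 vaddC vaddA vadd0.
Let Gc := AbelianGroup.Class V Gm
  (AbelianGroup.Mixin (AbelianMonoid.Pack V Gm V) vneg vaddN).
Let Mc := ModuleSpace.Class C_Ring V Gc
  (ModuleSpace.Mixin C_Ring (AbelianGroup.Pack V Gc V) vmul vmulA vmul1 vmulDr vmulDl).

Let bl (x : V) (e : R) (y : V) : Prop := dst y x < e.

Let bl_center x (e : posreal) : bl x e x.
Proof. unfold bl; rewrite dst_refl; apply cond_pos. Qed.

Let bl_sym x y e : bl x e y -> bl y e x.
Proof. unfold bl; now rewrite dst_sym. Qed.

Let bl_triangle x y z e1 e2 : bl x e1 y -> bl y e2 z -> bl x (e1 + e2) z.
Proof. unfold bl; generalize (dst_triangle z y x); lra. Qed.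

Let Uc := UniformSpace.Mixin V v0 bl bl_center bl_sym bl_triangle.
Let Ac := NormedModuleAux.Class C_AbsRing V Mc Uc.

Let norm_ball x y (e : R) : dst y x < e -> bl x e y. Proof. trivial. Qed.
Let ball_norm' x y (e : posreal) : bl x e y -> dst y x < 1 * e.
Proof. unfold bl; lra. Qed.
Let nrm_eq0 x : nrm x = 0 -> x = v0.
Proof. intros E; apply ip_def; fold (q x); rewrite <- nrm_sq, E; ring. Qed.
Let nrmZ_le (a : C) x : nrm (vmul a x) <= Cmod a * nrm x.
Proof. right; apply nrmZ. Qed.

Let Nc := NormedModule.Class C_AbsRing V Ac
  (NormedModule.Mixin C_AbsRing (NormedModuleAux.Pack C_AbsRing V Ac V)
     nrm 1 nrm_triangle nrmZ_le norm_ball ball_norm' nrm_eq0).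
Let N := NormedModule.Pack C_AbsRing V Nc V.

(** Limits have to be a total function of the filter, so a point is chosen for every [F]; it is
    meaningful for Cauchy filters. *)
Let lm (F : (V -> Prop) -> Prop) : V :=
  epsilon (inhabits v0) (fun l => forall e : posreal, F (bl l e)).

(** A Cauchy filter contains balls of radius 1 / (n + 1) about points u_n. Two members of a proper
    filter meet, so the u_n form a Cauchy sequence, and its limit is a limit of the filter. *)
Let lm_cauchy (F : (N -> Prop) -> Prop) :
  ProperFilter F -> cauchy F -> forall e : posreal, F (bl (lm F) e).
Proof.
  intros PF CF; apply epsilon_spec.
  assert (Hp : forall n : nat, 0 < / (INR n + 1)).
  { intros n; apply Rinv_0_lt_compat; generalize (pos_INR n); lra. }
  assert (CF' : forall n, exists x, F (bl x (/ (INR n + 1)))).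
  { intros n; exact (CF (mkposreal _ (Hp n))). }
  assert (Small : forall e, 0 < e -> exists M, forall n, (M <= n)%nat -> / (INR n + 1) < e).
  { intros e He; destruct (archimed_cor1 e He) as [M [HM M0]]; exists M; intros n Hn.
    apply Rle_lt_trans with (2 := HM), Rinv_le_contravar.
    - apply lt_0_INR; trivial.
    - apply le_INR in Hn; lra. }
  assert (Meet : forall x y e d, F (bl x e) -> F (bl y d) -> dst x y < e + d).
  { intros x y e d Fx Fy.
    destruct (filter_ex _ (filter_and _ _ Fx Fy)) as [z [Zx Zy]].
    generalize (dst_triangle x z y); rewrite (dst_sym x z); unfold bl in *; lra. }
  set (u := fun n => proj1_sig (constructive_indefinite_description _ (CF' n))).
  assert (Hu : forall n, F (bl (u n) (/ (INR n + 1)))).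
  { intros n; exact (proj2_sig (constructive_indefinite_description _ (CF' n))). }
  destruct (seq_complete u) as [l Hl].
  - intros e He; destruct (Small (e / 2)) as [M HM]; [lra |]; exists M.
    intros n m Hn Hm; generalize (Meet _ _ _ _ (Hu n) (Hu m)) (HM n Hn) (HM m Hm); lra.
  - exists l; intros e.
    assert (He := cond_pos e).
    destruct (Small (e / 2)) as [M HM]; [lra |].
    destruct (Hl (e / 2)) as [M' HM']; [lra |].
    apply filter_imp with (2 := Hu (M + M')%nat).
    intros x Bx; unfold bl in *.
    generalize (HM (M + M')%nat ltac:(lia)) (HM' (M + M')%nat ltac:(lia)) (dst_triangle x (u (M + M')%nat) l); lra.
Qed.

(** Filters finer than each other are equal by extensionality, so the choice returns the same
    point. *)
Let lm_close (F1 F2 : (N -> Prop) -> Prop) :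
  filter_le F1 F2 -> filter_le F2 F1 -> @close (UniformSpace.Pack V Uc V) (lm F1) (lm F2).
Proof.
  intros L1 L2.
  replace F2 with F1; [intros e; apply bl_center |].
  extensionality P; apply propositional_extensionality; split; auto.
Qed.

Definition mkHilbert_space : CompleteNormedModule C_AbsRing :=
  CompleteNormedModule.Pack C_AbsRing V
    (CompleteNormedModule.Class C_AbsRing V Nc
       (CompleteSpace.Mixin N lm lm_cauchy lm_close)) V.

Let ip_norm x : ip x x = RtoC (nrm x ^ 2).
Proof.
  assert (E := ipC x x); apply (f_equal Im) in E; unfold Im in E; simpl in E.
  apply injective_projections.
  - simpl; rewrite Rmult_1_r, nrm_sq; reflexivity.
  - simpl; lra.
Qed.

Definition mkHilbert : HilbertSpace :=
  @Build_HilbertSpace mkHilbert_space ip ipD ipZ ipC ip_norm.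

End MakeHilbert.

(** * Orthogonal complements and square-summable sequences *)

Section OrthogonalComplement.
Variable H : HilbertSpace.
Variable K : H -> Prop.

Definition orth (x : H) : Prop := forall y, K y -> inner x y = 0.
Let V := {x : H | orth x}.

Let sub_eq (x y : V) : proj1_sig x = proj1_sig y -> x = y.
Proof.
  destruct x as [x Hx], y as [y Hy]; simpl; intros E; subst.
  f_equal; apply proof_irrelevance.
Qed.

Lemma orth_zero : orth vzero.
Proof. intros y _; apply inner_zero_l. Qed.
Lemma orth_plus x y : orth x -> orth y -> orth (vplus x y).
Proof. intros A B z Hz; rewrite inner_plus_l, A, B by trivial; ring. Qed.
Lemma orth_opp x : orth x -> orth (vopp x).
Proof. intros A z Hz; rewrite inner_opp_l, A by trivial; ring. Qed.
Lemma orth_scal a x : orth x -> orth (vscal a x).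
Proof. intros A z Hz; rewrite inner_scal_l, A by trivial; ring. Qed.

Lemma orth_closed u l : (forall n, orth (u n)) -> tends u l -> orth l.
Proof.
  intros A T y Hy.
  apply Cmod_eq_0, Rle_antisym; [| apply Cmod_ge_0].
  apply le_epsilon; intros e He.
  destruct (T (e / (norm y + 1))) as [N HN].
  { apply Rdiv_lt_0_compat; generalize (norm_ge_0 y); lra. }
  specialize (HN N (le_n N)).
  replace (inner l y) with (Copp (inner (vminus (u N) l) y)).
  - rewrite Cmod_opp; apply Rle_trans with (1 := Cauchy_Schwarz _ _).
    assert (P := norm_ge_0 y).
    apply Rle_trans with (e / (norm y + 1) * (norm y + 1)); [| right; field; lra].
    generalize (norm_ge_0 (vminus (u N) l)); nra.
  - rewrite inner_minus_l, (A N y Hy); ring.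
Qed.

Definition orth_compl : HilbertSpace.
Proof.
  refine (@mkHilbert V (exist _ vzero orth_zero)
    (fun x y => exist _ _ (orth_plus _ _ (proj2_sig x) (proj2_sig y)))
    (fun x => exist _ _ (orth_opp _ (proj2_sig x)))
    (fun a x => exist _ _ (orth_scal a _ (proj2_sig x)))
    (fun x y => inner (proj1_sig x) (proj1_sig y)) _ _ _ _ _ _ _ _ _ _ _ _ _ _);
    try (intros; apply sub_eq; simpl; vec; fail).
  - intros; apply inner_plus_l.
  - intros; apply inner_scal_l.
  - intros; apply inner_conj.
  - intros; rewrite <- norm2_inner; apply pow2_ge_0.
  - intros x E; apply sub_eq, norm_sq_eq0; rewrite norm2_inner; exact E.
  - intros u CU; simpl in CU.
    destruct (cauchy_tends _ (fun n => proj1_sig (u n))) as [l Hl].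
    + intros e He; destruct (CU e He) as [N HN]; exists N; intros n m Hn Hm.
      rewrite norm_sqrt_inner; exact (HN n m Hn Hm).
    + exists (exist _ l (orth_closed _ _ (fun n => proj2_sig (u n)) Hl)).
      intros e He; destruct (Hl e He) as [N HN]; exists N; intros n Hn.
      specialize (HN n Hn); rewrite norm_sqrt_inner in HN; exact HN.
Defined.

Definition orth_val (x : orth_compl) : H := proj1_sig x.

Lemma orth_val_inj x y : orth_val x = orth_val y -> x = y.
Proof. exact (sub_eq x y). Qed.

Lemma orth_val_orth x : orth (orth_val x).
Proof. exact (proj2_sig x). Qed.

Lemma orth_val_ex x : orth x -> exists y, orth_val y = x.
Proof. intros A; exists (exist _ x A); trivial. Qed.

Lemma orth_val_inner x y : inner (orth_val x) (orth_val y) = inner x y.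
Proof. reflexivity. Qed.

Lemma orth_val_linear : is_linear orth_val.
Proof.
  apply linear_of with 1; try reflexivity.
  intros x; rewrite !norm_sqrt_inner, orth_val_inner; lra.
Qed.

End OrthogonalComplement.

Section RealSeries.
Implicit Types x y : nat -> R.

Lemma sum_n_S x n : sum_n x (S n) = sum_n x n + x (S n).
Proof. exact (sum_Sn x n). Qed.

Lemma sum_n_0 x : sum_n x 0 = x 0%nat.
Proof. exact (sum_O x). Qed.

Lemma sum_n_le_Series x : (forall n, 0 <= x n) -> ex_series x -> forall N, sum_n x N <= Series x.
Proof.
  intros P E N.
  assert (L := Series_correct _ E).
  assert (I : forall n, sum_n x n <= sum_n x (S n)) by (intros n; rewrite sum_n_S; generalize (P (S n)); lra).
  exact (is_lim_seq_incr_compare (sum_n x) (Series x) L I N).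
Qed.

Lemma bounded_ex_series x M : (forall n, 0 <= x n) -> (forall N, sum_n x N <= M) -> ex_series x.
Proof.
  intros P B.
  destruct (ex_finite_lim_seq_incr (sum_n x) M) as [l Hl].
  - intros n; rewrite sum_n_S; generalize (P (S n)); lra.
  - exact B.
  - exists l; exact Hl.
Qed.

Lemma Series_le_bound x M : ex_series x -> (forall N, sum_n x N <= M) -> Series x <= M.
Proof.
  intros E B.
  assert (L : is_lim_seq (sum_n x) (Series x)) by exact (Series_correct _ E).
  exact (is_lim_seq_le (sum_n x) (fun _ => M) (Series x) M B L (is_lim_seq_const M)).
Qed.

Lemma ex_series_dom x y : (forall n, Rabs (x n) <= y n) -> ex_series y -> ex_series x.
Proof. intros D; exact (ex_series_le x y D). Qed.

Lemma sum_n_lim (u : nat -> nat -> R) x N :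
  (forall n, is_lim_seq (fun k => u k n) (x n)) ->
  is_lim_seq (fun k => sum_n (u k) N) (sum_n x N).
Proof.
  intros L; induction N as [| N IH].
  - rewrite sum_n_0; apply is_lim_seq_ext with (2 := L 0%nat); intros; now rewrite sum_n_0.
  - rewrite sum_n_S.
    apply is_lim_seq_ext with (u := fun k => sum_n (u k) N + u k (S N)).
    + intros; now rewrite sum_n_S.
    + now apply is_lim_seq_plus'.
Qed.

Lemma Series_nonneg x : (forall n, 0 <= x n) -> ex_series x -> 0 <= Series x.
Proof.
  intros P E; apply Rle_trans with (2 := sum_n_le_Series _ P E 0).
  rewrite sum_n_0; auto.
Qed.

Lemma term_le_Series x : (forall n, 0 <= x n) -> ex_series x -> forall n, x n <= Series x.
Proof.
  intros P E n; apply Rle_trans with (2 := sum_n_le_Series _ P E n).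
  destruct n; [rewrite sum_n_0; lra |].
  rewrite sum_n_S.
  assert (Q : 0 <= sum_n x n).
  { clear E; induction n; [rewrite sum_n_0; auto | rewrite sum_n_S; generalize (P (S n)); lra]. }
  lra.
Qed.

End RealSeries.

Lemma tends_norm_minus (H : HilbertSpace) (u : nat -> H) l x :
  tends u l -> is_lim_seq (fun n => norm (vminus x (u n))) (norm (vminus x l)).
Proof.
  intros T; apply is_lim_seq_spec; intros e.
  destruct (T e (cond_pos e)) as [N HN]; exists N; intros n Hn.
  specialize (HN n Hn).
  generalize (norm_minus_trans H x (u n) l) (norm_minus_trans H x l (u n)).
  rewrite (norm_minus_sym H l (u n)); intros.
  apply Rabs_lt_between'; lra.
Qed.

Section L2.
Variable Y : HilbertSpace.
Implicit Types a b : nat -> Y.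

Definition sqsum a : Prop := ex_series (fun n => norm (a n) ^ 2).
Let V := {a : nat -> Y | sqsum a}.

Let l2_eq (x y : V) : (forall n, proj1_sig x n = proj1_sig y n) -> x = y.
Proof.
  destruct x as [x Hx], y as [y Hy]; simpl; intros E.
  assert (E' : x = y) by (now extensionality n); subst.
  f_equal; apply proof_irrelevance.
Qed.

Lemma sqsum_zero : sqsum (fun _ => vzero).
Proof.
  apply bounded_ex_series with 0.
  - intros; apply pow2_ge_0.
  - intros N; rewrite norm_zero'; induction N as [| N IH]; [rewrite sum_n_0 | rewrite sum_n_S]; lra.
Qed.

Lemma sqsum_plus a b : sqsum a -> sqsum b -> sqsum (fun n => vplus (a n) (b n)).
Proof.
  intros A B; apply ex_series_dom with (fun n => 2 * norm (a n) ^ 2 + 2 * norm (b n) ^ 2).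
  - intros n; rewrite Rabs_pos_eq by apply pow2_ge_0.
    rewrite norm2_plus; generalize (Re_inner_am Y (a n) (b n)); lra.
  - exact (ex_series_plus (V := R_NormedModule) _ _ (ex_series_scal 2 _ A) (ex_series_scal 2 _ B)).
Qed.

Lemma sqsum_scal c a : sqsum a -> sqsum (fun n => vscal c (a n)).
Proof.
  intros A; apply ex_series_ext with (fun n => Cmod c ^ 2 * norm (a n) ^ 2).
  - intros n; symmetry; apply norm2_scal.
  - exact (ex_series_scal (Cmod c ^ 2) _ A).
Qed.

Lemma sqsum_opp a : sqsum a -> sqsum (fun n => vopp (a n)).
Proof.
  intros A; apply ex_series_ext with (2 := A).
  intros n; now rewrite norm_opp'.
Qed.

Let re a b n := Re (inner (a n) (b n)).
Let im a b n := Im (inner (a n) (b n)).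

Let ex_ip a b : sqsum a -> sqsum b -> ex_series (re a b) /\ ex_series (im a b).
Proof.
  intros A B.
  assert (E : ex_series (fun n => norm (a n) ^ 2 + norm (b n) ^ 2)) by exact (ex_series_plus (V := R_NormedModule) _ _ A B).
  assert (D : forall n, Rmax (Rabs (re a b n)) (Rabs (im a b n)) <= norm (a n) ^ 2 + norm (b n) ^ 2).
  { intros n; apply Rle_trans with (1 := Rmax_Cmod _), Rle_trans with (1 := Cauchy_Schwarz _ _).
    generalize (pow2_ge_0 (norm (a n) - norm (b n))); generalize (pow2_ge_0 (norm (a n))) (pow2_ge_0 (norm (b n))); lra. }
  split; apply ex_series_dom with (2 := E); intros n.
  - apply Rle_trans with (1 := Rmax_l _ _) (2 := D n).
  - apply Rle_trans with (1 := Rmax_r _ _) (2 := D n).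
Qed.

Let ip (x y : V) : C :=
  (Series (re (proj1_sig x) (proj1_sig y)), Series (im (proj1_sig x) (proj1_sig y))).

Let ip_self x : Re (ip x x) = Series (fun n => norm (proj1_sig x n) ^ 2).
Proof.
  apply Series_ext; intros n; unfold re; symmetry; apply norm2_inner.
Qed.

(** Coordinates converge since each is dominated by the norm. The Cauchy bound is kept for finite
    sums, where the limit in the second index can be taken, and only then passed to the series. *)
Let cauchy_l2 (u : nat -> V) :
  let dst (x y : V) := sqrt (Series (fun n => norm (vminus (proj1_sig x n) (proj1_sig y n)) ^ 2)) in
  (forall eps, 0 < eps -> exists N, forall n m, (N <= n)%nat -> (N <= m)%nat ->
     dst (u n) (u m) < eps) ->
  exists l, forall eps, 0 < eps -> exists N, forall n, (N <= n)%nat -> dst (u n) l < eps.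
Proof.
  intros dst CU.
  assert (SM : forall a b, sqsum a -> sqsum b -> sqsum (fun n => vminus (a n) (b n))).
  { intros a b A B; apply sqsum_plus; trivial; now apply sqsum_opp. }
  assert (P : forall (a b : nat -> Y) n, 0 <= norm (vminus (a n) (b n)) ^ 2) by (intros; apply pow2_ge_0).
  assert (CB : forall eps, 0 < eps -> exists N, forall n m, (N <= n)%nat -> (N <= m)%nat -> forall M,
     sum_n (fun k => norm (vminus (proj1_sig (u n) k) (proj1_sig (u m) k)) ^ 2) M <= eps ^ 2).
  { intros e He; destruct (CU e He) as [N HN]; exists N; intros n m Hn Hm M.
    specialize (HN n m Hn Hm); unfold dst in HN.
    eapply Rle_trans; [apply sum_n_le_Series |].
    - apply P.
    - apply SM; apply proj2_sig.
    - apply Rlt_le; apply sqrt_lt_0_alt.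
      rewrite sqrt_pow2 by lra; exact HN. }
  assert (CC : forall k, exists l, tends (fun n => proj1_sig (u n) k) l).
  { intros k; apply cauchy_tends; intros e He.
    destruct (CB (e / 2)) as [N HN]; [lra |]; exists N; intros n m Hn Hm.
    specialize (HN n m Hn Hm k).
    assert (B : norm (vminus (proj1_sig (u n) k) (proj1_sig (u m) k)) ^ 2 <= (e / 2) ^ 2).
    { apply Rle_trans with (2 := HN).
      set (x := fun k => norm (vminus (proj1_sig (u n) k) (proj1_sig (u m) k)) ^ 2).
      change (x k <= sum_n x k).
      assert (Px : forall n, 0 <= x n) by (intros; apply P).
      destruct k; [rewrite sum_n_0; lra |]; rewrite sum_n_S.
      assert (Q : 0 <= sum_n x k); [| lra].
      clear HN; clearbody x; induction k; [rewrite sum_n_0; auto | rewrite sum_n_S; generalize (Px (S k)); lra]. }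
    generalize (norm_ge_0 (vminus (proj1_sig (u n) k) (proj1_sig (u m) k))); intros; nra. }
  set (l := fun k => proj1_sig (constructive_indefinite_description _ (CC k))).
  assert (Hl : forall k, tends (fun n => proj1_sig (u n) k) (l k)).
  { intros k; exact (proj2_sig (constructive_indefinite_description _ (CC k))). }
  assert (LB : forall eps, 0 < eps -> exists N, forall n, (N <= n)%nat -> forall M,
     sum_n (fun k => norm (vminus (proj1_sig (u n) k) (l k)) ^ 2) M <= eps ^ 2).
  { intros e He; destruct (CB e He) as [N HN]; exists N; intros n Hn M.
    apply (is_lim_seq_le_loc (fun m => sum_n (fun k => norm (vminus (proj1_sig (u n) k) (proj1_sig (u m) k)) ^ 2) M)
            (fun _ => e ^ 2)
            (sum_n (fun k => norm (vminus (proj1_sig (u n) k) (l k)) ^ 2) M) (e ^ 2)).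
    - exists N; intros m Hm; apply HN; trivial.
    - apply (sum_n_lim (fun m k => norm (vminus (proj1_sig (u n) k) (proj1_sig (u m) k)) ^ 2)).
      intros k.
      apply is_lim_seq_ext with (fun m => norm (vminus (proj1_sig (u n) k) (proj1_sig (u m) k)) * norm (vminus (proj1_sig (u n) k) (proj1_sig (u m) k))).
      + intros; simpl; ring.
      + replace (norm (vminus (proj1_sig (u n) k) (l k)) ^ 2) with (norm (vminus (proj1_sig (u n) k) (l k)) * norm (vminus (proj1_sig (u n) k) (l k))) by ring.
        apply is_lim_seq_mult'; apply tends_norm_minus; apply Hl.
    - apply is_lim_seq_const. }
  assert (SL : sqsum l).
  { destruct (LB 1) as [N HN]; [lra |].
    assert (D : sqsum (fun k => vminus (proj1_sig (u N) k) (l k))).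
    { apply bounded_ex_series with (1 ^ 2); [apply P | apply HN, le_n]. }
    unfold sqsum; apply ex_series_ext with (fun n => norm (vminus (proj1_sig (u N) n) (vminus (proj1_sig (u N) n) (l n))) ^ 2).
    - intros n; f_equal; f_equal; vec.
    - apply (SM _ _ (proj2_sig (u N)) D). }
  exists (exist _ l SL); intros e He.
  destruct (LB (e / 2)) as [N HN]; [lra |]; exists N; intros n Hn.
  apply Rle_lt_trans with (e / 2); [| lra].
  unfold dst; rewrite <- (sqrt_pow2 (e / 2)) by lra.
  apply sqrt_le_1_alt, Series_le_bound.
  - apply (SM _ _ (proj2_sig (u n)) SL).
  - apply HN; trivial.
Qed.

Definition l2 : HilbertSpace.
Proof.
  refine (@mkHilbert V (exist _ _ sqsum_zero)
    (fun x y => exist _ _ (sqsum_plus _ _ (proj2_sig x) (proj2_sig y)))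
    (fun x => exist _ _ (sqsum_opp _ (proj2_sig x)))
    (fun c x => exist _ _ (sqsum_scal c _ (proj2_sig x)))
    ip _ _ _ _ _ _ _ _ _ _ _ _ _ _);
    try (intros; apply l2_eq; intros; simpl; vec; fail).
  - intros x y z.
    destruct (ex_ip _ _ (proj2_sig x) (proj2_sig z)), (ex_ip _ _ (proj2_sig y) (proj2_sig z)).
    apply injective_projections; simpl; rewrite <- Series_plus by trivial;
      apply Series_ext; intros n; unfold re, im; rewrite inner_plus_l; reflexivity.
  - intros c x y; destruct (ex_ip _ _ (proj2_sig x) (proj2_sig y)) as [E1 E2].
    assert (F : forall r z, ex_series z -> ex_series (fun n => r * z n)) by (intros r z Z; exact (ex_series_scal r z Z)).
    apply injective_projections; simpl; rewrite <- !Series_scal_l.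
    + rewrite <- Series_minus by auto.
      apply Series_ext; intros n; unfold re, im; rewrite inner_scal_l; reflexivity.
    + rewrite <- Series_plus by auto.
      apply Series_ext; intros n; unfold re, im; rewrite inner_scal_l; reflexivity.
  - intros x y; apply injective_projections; simpl.
    + apply Series_ext; intros n; unfold re; apply Re_inner_sym.
    + rewrite <- Series_opp; apply Series_ext; intros n; unfold im; rewrite (inner_conj _ (proj1_sig x n)); unfold Im; simpl; ring.
  - intros x; rewrite ip_self; apply Series_nonneg; [intros; apply pow2_ge_0 | apply proj2_sig].
  - intros x E; rewrite ip_self in E; apply l2_eq; intros n; simpl.
    apply norm_sq_eq0, Rle_antisym; [| apply pow2_ge_0].
    rewrite <- E; apply (term_le_Series (fun n => norm (proj1_sig x n) ^ 2));
      [intros; apply pow2_ge_0 | apply proj2_sig].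
  - intros u CU.
    destruct (cauchy_l2 u) as [l Hl].
    + intros e He; destruct (CU e He) as [N HN]; exists N; intros n m Hn Hm.
      specialize (HN n m Hn Hm); rewrite ip_self in HN; exact HN.
    + exists l; intros e He; destruct (Hl e He) as [N HN]; exists N; intros n Hn.
      rewrite ip_self; apply HN; trivial.
Defined.

Definition co (a : l2) (n : nat) : Y := proj1_sig a n.

Lemma co_ext (a b : l2) : (forall n, co a n = co b n) -> a = b.
Proof. exact (l2_eq a b). Qed.

Lemma co_sqsum (a : l2) : sqsum (co a).
Proof. exact (proj2_sig a). Qed.

Definition l2_of (a : nat -> Y) (Ha : sqsum a) : l2 := exist _ a Ha.

Lemma co_plus (a b : l2) n : co (vplus a b) n = vplus (co a n) (co b n).
Proof. reflexivity. Qed.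
Lemma co_scal c (a : l2) n : co (vscal c a) n = vscal c (co a n).
Proof. reflexivity. Qed.
Lemma co_zero n : co vzero n = vzero.
Proof. reflexivity. Qed.

Lemma l2_norm (a : l2) : norm a ^ 2 = Series (fun n => norm (co a n) ^ 2).
Proof. rewrite norm2_inner; exact (ip_self a). Qed.

(** The tails enter as arbitrary elements with the shifted coordinates, the backward shift [tl]
    being defined only later. *)
Lemma l2_inner_tail (a : l2) (b : l2) :
  (forall n, co b n = co a (S n)) ->
  forall a' b' : l2, (forall n, co b' n = co a' (S n)) ->
  inner a a' = Cplus (inner (co a 0) (co a' 0)) (inner b b').
Proof.
  intros E a' b' E'.
  destruct (ex_ip _ _ (co_sqsum a) (co_sqsum a')) as [E1 E2].
  apply injective_projections; simpl.
  - change (Series (re (co a) (co a')) = Re (inner (co a 0) (co a' 0)) + Series (re (co b) (co b'))).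
    rewrite Series_incr_1 by trivial; unfold re at 1; f_equal.
    apply Series_ext; intros n; unfold re; now rewrite E, E'.
  - change (Series (im (co a) (co a')) = Im (inner (co a 0) (co a' 0)) + Series (im (co b) (co b'))).
    rewrite Series_incr_1 by trivial; unfold im at 1; f_equal.
    apply Series_ext; intros n; unfold im; now rewrite E, E'.
Qed.

End L2.
#[global] Arguments l2 : simpl never.
#[global] Arguments orth_compl : simpl never.

(** * Square roots and ranges of operators *)

Lemma tends_choice (A : Type) (H : HilbertSpace) (u : nat -> A -> H) :
  (forall x, exists l, tends (fun n => u n x) l) ->
  exists v : A -> H, forall x, tends (fun n => u n x) (v x).
Proof.
  intros E; exists (fun x => proj1_sig (constructive_indefinite_description _ (E x))).
  intros x; exact (proj2_sig (constructive_indefinite_description _ (E x))).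
Qed.

Lemma tends_plus (H : HilbertSpace) (u v : nat -> H) l m :
  tends u l -> tends v m -> tends (fun n => vplus (u n) (v n)) (vplus l m).
Proof.
  intros A B e He; destruct (A (e / 2)) as [N HN]; [lra |].
  destruct (B (e / 2)) as [M HM]; [lra |]; exists (N + M)%nat; intros n Hn.
  specialize (HN n ltac:(lia)); specialize (HM n ltac:(lia)).
  replace (vminus (vplus (u n) (v n)) (vplus l m)) with (vplus (vminus (u n) l) (vminus (v n) m)) by vec.
  generalize (norm_triangle' H (vminus (u n) l) (vminus (v n) m)); lra.
Qed.

Lemma tends_ext (H : HilbertSpace) (u v : nat -> H) l :
  (forall n, u n = v n) -> tends u l -> tends v l.
Proof.
  intros E A e He; destruct (A e He) as [N HN]; exists N; intros n Hn; rewrite <- E; auto.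
Qed.

Lemma tends_scal (H : HilbertSpace) (a : C) (u : nat -> H) l :
  tends u l -> tends (fun n => vscal a (u n)) (vscal a l).
Proof.
  intros A; apply (lin_tends H H (fun x => vscal a x)); trivial.
  apply lin_comp_scal; exact is_linear_id.
Qed.

Lemma tends_norm_le (H : HilbertSpace) (u : nat -> H) l M :
  tends u l -> (forall n, norm (u n) <= M) -> norm l <= M.
Proof.
  intros A B; apply le_epsilon; intros e He; destruct (A e He) as [N HN].
  specialize (HN N (le_n N)).
  replace l with (vminus (u N) (vminus (u N) l)) by vec.
  generalize (norm_minus_le H (u N) (vminus (u N) l)) (B N); lra.
Qed.

(** This lets the symmetry <P_k x, y> = <x, P_k y> pass to pointwise limits of operators. *)
Lemma tends_inner_eq (H : HilbertSpace) (u v : nat -> H) l m x y :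
  tends u l -> tends v m -> (forall n, inner (u n) y = inner x (v n)) -> inner l y = inner x m.
Proof.
  intros A B E.
  assert (Z : Cminus (inner l y) (inner x m) = 0).
  { apply Cmod_eq_0, Rle_antisym; [| apply Cmod_ge_0].
    apply le_epsilon; intros e He.
    assert (Nx := norm_ge_0 x); assert (Ny := norm_ge_0 y).
    destruct (A (e / (norm x + norm y + 1))) as [N HN]; [apply Rdiv_lt_0_compat; lra |].
    destruct (B (e / (norm x + norm y + 1))) as [M HM]; [apply Rdiv_lt_0_compat; lra |].
    set (d := e / (norm x + norm y + 1)) in *.
    specialize (HN (N + M)%nat ltac:(lia)); specialize (HM (N + M)%nat ltac:(lia)).
    replace (Cminus (inner l y) (inner x m)) with
      (Cplus (inner x (vminus (v (N + M)%nat) m)) (Copp (inner (vminus (u (N + M)%nat) l) y))).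
    - apply Rle_trans with (1 := Cmod_triangle _ _); rewrite Cmod_opp.
      assert (C1 := Cauchy_Schwarz x (vminus (v (N + M)%nat) m)).
      assert (C2 := Cauchy_Schwarz (vminus (u (N + M)%nat) l) y).
      assert (D : d * (norm x + norm y + 1) = e) by (unfold d; field; lra).
      generalize (norm_ge_0 (vminus (v (N + M)%nat) m)) (norm_ge_0 (vminus (u (N + M)%nat) l)).
      intros; nra.
    - rewrite inner_minus_l, inner_minus_r, E; ring. }
  replace (inner l y) with (Cplus (Cminus (inner l y) (inner x m)) (inner x m)) by ring.
  rewrite Z; ring.
Qed.

Section SquareRoot.
Variable H : HilbertSpace.
Variable E : H -> H.
Hypothesis E_lin : is_linear E.
Hypothesis E_contr : forall x, norm (E x) <= norm x.
Hypothesis E_sym : forall x y, inner (E x) y = inner x (E y).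

Fixpoint iterP (k : nat) (x : H) : H :=
  match k with
  | O => vzero
  | S k => vscal (RtoC (/ 2)) (vplus (E x) (iterP k (iterP k x)))
  end.

Fixpoint iterp (k : nat) : R :=
  match k with
  | O => 0
  | S k => (1 + iterp k ^ 2) / 2
  end.

Lemma iterp_range k : 0 <= iterp k <= 1.
Proof. induction k; simpl in *; nra. Qed.

Lemma iterp_incr k : iterp k <= iterp (S k).
Proof.
  induction k; simpl in *; [lra |].
  generalize (iterp_range k) (iterp_range (S k)); simpl; intros; nra.
Qed.

Lemma iterP_plus k : forall x y, iterP k (vplus x y) = vplus (iterP k x) (iterP k y).
Proof.
  induction k; intros x y; simpl; [vec |].
  rewrite !IHk, (lin_plus _ _ _ E_lin); vec.
Qed.

Lemma iterP_scal k : forall (a : C) x, iterP k (vscal a x) = vscal a (iterP k x).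
Proof.
  induction k; intros a x; simpl; [vec |].
  rewrite !IHk, (lin_scal _ _ _ E_lin); vec.
Qed.

Lemma Cmod_half : Cmod (RtoC (/ 2)) = / 2.
Proof. rewrite Cmod_R, Rabs_pos_eq; lra. Qed.

Lemma iterP_norm k : forall x, norm (iterP k x) <= iterp k * norm x.
Proof.
  induction k; intros x; simpl.
  - rewrite norm_zero'; lra.
  - rewrite norm_scal', Cmod_half.
    generalize (norm_triangle' H (E x) (iterP k (iterP k x))) (E_contr x) (IHk (iterP k x)) (IHk x) (iterp_range k) (norm_ge_0 x).
    intros; nra.
Qed.

Lemma iterP_lin k : is_linear (iterP k).
Proof. apply linear_of with (iterp k); [apply iterP_plus | apply iterP_scal | apply iterP_norm]. Qed.

(** With P' = P_(k+1) and P = P_k one has 2 (P_(k+2) - P') = P' (P' - P) + (P' - P) P, an identity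
    that needs no commutation. For the scalars the same expression is p'^2 - p^2. *)
Lemma iterP_step k : forall x,
  norm (vminus (iterP (S k) x) (iterP k x)) <= (iterp (S k) - iterp k) * norm x.
Proof.
  induction k; intros x.
  - simpl; rewrite v_minus_zero_r, v_plus0r, norm_scal', Cmod_half.
    generalize (E_contr x); lra.
  - set (P' := iterP (S k)); set (P := iterP k).
    replace (vminus (iterP (S (S k)) x) (P' x))
      with (vscal (RtoC (/ 2)) (vplus (P' (vminus (P' x) (P x))) (vminus (P' (P x)) (P (P x))))).
    + rewrite norm_scal', Cmod_half.
      assert (A := norm_triangle' H (P' (vminus (P' x) (P x))) (vminus (P' (P x)) (P (P x)))).
      assert (B := iterP_norm (S k) (vminus (P' x) (P x))).
      assert (D := IHk x); assert (F := IHk (P x)); assert (G := iterP_norm k x).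
      fold P P' in A, B, D, F, G.
      assert (I := iterp_incr k); assert (R1 := iterp_range k); assert (R2 := iterp_range (S k)).
      assert (F' : norm (vminus (P' (P x)) (P (P x))) <= (iterp (S k) - iterp k) * (iterp k * norm x)).
      { apply Rle_trans with (1 := F); apply Rmult_le_compat_l; lra. }
      assert (B' : norm (P' (vminus (P' x) (P x))) <= iterp (S k) * ((iterp (S k) - iterp k) * norm x)).
      { apply Rle_trans with (1 := B); apply Rmult_le_compat_l; lra. }
      change (iterp (S (S k))) with ((1 + iterp (S k) ^ 2) / 2).
      replace ((1 + iterp (S k) ^ 2) / 2 - iterp (S k)) with ((iterp (S k) ^ 2 - iterp k ^ 2) / 2) by (simpl iterp; field).
      lra.
    + unfold P'; rewrite (lin_minus _ _ _ (iterP_lin (S k))); fold P'.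
      change (iterP (S (S k)) x) with (vscal (RtoC (/ 2)) (vplus (E x) (P' (P' x)))).
      assert (Ex : forall y, P' y = vscal (RtoC (/ 2)) (vplus (E y) (P (P y)))) by reflexivity.
      apply inner_ext; intros w; autorewrite with hil.
      assert (F := f_equal (fun y => inner y w) (Ex x)); cbv beta in F.
      autorewrite with hil in F; rewrite F; change (iterP (S k) x) with (P' x); ring.
Qed.

Lemma iterP_steps k m x :
  norm (vminus (iterP (k + m) x) (iterP k x)) <= (iterp (k + m) - iterp k) * norm x.
Proof.
  induction m.
  - rewrite Nat.add_0_r, v_minus_self, norm_zero'; lra.
  - rewrite Nat.add_succ_r.
    generalize (norm_minus_trans H (iterP (S (k + m)) x) (iterP (k + m) x) (iterP k x)) (iterP_step (k + m) x); lra.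
Qed.

Lemma iterP_cauchy x : exists l, tends (fun k => iterP k x) l.
Proof.
  destruct (ex_finite_lim_seq_incr iterp 1 iterp_incr (fun k => proj2 (iterp_range k))) as [l Hl].
  assert (Le : forall k, iterp k <= l) by exact (is_lim_seq_incr_compare iterp l Hl iterp_incr).
  apply cauchy_tends; intros e He.
  assert (Nx := norm_ge_0 x).
  assert (Hd : 0 < e / (2 * (norm x + 1))) by (apply Rdiv_lt_0_compat; lra).
  apply is_lim_seq_spec in Hl; destruct (Hl (mkposreal _ Hd)) as [N HN].
  exists N.
  assert (A : forall n, (N <= n)%nat -> norm (vminus (iterP n x) (iterP N x)) < e / 2).
  { intros n Hn; replace n with (N + (n - N))%nat by lia.
    apply Rle_lt_trans with (1 := iterP_steps N (n - N) x).
    specialize (HN N (le_n N)); simpl in HN; apply Rabs_lt_between' in HN.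
    assert (B := Le (N + (n - N))%nat).
    apply Rle_lt_trans with (e / (2 * (norm x + 1)) * norm x).
    - apply Rmult_le_compat_r; lra.
    - apply Rlt_le_trans with (e / (2 * (norm x + 1)) * (norm x + 1)); [nra | right; field; lra]. }
  intros n m Hn Hm.
  generalize (norm_minus_trans H (iterP n x) (iterP N x) (iterP m x)) (A n Hn) (A m Hm).
  rewrite (norm_minus_sym H (iterP N x)); lra.
Qed.

(* [P_(k+1) = (E + P_k^2) / 2] is dominated by the same recursion for the scalars
   [p_(k+1) = (1 + p_k^2) / 2 <= 1]; its limit [P] satisfies [(1 - P)^2 = 1 - E]. *)
Lemma operator_sqrt : exists D : H -> H, is_linear D /\
  (forall x y, inner (D x) y = inner x (D y)) /\ forall x, D (D x) = vminus x (E x).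
Proof.
  destruct (tends_choice _ _ iterP iterP_cauchy) as [P HP].
  assert (Pl : is_linear P).
  { apply linear_of with 1.
    - intros x y; apply (tends_unique _ _ _ _ (HP (vplus x y))).
      apply tends_ext with (fun k => vplus (iterP k x) (iterP k y)).
      + intros; now rewrite iterP_plus.
      + now apply tends_plus.
    - intros a x; apply (tends_unique _ _ _ _ (HP (vscal a x))).
      apply tends_ext with (fun k => vscal a (iterP k x)).
      + intros; now rewrite iterP_scal.
      + now apply tends_scal.
    - intros x; apply (tends_norm_le _ _ _ _ (HP x)).
      intros n; generalize (iterP_norm n x) (iterp_range n) (norm_ge_0 x); intros; nra. }
  assert (Psym : forall x y, inner (P x) y = inner x (P y)).
  { intros x y; apply (tends_inner_eq _ _ _ _ _ _ _ (HP x) (HP y)).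
    intros n; revert x y; induction n; intros x y; simpl.
    - rewrite inner_zero_l, inner_zero_r; trivial.
    - autorewrite with hil; rewrite E_sym, IHn, IHn.
      f_equal; apply injective_projections; simpl; ring. }
  assert (Pfix : forall x, P x = vscal (RtoC (/ 2)) (vplus (E x) (P (P x)))).
  { intros x; apply tends_unique with (fun k => iterP (S k) x).
    - intros e He; destruct (HP x e He) as [N HN]; exists N; intros; apply HN; lia.
    - simpl; apply tends_scal, tends_plus.
      + intros e He; exists O; intros; rewrite v_minus_self, norm_zero'; trivial.
      (* P_n (P_n x) tends to P (P x) because every P_n is a contraction. *)
      + intros e He; destruct (HP x (e / 2)) as [N HN]; [lra |].
        destruct (HP (P x) (e / 2)) as [M HM]; [lra |]; exists (N + M)%nat; intros n Hn.
        specialize (HN n ltac:(lia)); specialize (HM n ltac:(lia)).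
        assert (A := norm_minus_trans H (iterP n (iterP n x)) (iterP n (P x)) (P (P x))).
        rewrite <- (lin_minus _ _ _ (iterP_lin n)) in A.
        assert (B := iterP_norm n (vminus (iterP n x) (P x))).
        generalize (iterp_range n) (norm_ge_0 (vminus (iterP n x) (P x))); intros; nra. }
  exists (fun x => vminus x (P x)); split; [| split].
  - apply lin_comp_minus; [exact is_linear_id | trivial].
  - intros x y; autorewrite with hil; now rewrite Psym.
  (* (1 - P)^2 x = x - 2 P x + P (P x), where 2 P x = E x + P (P x). *)
  - intros x; rewrite (lin_minus _ _ _ Pl).
    rewrite (Pfix x) at 1 2.
    vec.
    apply injective_projections; simpl; field.
Qed.

End SquareRoot.

Lemma null_inv_INR e : 0 < e -> exists N, forall n, (N <= n)%nat -> / (INR n + 1) < e.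
Proof.
  intros He; destruct (archimed_cor1 e He) as [M [HM M0]]; exists M; intros n Hn.
  apply Rle_lt_trans with (2 := HM), Rinv_le_contravar.
  - apply lt_0_INR; trivial.
  - apply le_INR in Hn; lra.
Qed.

Lemma inv_INR_pos n : 0 < / (INR n + 1).
Proof. apply Rinv_0_lt_compat; generalize (pos_INR n); lra. Qed.

(* [x] is the limit of [c^* v_n] along a maximizing sequence [v_n] of
   [2 Re <f, v> - |c^* v|^2]. *)
Lemma range_criterion (X L : HilbertSpace) (c : X -> L) (q : R) (f : L) :
  is_linear c ->
  (forall v, 2 * Re (inner f v) - norm (adj c v) ^ 2 <= q) ->
  exists x, c x = f /\ forall eps, 0 < eps -> exists v, norm (vminus x (adj c v)) < eps.
Proof.
  intros Lc Q.
  set (C := adj c) in *.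
  assert (LC : is_linear C) by now apply adj_linear.
  set (J := fun v => 2 * Re (inner f v) - norm (C v) ^ 2) in *.
  destruct (completeness (fun t => exists v, t = J v)) as [s [Up Least]].
  { exists q; intros t [v ->]; apply Q. }
  { exists (J vzero), vzero; trivial. }
  assert (JU : forall v, J v <= s) by (intros v; apply Up; now exists v).
  assert (Near : forall n : nat, exists v, s - / (INR n + 1) < J v).
  { intros n; apply Classical_Prop.NNPP; intros No.
    assert (Bd : s <= s - / (INR n + 1)).
    { apply Least; intros t [v ->]; apply Rnot_lt_le; intros Lt; apply No; now exists v. }
    generalize (inv_INR_pos n); lra. }
  set (v := fun n => proj1_sig (constructive_indefinite_description _ (Near n))).
  assert (Hv : forall n, s - / (INR n + 1) < J (v n)).
  { intros n; exact (proj2_sig (constructive_indefinite_description _ (Near n))). }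
  (* The parallelogram law: two near-maximizers of J have nearby images, since J at their midpoint
     is at most [s]. *)
  assert (Par : forall a b, norm (vminus (C a) (C b)) ^ 2
     = 4 * J (vscal (RtoC (/ 2)) (vplus a b)) - 2 * J a - 2 * J b).
  { intros a b; unfold J.
    rewrite (lin_scal _ _ _ LC), (lin_plus _ _ _ LC), norm2_scal, Cmod_half, norm2_plus, norm2_minus.
    autorewrite with hil; unfold Re; simpl; field. }
  destruct (cauchy_tends _ (fun n => C (v n))) as [x Hx].
  { intros e He; destruct (null_inv_INR (e ^ 2 / 4)) as [N HN]; [nra |].
    exists N; intros n m Hn Hm; specialize (Par (v n) (v m)).
    generalize (JU (vscal (RtoC (/ 2)) (vplus (v n) (v m)))) (Hv n) (Hv m) (HN n Hn) (HN m Hm).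
    generalize (norm_ge_0 (vminus (C (v n)) (C (v m)))); intros.
    assert (norm (vminus (C (v n)) (C (v m))) ^ 2 < e ^ 2) by lra.
    nra. }
  exists x; split.
  - symmetry; apply minus_eq0, norm_sq_eq0.
    set (u := vminus f (c x)); set (G := norm u ^ 2).
    destruct (Req_dec G 0) as [Z | Z]; [exact Z | exfalso].
    assert (G0 : 0 < G) by (generalize (pow2_ge_0 (norm u)); fold G; lra).
    set (B := norm (C u) ^ 2); assert (B0 : 0 <= B) by apply pow2_ge_0.
    (* If u = f - c x were not zero, moving the near-maximizer [w] by t u would raise J above [s].
       The linear gain is 2 t G; with this t the quadratic loss t^2 B is at most t G, and the errors
       of J w and of c^* w cost at most t G / 2 each, the former strictly less. *)
    set (t := G / (B + 1)).
    assert (t0 : 0 < t) by (apply Rdiv_lt_0_compat; lra).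
    assert (tB : t * B <= G).
    { apply Rle_trans with (t * (B + 1)); [nra | unfold t; right; field; lra]. }
    assert (Nu := norm_ge_0 (C u)).
    destruct (null_inv_INR (t * G / 2)) as [N HN]; [nra |].
    destruct (Hx (G / 4 / (norm (C u) + 1))) as [M HM]; [apply Rdiv_lt_0_compat; lra |].
    specialize (HN (N + M)%nat ltac:(lia)); specialize (HM (N + M)%nat ltac:(lia)).
    specialize (Hv (N + M)%nat); set (w := v (N + M)%nat) in *.
    assert (Jt := JU (vplus w (vscal (RtoC t) u))).
    assert (EJ : J (vplus w (vscal (RtoC t) u)) = J w + 2 * t * Re (inner f u) - t ^ 2 * B - 2 * t * Re (inner (C w) (C u))).
    { unfold J, B; rewrite (lin_plus _ _ _ LC), (lin_scal _ _ _ LC), norm2_plus, norm2_scal.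
      rewrite Cmod_R, Rabs_pos_eq by lra.
      autorewrite with hil; unfold Re; simpl; ring. }
    assert (EI : Re (inner f u) = G + Re (inner x (C u))).
    { unfold G, C; rewrite norm2_inner, <- adjP by trivial; unfold u at 2.
      rewrite inner_minus_l; unfold Re; simpl; ring. }
    assert (CS := Re_inner_le X (vminus (C w) x) (C u)).
    rewrite inner_minus_l in CS.
    assert (CS' := Rle_abs (Re (inner (C w) (C u) - inner x (C u))%C)).
    assert (Bd : norm (vminus (C w) x) * norm (C u) <= G / 4).
    { apply Rle_trans with (G / 4 / (norm (C u) + 1) * (norm (C u) + 1)); [| right; field; lra].
      generalize (norm_ge_0 (vminus (C w) x)); intros; nra. }
    replace (Re (inner (C w) (C u) - inner x (C u))%C) with (Re (inner (C w) (C u)) - Re (inner x (C u))) in * by (unfold Re; simpl; ring).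
    rewrite EJ, EI in Jt.
    assert (t * (Re (inner (C w) (C u)) - Re (inner x (C u))) <= t * (G / 4)) by (apply Rmult_le_compat_l; lra).
    assert (t * (t * B) <= t * G) by (apply Rmult_le_compat_l; lra).
    nra.
  - intros e He; destruct (Hx e He) as [N HN]; exists (v N).
    rewrite norm_minus_sym; exact (HN N (le_n N)).
Qed.

(** * Shifts and point evaluations *)

Section Shifts.
Variable Y : HilbertSpace.
Implicit Types (a b : l2 Y) (y : Y).

Definition hd a : Y := co Y a 0.

Definition tl a : l2 Y := l2_of Y (fun n => co Y a (S n))
  (proj1 (ex_series_incr_1 (V := R_NormedModule) _) (co_sqsum Y a)).

Definition cons_seq y (a : nat -> Y) (n : nat) : Y :=
  match n with O => y | S n => a n end.

Lemma cons_sqsum y a : sqsum Y (cons_seq y (co Y a)).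
Proof.
  apply (proj2 (ex_series_incr_1 (V := R_NormedModule) _)); exact (co_sqsum Y a).
Qed.

Definition lcons y a : l2 Y := l2_of Y _ (cons_sqsum y a).

Lemma lcons_eta a : lcons (hd a) (tl a) = a.
Proof. apply co_ext; intros [| n]; reflexivity. Qed.

Lemma hd_lcons y a : hd (lcons y a) = y. Proof. reflexivity. Qed.
Lemma tl_lcons y a : tl (lcons y a) = a. Proof. now apply co_ext. Qed.

Lemma l2_inner a b : inner a b = Cplus (inner (hd a) (hd b)) (inner (tl a) (tl b)).
Proof. now apply l2_inner_tail. Qed.

Lemma l2_norm_cons y a : norm (lcons y a) ^ 2 = norm y ^ 2 + norm a ^ 2.
Proof. now rewrite !norm2_inner, l2_inner, tl_lcons. Qed.

Lemma l2_norm_hd_tl a : norm a ^ 2 = norm (hd a) ^ 2 + norm (tl a) ^ 2.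
Proof. rewrite <- (lcons_eta a) at 1; apply l2_norm_cons. Qed.

Lemma sq_le_inv (x y : R) : 0 <= y -> x ^ 2 <= y ^ 2 -> x <= y.
Proof. intros; nra. Qed.

Lemma norm_hd a : norm (hd a) <= norm a.
Proof. apply sq_le_inv; [apply norm_ge_0 |]; rewrite (l2_norm_hd_tl a); generalize (pow2_ge_0 (norm (tl a))); lra. Qed.
Lemma norm_tl a : norm (tl a) <= norm a.
Proof. apply sq_le_inv; [apply norm_ge_0 |]; rewrite (l2_norm_hd_tl a); generalize (pow2_ge_0 (norm (hd a))); lra. Qed.

Lemma hd_linear : is_linear hd.
Proof. apply linear_of with 1; try reflexivity. intros a; rewrite Rmult_1_l; apply norm_hd. Qed.

Lemma tl_linear : is_linear tl.
Proof.
  apply linear_of with 1; try (intros; now apply co_ext).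
  intros a; rewrite Rmult_1_l; apply norm_tl.
Qed.

Lemma lcons_plus y y' a a' : lcons (vplus y y') (vplus a a') = vplus (lcons y a) (lcons y' a').
Proof. apply co_ext; intros [| n]; reflexivity. Qed.
Lemma lcons_scal c y a : lcons (vscal c y) (vscal c a) = vscal c (lcons y a).
Proof. apply co_ext; intros [| n]; reflexivity. Qed.

Definition shift a : l2 Y := lcons vzero a.
Definition single y : l2 Y := lcons y vzero.

Lemma norm_shift a : norm (shift a) = norm a.
Proof.
  apply Rle_antisym; apply sq_le_inv; try apply norm_ge_0; unfold shift; rewrite l2_norm_cons, norm_zero'; lra.
Qed.

Lemma norm_single y : norm (single y) = norm y.
Proof.
  apply Rle_antisym; apply sq_le_inv; try apply norm_ge_0; unfold single; rewrite l2_norm_cons, norm_zero'; lra.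
Qed.

Lemma shift_linear : is_linear shift.
Proof.
  apply linear_of with 1; unfold shift.
  - intros; rewrite <- lcons_plus; f_equal; vec.
  - intros; rewrite <- lcons_scal; f_equal; vec.
  - intros; fold (shift x); rewrite norm_shift; lra.
Qed.

Lemma single_linear : is_linear single.
Proof.
  apply linear_of with 1; unfold single.
  - intros; rewrite <- lcons_plus; f_equal; vec.
  - intros; rewrite <- lcons_scal; f_equal; vec.
  - intros; fold (single x); rewrite norm_single; lra.
Qed.

Lemma lcons_split y a : lcons y a = vplus (single y) (shift a).
Proof. unfold single, shift; rewrite <- lcons_plus; f_equal; vec. Qed.

Lemma inner_shift_r a b : inner a (shift b) = inner (tl a) b.
Proof. rewrite l2_inner; unfold shift; rewrite tl_lcons, hd_lcons, inner_zero_r; ring. Qed.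

Lemma inner_single_r a y : inner a (single y) = inner (hd a) y.
Proof. rewrite l2_inner; unfold single; rewrite tl_lcons, hd_lcons, inner_zero_r; ring. Qed.

Lemma co_iter_tl N : forall a n, co Y (Nat.iter N tl a) n = co Y a (N + n).
Proof.
  induction N; intros a n; simpl; trivial.
  change (co Y (Nat.iter N tl a) (S n) = co Y a (S (N + n))).
  rewrite IHN; f_equal; lia.
Qed.

Lemma norm_iter_tl N a : norm (Nat.iter N tl a) <= norm a.
Proof. induction N; [apply Rle_refl | exact (Rle_trans _ _ _ (norm_tl _) IHN)]. Qed.

Lemma norm_iter_tl_sum N a :
  norm (Nat.iter (S N) tl a) ^ 2 = norm a ^ 2 - sum_n (fun n => norm (co Y a n) ^ 2) N.
Proof.
  induction N.
  - rewrite sum_n_0; change (Nat.iter 1 tl a) with (tl a); rewrite (l2_norm_hd_tl a); unfold hd; ring.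
  - rewrite sum_n_S.
    assert (E := l2_norm_hd_tl (Nat.iter (S N) tl a)).
    unfold hd in E; rewrite co_iter_tl, Nat.add_0_r in E.
    change (norm (tl (Nat.iter (S N) tl a)) ^ 2 = norm a ^ 2 - (sum_n (fun n => norm (co Y a n) ^ 2) N + norm (co Y a (S N)) ^ 2)).
    lra.
Qed.

(** The squared norms are tails of a convergent series. Hence a continuous quantity that does not
    decrease along [tl] and vanishes at zero is zero, which settles both [evl_mulop] and
    [observability_adj]. *)
Lemma tends_iter_tl a : tends (fun N => Nat.iter N tl a) vzero.
Proof.
  intros e He.
  assert (L : is_lim_seq (sum_n (fun n => norm (co Y a n) ^ 2)) (norm a ^ 2)).
  { rewrite l2_norm; exact (Series_correct _ (co_sqsum Y a)). }
  apply is_lim_seq_spec in L.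
  assert (He2 : 0 < e ^ 2) by nra.
  destruct (L (mkposreal _ He2)) as [N HN]; exists (S N); intros [| n] Hn; [lia |].
  specialize (HN n ltac:(lia)); simpl pos in HN; apply Rabs_lt_between' in HN.
  rewrite v_minus_zero_r.
  assert (E := norm_iter_tl_sum n a).
  generalize (norm_ge_0 (Nat.iter (S n) tl a)); intros.
  assert (norm (Nat.iter (S n) tl a) ^ 2 < e ^ 2) by lra.
  nra.
Qed.

End Shifts.

Section Polynomials.
Variable Y : HilbertSpace.
Implicit Types (a b : nat -> Y) (z : C).

(** Horner form, so that the recursion follows the backward shift of the coefficients. The bound [N]
    is exclusive, whereas [sum_n] includes its last index. *)
Fixpoint vpoly a (N : nat) z : Y :=
  match N with
  | O => vzero
  | S N => vplus (a O) (vscal z (vpoly (fun n => a (S n)) N z))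
  end.

Lemma poly_ext a b N z : (forall n, (n < N)%nat -> a n = b n) -> vpoly a N z = vpoly b N z.
Proof.
  revert a b; induction N; intros a b E; simpl; trivial.
  rewrite (E O) by lia; f_equal; f_equal; apply IHN; intros; apply E; lia.
Qed.

Lemma poly_add a N M z :
  vpoly a (N + M) z = vplus (vpoly a N z) (vscal (Cpow z N) (vpoly (fun n => a (N + n)%nat) M z)).
Proof.
  revert a; induction N; intros a.
  - change (vpoly a M z = vplus vzero (vscal (RtoC 1) (vpoly a M z))); vec.
  - simpl; rewrite IHN; vec.
Qed.

Lemma poly_last a N z : vpoly a (S N) z = vplus (vpoly a N z) (vscal (Cpow z N) (a N)).
Proof.
  replace (S N) with (N + 1)%nat by lia; rewrite poly_add; simpl.
  rewrite Nat.add_0_r; vec.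
Qed.

Lemma poly_plus a b N z : vpoly (fun n => vplus (a n) (b n)) N z = vplus (vpoly a N z) (vpoly b N z).
Proof. revert a b; induction N; intros a b; simpl; [vec |]; rewrite IHN; vec. Qed.

Lemma poly_scal c a N z : vpoly (fun n => vscal c (a n)) N z = vscal c (vpoly a N z).
Proof. revert a; induction N; intros a; simpl; [vec |]; rewrite IHN; vec. Qed.

Lemma pow_n_Cpow z n : @pow_n C_Ring z n = Cpow z n.
Proof. induction n; simpl; [reflexivity | rewrite IHn; reflexivity]. Qed.

Lemma sum_n_poly a N z :
  @sum_n (CompleteNormedModule.AbelianMonoid C_AbsRing (hilbert_car Y))
    (fun n => vscal (@pow_n C_Ring z n) (a n)) N = vpoly a (S N) z.
Proof.
  induction N.
  - rewrite sum_O, pow_n_Cpow; simpl; vec.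
  - rewrite sum_Sn, IHN, (poly_last a (S N)), pow_n_Cpow; reflexivity.
Qed.

Lemma is_pseries_poly a z l :
  is_pseries (V := CompleteNormedModule.NormedModule _ Y) a z l <-> tends (fun N => vpoly a N z) l.
Proof.
  assert (E : is_pseries (V := CompleteNormedModule.NormedModule _ Y) a z l <-> tends (fun N => vpoly a (S N) z) l).
  { rewrite tends_filterlim; unfold is_pseries, is_series; split; apply filterlim_ext; intros N.
    - exact (sum_n_poly a N z).
    - symmetry; exact (sum_n_poly a N z). }
  rewrite E; split; intros A e He; destruct (A e He) as [N HN].
  - exists (S N); intros [| n] Hn; [lia |]; apply HN; lia.
  - exists N; intros; apply HN; lia.
Qed.

End Polynomials.

Section Evaluation.
Variable Y : HilbertSpace.
Variable z : disk.
Implicit Types (a : l2 Y) (y : Y).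

Lemma disk_range : 0 <= Cmod z < 1.
Proof. split; [apply Cmod_ge_0 | exact (proj2_sig z)]. Qed.

Lemma szego_sqsum y : sqsum Y (fun n => vscal (Cpow (Cconj z) n) y).
Proof.
  apply ex_series_ext with (fun n => norm y ^ 2 * (Cmod z ^ 2) ^ n).
  - intros n; rewrite norm2_scal, Cmod_pow, Cmod_conj, <- !pow_mult, (Nat.mul_comm n); apply Rmult_comm.
  - apply (ex_series_scal (norm y ^ 2) (fun n => (Cmod z ^ 2) ^ n)), ex_series_geom.
    generalize disk_range; intros; rewrite Rabs_pos_eq; nra.
Qed.

(** The coefficients of w |-> y / (1 - w conj(z)), the reproducing kernel function of H^2 at [z]. *)
Definition szego y : l2 Y := l2_of Y _ (szego_sqsum y).

Lemma hd_szego y : hd Y (szego y) = y.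
Proof. change (vscal (RtoC 1) y = y); vec. Qed.

Lemma tl_szego y : tl Y (szego y) = vscal (Cconj z) (szego y).
Proof.
  apply co_ext; intros n.
  change (vscal (Cmult (Cconj z) (Cpow (Cconj z) n)) y = vscal (Cconj z) (vscal (Cpow (Cconj z) n) y)).
  vec.
Qed.

Lemma szego_linear : is_linear szego.
Proof.
  apply linear_of with (sqrt (/ (1 - Cmod z ^ 2))).
  - intros x y; apply co_ext; intros n.
    change (vscal (Cpow (Cconj z) n) (vplus x y) = vplus (vscal (Cpow (Cconj z) n) x) (vscal (Cpow (Cconj z) n) y)); vec.
  - intros c y; apply co_ext; intros n.
    change (vscal (Cpow (Cconj z) n) (vscal c y) = vscal c (vscal (Cpow (Cconj z) n) y)); vec.
  - intros y; generalize disk_range; intros.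
    assert (P : 0 < / (1 - Cmod z ^ 2)) by (apply Rinv_0_lt_compat; nra).
    apply sq_le_inv; [apply Rmult_le_pos; [apply sqrt_pos | apply norm_ge_0] |].
    rewrite Rpow_mult_distr, pow2_sqrt by lra.
    assert (E := l2_norm_hd_tl Y (szego y)); rewrite tl_szego, norm2_scal, hd_szego, Cmod_conj in E.
    right; apply Rmult_eq_reg_l with (1 - Cmod z ^ 2); [| nra].
    rewrite <- Rmult_assoc, Rinv_r by nra; lra.
Qed.

(** Point evaluation at [z]. As the adjoint of the kernel map it is bounded and linear from the
    start; [evl_tends] shows that it sums the power series. *)
Definition evl : l2 Y -> Y := adj szego.

Lemma evl_linear : is_linear evl.
Proof. apply adj_linear, szego_linear. Qed.

Lemma evl_szego a y : inner (evl a) y = inner a (szego y).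
Proof. symmetry; apply adjPr, szego_linear. Qed.

(** Dual to [tl_szego]: the kernel function is an eigenvector of the backward shift for conj(z). *)
Lemma evl_cons a : evl a = vplus (hd Y a) (vscal (z : C) (evl (tl Y a))).
Proof.
  apply inner_ext; intros y; autorewrite with hil.
  rewrite !evl_szego, (l2_inner Y a), hd_szego, tl_szego, inner_scal_r.
  f_equal; f_equal; apply injective_projections; simpl; ring.
Qed.

Lemma evl_poly N a :
  evl a = vplus (vpoly Y (co Y a) N z) (vscal (Cpow z N) (evl (Nat.iter N (tl Y) a))).
Proof.
  induction N; [simpl; vec |].
  rewrite IHN at 1; rewrite poly_last, (evl_cons (Nat.iter N (tl Y) a)).
  simpl; unfold hd; rewrite co_iter_tl, Nat.add_0_r; vec.
Qed.

(** The bound depends on [a] only through its norm, as operator-norm convergence in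
    [transfer_analytic] requires. *)
Lemma evl_error (M : R) N a : 0 <= M -> (forall b, norm (evl b) <= M * norm b) ->
  norm (vminus (vpoly Y (co Y a) N z) (evl a)) <= Cmod z ^ N * (M * norm a).
Proof.
  intros M0 HM; rewrite (evl_poly N a) at 1.
  replace (vminus (vpoly Y (co Y a) N z) _) with (vopp (vscal (Cpow z N) (evl (Nat.iter N (tl Y) a)))) by vec.
  rewrite norm_opp', norm_scal', Cmod_pow.
  apply Rmult_le_compat_l; [apply pow_le, Cmod_ge_0 |].
  apply Rle_trans with (1 := HM _), Rmult_le_compat_l; trivial; apply norm_iter_tl.
Qed.

Lemma geom_null (K : R) : is_lim_seq (fun N => Cmod z ^ N * K) 0.
Proof.
  replace (Finite 0) with (Rbar_mult 0 K) by (simpl; f_equal; ring).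
  apply is_lim_seq_scal_r, is_lim_seq_geom.
  generalize disk_range; intros; rewrite Rabs_pos_eq; lra.
Qed.

Lemma evl_tends a : tends (fun N => vpoly Y (co Y a) N z) (evl a).
Proof.
  destruct (lin_bound _ _ _ evl_linear) as [M [HM B]].
  apply tends_error with (fun N => Cmod z ^ N * (M * norm a)).
  - intros N; apply evl_error; trivial; lra.
  - apply geom_null.
Qed.

End Evaluation.

Lemma evl_taylor (Y : HilbertSpace) (a : l2 Y) : is_taylor (fun z => evl Y z a) (co Y a).
Proof. intros z; apply is_pseries_poly, evl_tends. Qed.
(* Unification would otherwise unfold the construction of these spaces. *)
#[global] Opaque l2 orth_compl.

(** * Dyadic means and Taylor coefficients *)

(** A sum over n < N: unlike [sum_n] it may be empty, and it splits along N + M. *)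
Fixpoint rsum (x : nat -> R) (N : nat) : R :=
  match N with O => 0 | S N => x O + rsum (fun n => x (S n)) N end.

Lemma rsum_last x N : rsum x (S N) = rsum x N + x N.
Proof.
  revert x; induction N; intros x; [simpl; ring |].
  change (x O + rsum (fun n => x (S n)) (S N) = x O + rsum (fun n => x (S n)) N + x (S N)).
  rewrite IHN; ring.
Qed.

Lemma rsum_add x N M : rsum x (N + M) = rsum x N + rsum (fun n => x (N + n)%nat) M.
Proof.
  induction M.
  - rewrite Nat.add_0_r; simpl; ring.
  - rewrite Nat.add_succ_r, !rsum_last, IHM; ring.
Qed.

Lemma rsum_le x y N : (forall n, (n < N)%nat -> x n <= y n) -> rsum x N <= rsum y N.
Proof.
  induction N; intros L; [simpl; lra |].
  rewrite !rsum_last; assert (A := L N (Nat.lt_succ_diag_r N)).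
  assert (rsum x N <= rsum y N) by auto; lra.
Qed.

Lemma rsum_ge0 x N : (forall n, 0 <= x n) -> 0 <= rsum x N.
Proof.
  intros P; apply Rle_trans with (rsum (fun _ => 0) N).
  - right; induction N; [reflexivity | rewrite rsum_last, <- IHN; ring].
  - apply rsum_le; auto.
Qed.

Lemma rsum_ext x y N : (forall n, (n < N)%nat -> x n = y n) -> rsum x N = rsum y N.
Proof. intros E; apply Rle_antisym; apply rsum_le; intros; rewrite E; lra || trivial. Qed.

Lemma rsum_plus x y N : rsum (fun n => x n + y n) N = rsum x N + rsum y N.
Proof. induction N; [simpl; ring | rewrite !rsum_last, IHN; ring]. Qed.

Lemma rsum_scal c x N : rsum (fun n => c * x n) N = c * rsum x N.
Proof. induction N; [simpl; ring | rewrite !rsum_last, IHN; ring]. Qed.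

Lemma rsum_mono x N M : (forall n, 0 <= x n) -> (N <= M)%nat -> rsum x N <= rsum x M.
Proof.
  intros P L; replace M with (N + (M - N))%nat by lia; rewrite rsum_add.
  generalize (rsum_ge0 (fun n => x (N + n)%nat) (M - N) (fun n => P _)); lra.
Qed.

Lemma sum_n_rsum x N : sum_n x N = rsum x (S N).
Proof.
  induction N; [rewrite sum_n_0; symmetry; apply Rplus_0_r |].
  now rewrite sum_n_S, IHN, (rsum_last x (S N)).
Qed.

Definition cis (t : R) : C := (cos t, sin t).

Lemma Cmod_cis t : Cmod (cis t) = 1.
Proof.
  unfold Cmod, cis; simpl; rewrite !Rmult_1_r.
  generalize (sin2_cos2 t); unfold Rsqr; intros E.
  rewrite Rplus_comm, E; apply sqrt_1.
Qed.

Lemma cis_half t : Cmult (cis (t / 2)) (cis (t / 2)) = cis t.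
Proof.
  unfold cis, Cmult; simpl.
  rewrite <- cos_plus, (Rplus_comm (cos _ * _)), <- sin_plus.
  replace (t / 2 + t / 2) with t by field; trivial.
Qed.

Lemma cis_PI t : cis (t + PI) = Copp (cis t).
Proof. unfold cis, Copp; simpl; now rewrite neg_cos, neg_sin. Qed.

(* The mean of [g] over the [2 ^ p] roots of [z ^ (2 ^ p) = cis t]. *)
Fixpoint dyadic_mean (p : nat) (g : C -> R) (t : R) : R :=
  match p with
  | O => g (cis t)
  | S p => (dyadic_mean p g (t / 2) + dyadic_mean p g (t / 2 + PI)) / 2
  end.

Lemma Cpow_double z n : Cpow z (n + n) = Cmult (Cpow z n) (Cpow z n).
Proof. apply Cpow_add_r. Qed.

Lemma pow2_double p : (2 ^ S p = 2 ^ p + 2 ^ p)%nat.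
Proof. simpl; lia. Qed.

(** The hypothesis is restricted to the nodes of the mean, where z^(2^p) is the constant [cis t];
    [dyadic_parseval] relies on this through [dyadic_mean_ext]. *)
Lemma dyadic_mean_le p : forall (g h : C -> R) k t,
  (forall z, Cmod z = 1 -> Cpow z (2 ^ p) = cis t -> g z <= h z + k) ->
  dyadic_mean p g t <= dyadic_mean p h t + k.
Proof.
  induction p; intros g h k t L.
  - simpl; apply L; [apply Cmod_cis | simpl; ring].
  - simpl.
    assert (A : dyadic_mean p g (t / 2) <= dyadic_mean p h (t / 2) + k).
    { apply IHp; intros z Hz E; apply L; trivial.
      rewrite pow2_double, Cpow_double, E; apply cis_half. }
    assert (B : dyadic_mean p g (t / 2 + PI) <= dyadic_mean p h (t / 2 + PI) + k).
    { apply IHp; intros z Hz E; apply L; trivial.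
      rewrite pow2_double, Cpow_double, E, cis_PI, <- (cis_half t); ring. }
    lra.
Qed.

Lemma dyadic_mean_ext p (g h : C -> R) t :
  (forall z, Cmod z = 1 -> Cpow z (2 ^ p) = cis t -> g z = h z) ->
  dyadic_mean p g t = dyadic_mean p h t.
Proof.
  intros E; apply Rle_antisym.
  - generalize (dyadic_mean_le p g h 0 t (fun z A B => Req_le _ _ (eq_trans (E z A B) (eq_sym (Rplus_0_r _))))); lra.
  - generalize (dyadic_mean_le p h g 0 t (fun z A B => Req_le _ _ (eq_trans (eq_sym (E z A B)) (eq_sym (Rplus_0_r _))))); lra.
Qed.

(** As in the fast Fourier transform, where z^(2^p) = cis s the two halves of the polynomial merge
    into one with coefficients b_n + cis(s) b_(2^p+n). The two values of s give opposite [cis s],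
    and the parallelogram law yields |b_n|^2 + |b_(2^p+n)|^2. *)
Lemma dyadic_parseval (Y : HilbertSpace) p : forall (b : nat -> Y) t,
  dyadic_mean p (fun z => norm (vpoly Y b (2 ^ p) z) ^ 2) t = rsum (fun n => norm (b n) ^ 2) (2 ^ p).
Proof.
  induction p; intros b t.
  - simpl; rewrite v_scal0r, v_plus0r; ring.
  - assert (Half : forall s,
      dyadic_mean p (fun z => norm (vpoly Y b (2 ^ S p) z) ^ 2) s
      = rsum (fun n => norm (vplus (b n) (vscal (cis s) (b (2 ^ p + n)%nat))) ^ 2) (2 ^ p)).
    { intros s; rewrite <- (IHp _ s).
      apply dyadic_mean_ext; intros z _ E; do 2 f_equal.
      rewrite pow2_double, poly_add, E, poly_plus, poly_scal; trivial. }
    change (dyadic_mean (S p) (fun z => norm (vpoly Y b (2 ^ S p) z) ^ 2) t) with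
      ((dyadic_mean p (fun z => norm (vpoly Y b (2 ^ S p) z) ^ 2) (t / 2) +
        dyadic_mean p (fun z => norm (vpoly Y b (2 ^ S p) z) ^ 2) (t / 2 + PI)) / 2).
    rewrite !Half, <- rsum_plus, cis_PI, pow2_double, rsum_add, <- rsum_plus.
    unfold Rdiv; rewrite Rmult_comm, <- rsum_scal; apply rsum_ext; intros n _.
    set (x := b n); set (y := b (2 ^ p + n)%nat).
    rewrite !norm2_plus, !norm2_scal, Cmod_opp, Cmod_cis, !inner_scal_r.
    unfold Re; simpl; field.
Qed.

Lemma poly_dilate (Y : HilbertSpace) (b : nat -> Y) (r : R) N z :
  vpoly Y b N (Cmult (RtoC r) z) = vpoly Y (fun n => vscal (RtoC (r ^ n)) (b n)) N z.
Proof.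
  revert b; induction N; intros b; simpl; trivial.
  rewrite IHN.
  replace (vpoly Y (fun n => vscal (RtoC (r * r ^ n)) (b (S n))) N z)
    with (vscal (RtoC r) (vpoly Y (fun n => vscal (RtoC (r ^ n)) (b (S n))) N z)).
  - vec.
  - rewrite <- poly_scal; apply poly_ext; intros n _; vec.
    rewrite RtoC_mult; ring.
Qed.

Lemma poly_norm (Y : HilbertSpace) (b : nat -> Y) N z :
  Cmod z <= 1 -> norm (vpoly Y b N z) <= rsum (fun n => norm (b n)) N.
Proof.
  intros Hz; revert b; induction N; intros b.
  - simpl; rewrite norm_zero'; lra.
  - simpl; apply Rle_trans with (1 := norm_triangle' _ _ _), Rplus_le_compat_l.
    rewrite norm_scal'.
    specialize (IHN (fun n => b (S n))).
    generalize (Cmod_ge_0 z) (norm_ge_0 (vpoly Y (fun n => b (S n)) N z)); intros; nra.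
Qed.

(** The factor [c] collects the powers of |z| that the Horner recursion peels off; [taylor_tail]
    starts it at |z|^N. *)
Lemma poly_geom (Y : HilbertSpace) (q : R) z N : 0 <= q < 1 -> forall (b : nat -> Y) K c,
  0 <= K -> 0 <= c -> (forall k, c * norm (b k) * Cmod z ^ k <= K * q ^ k) ->
  c * norm (vpoly Y b N z) <= K / (1 - q).
Proof.
  intros Hq; induction N; intros b K c HK Hc B.
  - simpl; rewrite norm_zero', Rmult_0_r; apply Rdiv_le_0_compat; lra.
  - simpl.
    assert (A := norm_triangle' Y (b O) (vscal z (vpoly Y (fun n => b (S n)) N z))).
    rewrite norm_scal' in A.
    assert (B0 := B O); simpl in B0.
    assert (D : c * Cmod z * norm (vpoly Y (fun n => b (S n)) N z) <= K * q / (1 - q)).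
    { apply IHN.
      - apply Rmult_le_pos; lra.
      - apply Rmult_le_pos; [lra | apply Cmod_ge_0].
      - intros k; generalize (B (S k)); simpl; lra. }
    replace (K / (1 - q)) with (K + K * q / (1 - q)) by (field; lra).
    apply Rle_trans with (c * (norm (b O) + Cmod z * norm (vpoly Y (fun n => b (S n)) N z))); [| lra].
    apply Rmult_le_compat_l; trivial.
Qed.

Lemma finite_bound (x : nat -> R) N : exists K, 0 <= K /\ forall n, (n < N)%nat -> x n <= K.
Proof.
  induction N as [| N [K [K0 HK]]].
  - exists 0; split; [lra | intros; lia].
  - exists (Rmax K (x N)); split.
    + apply Rle_trans with (1 := K0), Rmax_l.
    + intros n Hn; destruct (Nat.eq_dec n N) as [-> | Ne]; [apply Rmax_r |].
      apply Rle_trans with (2 := Rmax_l _ _), HK; lia.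
Qed.

Lemma real_in_disk r : 0 <= r < 1 -> Cmod (RtoC r) < 1.
Proof. intros; rewrite Cmod_R, Rabs_pos_eq; lra. Qed.

Section TaylorTail.
Variable Y : HilbertSpace.
Variables (F : disk -> Y) (a : nat -> Y).
Hypothesis T : is_taylor F a.

Lemma taylor_terms_bounded r : 0 <= r < 1 -> exists K, 0 <= K /\ forall n, norm (a n) * r ^ n <= K.
Proof.
  intros Hr.
  set (z := exist _ (RtoC r) (real_in_disk r Hr) : disk).
  assert (Hz : Cmod z = r) by (simpl; rewrite Cmod_R, Rabs_pos_eq; lra).
  assert (A := proj1 (is_pseries_poly Y a z (F z)) (T z)).
  destruct (A 1) as [N HN]; [lra |].
  destruct (finite_bound (fun n => norm (a n) * r ^ n) N) as [K [K0 HK]].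
  (* From index N on, consecutive partial sums lie within 1 of the limit, so their differences are
     below 2. *)
  exists (K + 2); split; [lra |]; intros n.
  destruct (Nat.lt_ge_cases n N) as [L | L].
  - generalize (HK n L); lra.
  - assert (B := norm_minus_trans Y (vpoly Y a (S n) z) (F z) (vpoly Y a n z)).
    rewrite (norm_minus_sym _ (F z)) in B.
    generalize (HN (S n) ltac:(lia)) (HN n L).
    replace (vminus (vpoly Y a (S n) z) (vpoly Y a n z)) with (vscal (Cpow z n) (a n)) in B
      by (rewrite poly_last; vec).
    rewrite norm_scal', Cmod_pow, Hz in B; lra.
Qed.

(** The estimate is uniform on the circle |z| = r: the terms are bounded at the larger radius r' =
    (1 + r) / 2, so they decay like (r / r')^n on the smaller circle. *)
Lemma taylor_tail r : 0 <= r < 1 -> exists K q, 0 <= K /\ 0 <= q < 1 /\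
  forall (z : disk) N, Cmod z = r -> norm (vminus (vpoly Y a N z) (F z)) <= K * q ^ N.
Proof.
  intros Hr.
  set (r' := (1 + r) / 2).
  destruct (taylor_terms_bounded r') as [K [K0 HK]]; [unfold r'; lra |].
  set (q := r / r').
  assert (Hq : 0 <= q < 1).
  { unfold q, r'; split; [apply Rdiv_le_0_compat; lra |].
    apply Rmult_lt_reg_r with ((1 + r) / 2); [lra |].
    unfold Rdiv at 1; rewrite Rmult_assoc, Rinv_l; lra. }
  exists (K / (1 - q)), q; split; [apply Rdiv_le_0_compat; lra | split; trivial].
  intros z N Hz.
  assert (B : forall m, norm (vminus (vpoly Y a N z) (vpoly Y a (N + m) z)) <= K / (1 - q) * q ^ N).
  { intros m; rewrite poly_add.
    replace (vminus (vpoly Y a N z) _) with (vopp (vscal (Cpow z N) (vpoly Y (fun n => a (N + n)%nat) m z))) by vec.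
    rewrite norm_opp', norm_scal', Cmod_pow, Hz.
    replace (K / (1 - q) * q ^ N) with (K * q ^ N / (1 - q)) by (field; lra).
    apply poly_geom; trivial.
    - apply Rmult_le_pos; [trivial | apply pow_le; lra].
    - apply pow_le; lra.
    - intros k; rewrite Hz.
      replace (r ^ N * norm (a (N + k)%nat) * r ^ k) with (norm (a (N + k)%nat) * r ^ (N + k)) by (rewrite pow_add; ring).
      replace (K * q ^ N * q ^ k) with (K * q ^ (N + k)) by (rewrite pow_add; ring).
      replace (r ^ (N + k)) with (r' ^ (N + k) * q ^ (N + k)).
      + rewrite <- Rmult_assoc; apply Rmult_le_compat_r; [apply pow_le; lra | apply HK].
      + rewrite <- Rpow_mult_distr; f_equal; unfold q; field; unfold r'; lra. }
  apply le_epsilon; intros e He.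
  destruct (proj1 (is_pseries_poly Y a z (F z)) (T z) e He) as [M HM].
  generalize (norm_minus_trans Y (vpoly Y a N z) (vpoly Y a (N + M) z) (F z)) (B M) (HM (N + M)%nat ltac:(lia)); lra.
Qed.

End TaylorTail.

Lemma bernoulli s m : 0 <= s <= 1 -> 1 - INR m * s <= (1 - s) ^ m.
Proof.
  intros Hs; induction m; [simpl; lra |].
  rewrite S_INR; simpl.
  assert (P : 0 <= INR m * s) by (apply Rmult_le_pos; [apply pos_INR | lra]).
  assert ((1 - s) * (1 - INR m * s) <= (1 - s) * (1 - s) ^ m) by (apply Rmult_le_compat_l; lra).
  nra.
Qed.

(** Bernoulli's inequality for r = 1 - s loses at most m s X, which is below e when s <= e / (m X +
    1); the bound s <= 1 / 2 keeps r in [0, 1). *)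
Lemma radial_limit X B m : 0 <= X -> (forall r, 0 <= r < 1 -> r ^ m * X <= B) -> X <= B.
Proof.
  intros X0 H; apply le_epsilon; intros e He.
  assert (Pm := pos_INR m).
  assert (PX : 0 <= INR m * X) by (apply Rmult_le_pos; trivial).
  set (s := Rmin (1 / 2) (e / (INR m * X + 1))).
  assert (s0 : 0 < s) by (apply Rmin_pos; [lra | apply Rdiv_lt_0_compat; lra]).
  assert (s1 : s <= 1 / 2) by apply Rmin_l.
  assert (s2 : s <= e / (INR m * X + 1)) by apply Rmin_r.
  assert (S3 : s * (INR m * X + 1) <= e).
  { apply Rle_trans with (e / (INR m * X + 1) * (INR m * X + 1)); [| right; field; lra].
    apply Rmult_le_compat_r; lra. }
  specialize (H (1 - s) ltac:(lra)).
  assert (A := bernoulli s m ltac:(lra)).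
  assert ((1 - INR m * s) * X <= (1 - s) ^ m * X) by (apply Rmult_le_compat_r; trivial).
  nra.
Qed.

(* Compare the dyadic means of the two sides on circles of radius [r < 1]. *)
Lemma hardy_le (U Y : HilbertSpace) (F : disk -> Y) (a : nat -> Y) (u : nat -> U) M :
  is_taylor F a ->
  (forall z : disk, norm (F z) <= norm (vpoly U u M z)) ->
  forall L, rsum (fun n => norm (a n) ^ 2) L <= rsum (fun n => norm (u n) ^ 2) M.
Proof.
  intros T Le L.
  (* For n < L one has r^(2 L) <= r^(2 n), so a single power of r serves all the terms. *)
  apply radial_limit with (2 * L)%nat.
  { apply rsum_ge0; intros; apply pow2_ge_0. }
  intros r Hr.
  destruct (taylor_tail Y F a T r Hr) as [K [q [K0 [Hq Tail]]]].
  set (B := rsum (fun n => norm (u n)) M).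
  assert (B0 : 0 <= B) by (apply rsum_ge0; intros; apply norm_ge_0).
  assert (Scal : r ^ (2 * L) * rsum (fun n => norm (a n) ^ 2) L
      <= rsum (fun n => norm (vscal (RtoC (r ^ n)) (a n)) ^ 2) L).
  { rewrite <- rsum_scal; apply rsum_le; intros n Hn.
    rewrite norm2_scal, Cmod_R, Rabs_pos_eq by (apply pow_le; lra).
    apply Rmult_le_compat_r; [apply pow2_ge_0 |].
    rewrite <- pow_mult, (Nat.mul_comm n 2).
    replace (2 * L)%nat with (2 * n + 2 * (L - n))%nat by lia.
    rewrite pow_add; rewrite <- (Rmult_1_r (r ^ (2 * n))) at 2.
    apply Rmult_le_compat_l; [apply pow_le; lra |].
    rewrite <- (pow1 (2 * (L - n))); apply pow_incr; lra. }
  apply Rle_trans with (1 := Scal).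
  apply le_epsilon; intros e He.
  (* The Taylor tail changes a norm bounded by B by at most d <= 1, hence its square by at most 2 d
     B + d^2 <= (2 B + 1) d <= e. *)
  assert (Hd : 0 < Rmin 1 (e / (2 * B + 1))) by (apply Rmin_pos; [lra | apply Rdiv_lt_0_compat; lra]).
  set (d := Rmin 1 (e / (2 * B + 1))) in *.
  assert (d1 : d <= 1) by apply Rmin_l.
  assert (d2 : (2 * B + 1) * d <= e).
  { apply Rle_trans with ((2 * B + 1) * (e / (2 * B + 1))); [| right; field; lra].
    apply Rmult_le_compat_l; [lra | apply Rmin_r]. }
  destruct (pow_lt_1_zero q ltac:(rewrite Rabs_pos_eq; lra) (d / (K + 1)) ltac:(apply Rdiv_lt_0_compat; lra)) as [p0 Hp0].
  set (p := (p0 + L + M)%nat).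
  set (N := (2 ^ p)%nat).
  assert (HN : (p < N)%nat) by (apply Nat.pow_gt_lin_r; lia).
  assert (KN : K * q ^ N <= d).
  { specialize (Hp0 N ltac:(unfold p in HN; lia)).
    rewrite Rabs_pos_eq in Hp0 by (apply pow_le; lra).
    apply Rle_trans with ((K + 1) * (d / (K + 1))); [| right; field; lra].
    assert (0 <= q ^ N) by (apply pow_le; lra).
    apply Rmult_le_compat; lra. }
  (* Padding with zeros gives both sides the length 2^p that the dyadic Parseval identity
     requires. *)
  set (u' := fun n => if Nat.ltb n M then u n else vzero).
  assert (Pu : forall z, vpoly U u' N z = vpoly U u M z).
  { intros z; replace N with (M + (N - M))%nat by (unfold p in HN; lia).
    rewrite poly_add.
    rewrite (poly_ext U u' u M).
    - replace (vpoly U (fun n => u' (M + n)%nat) (N - M) z) with (vzero : U); [vec |].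
      generalize (N - M)%nat; intros k; symmetry.
      rewrite (poly_ext U _ (fun n => vscal (RtoC 0) (vzero : U))).
      + rewrite poly_scal; vec.
      + intros n _; unfold u'; replace (Nat.ltb (M + n) M) with false by (symmetry; apply Nat.ltb_ge; lia); vec.
    - intros n Hn; unfold u'; apply Nat.ltb_lt in Hn; now rewrite Hn. }
  apply Rle_trans with (rsum (fun n => norm (vscal (RtoC (r ^ n)) (a n)) ^ 2) N).
  { apply rsum_mono; [intros; apply pow2_ge_0 | unfold p in HN; lia]. }
  assert (Main : rsum (fun n => norm (vscal (RtoC (r ^ n)) (a n)) ^ 2) N
     <= rsum (fun n => norm (vscal (RtoC (r ^ n)) (u' n)) ^ 2) N + e).
  { unfold N; rewrite <- !(dyadic_parseval _ p _ 0); fold N.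
    apply dyadic_mean_le; intros z Hz _.
    rewrite <- !poly_dilate, Pu.
    assert (Hrz : Cmod (Cmult (RtoC r) z) = r).
    { rewrite Cmod_mult, Hz, Cmod_R, Rabs_pos_eq; lra. }
    assert (Hrz' : Cmod (Cmult (RtoC r) z) < 1) by lra.
    set (w := exist _ _ Hrz' : disk).
    assert (T1 := Tail w N Hrz); assert (L1 := Le w).
    assert (P1 := poly_norm U u M (Cmult (RtoC r) z) (Rlt_le _ _ Hrz')); fold B in P1.
    simpl disk_val in T1, L1.
    set (x := vpoly Y a N (Cmult (RtoC r) z)) in *.
    set (y := vpoly U u M (Cmult (RtoC r) z)) in *.
    assert (A : norm x <= norm y + d).
    { replace x with (vplus (vminus x (F w)) (F w)) by vec.
      generalize (norm_triangle' Y (vminus x (F w)) (F w)); lra. }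
    generalize (norm_ge_0 x) (norm_ge_0 y); intros.
    apply Rle_trans with ((norm y + d) ^ 2); [apply pow_incr; lra |].
    assert (d * norm y <= d * B) by (apply Rmult_le_compat_l; lra).
    assert (d * d <= d * 1) by (apply Rmult_le_compat_l; lra).
    lra. }
  apply Rle_trans with (1 := Main), Rplus_le_compat_r.
  replace N with (M + (N - M))%nat by (unfold p in HN; lia).
  rewrite rsum_add.
  replace (rsum (fun n => norm (vscal (RtoC (r ^ (M + n))) (u' (M + n)%nat)) ^ 2) (N - M)) with 0.
  - rewrite Rplus_0_r; apply rsum_le; intros n Hn; unfold u'; apply Nat.ltb_lt in Hn; rewrite Hn.
    rewrite norm2_scal, Cmod_R, Rabs_pos_eq by (apply pow_le; lra).
    rewrite <- (Rmult_1_l (norm (u n) ^ 2)) at 2.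
    apply Rmult_le_compat_r; [apply pow2_ge_0 |].
    rewrite <- pow_mult, <- (pow1 (n * 2)); apply pow_incr; lra.
  - rewrite (rsum_ext _ (fun _ => 0 * 0)); [rewrite rsum_scal; ring |].
    intros n _; unfold u'; replace (Nat.ltb (M + n) M) with false by (symmetry; apply Nat.ltb_ge; lia).
    rewrite v_scal0r, norm_zero'; ring.
Qed.

Lemma is_taylor_minus (Y : HilbertSpace) (f g : disk -> Y) a b :
  is_taylor f a -> is_taylor g b ->
  is_taylor (fun z => vminus (f z) (g z)) (fun n => vminus (a n) (b n)).
Proof.
  intros A B z; apply is_pseries_poly.
  apply tends_ext with (fun N => vplus (vpoly Y a N z) (vscal (RtoC (-1)) (vpoly Y b N z))).
  - intros N; rewrite <- poly_scal, <- poly_plus; apply poly_ext; intros; vec.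
  - replace (vminus (f z) (g z)) with (vplus (f z) (vscal (RtoC (-1)) (g z)))
      by vec.
    apply tends_plus; [| apply tends_scal]; apply is_pseries_poly; auto.
Qed.

(** The difference of the two series sums to zero, and [hardy_le] compares it with the empty
    polynomial. *)
Lemma taylor_unique (Y : HilbertSpace) (f : disk -> Y) a b :
  is_taylor f a -> is_taylor f b -> forall n, a n = b n.
Proof.
  intros A B n; apply minus_eq0, norm_sq_eq0.
  assert (D := is_taylor_minus Y f f a b A B).
  assert (Z := hardy_le Y Y _ _ (fun _ => vzero) 0 D).
  apply Rle_antisym; [| apply pow2_ge_0].
  assert (Z' : rsum (fun n => norm (vminus (a n) (b n)) ^ 2) (S n) <= 0).
  { apply Z; intros z; rewrite v_minus_self; apply Rle_refl. }
  rewrite rsum_last in Z'.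
  assert (P := rsum_ge0 (fun n => norm (vminus (a n) (b n)) ^ 2) n (fun n => pow2_ge_0 _)).
  lra.
Qed.

Lemma taylor_eq (Y : HilbertSpace) (f : disk -> Y) a : is_taylor f a -> forall n, taylor f n = a n.
Proof.
  intros A n; unfold taylor.
  assert (E : exists! c, exists a, is_taylor f a /\ a n = c).
  { exists (a n); split; [now exists a |].
    intros c [b [B <-]]; apply (taylor_unique Y f a b A B). }
  destruct (iota_correct _ E) as [b [B Eb]].
  change (iota (fun c : Y => exists a, is_taylor f a /\ a n = c) = a n).
  rewrite <- Eb; apply (taylor_unique Y f b a B A).
Qed.

(** * Multiplication by a Schur function *)

Lemma is_taylor_cons (Y : HilbertSpace) (f : disk -> Y) a y :
  is_taylor f a ->
  is_taylor (fun z => vplus y (vscal (z : C) (f z))) (cons_seq Y y a).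
Proof.
  intros A z; apply is_pseries_poly.
  assert (T : tends (fun N => vplus y (vscal (z : C) (vpoly Y a N z))) (vplus y (vscal (z : C) (f z)))).
  { apply tends_plus; [intros e He; exists O; intros; rewrite v_minus_self, norm_zero'; trivial |].
    apply tends_scal; apply is_pseries_poly; auto. }
  intros e He; destruct (T e He) as [N HN]; exists (S N); intros [| n] Hn; [lia |].
  exact (HN n ltac:(lia)).
Qed.

Lemma is_taylor_plus (Y : HilbertSpace) (f g : disk -> Y) a b :
  is_taylor f a -> is_taylor g b ->
  is_taylor (fun z => vplus (f z) (g z)) (fun n => vplus (a n) (b n)).
Proof.
  intros A B z; apply is_pseries_poly.
  apply tends_ext with (fun N => vplus (vpoly Y a N z) (vpoly Y b N z)).
  - intros N; symmetry; apply poly_plus.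
  - apply tends_plus; apply is_pseries_poly; auto.
Qed.

Lemma is_taylor_ext (Y : HilbertSpace) (f g : disk -> Y) a b :
  (forall z, f z = g z) -> (forall n, a n = b n) -> is_taylor f a -> is_taylor g b.
Proof.
  intros E E' A z; apply is_pseries_poly; rewrite <- E.
  apply tends_ext with (fun N => vpoly Y a N z).
  - intros N; apply poly_ext; auto.
  - apply is_pseries_poly; auto.
Qed.

Lemma evl_disk0 (Y : HilbertSpace) (a : l2 Y) : evl Y disk0 a = hd Y a.
Proof. rewrite evl_cons; change (disk_val disk0) with (RtoC 0); vec. Qed.

Lemma evl_unique (Y : HilbertSpace) (f : disk -> Y) (a : l2 Y) :
  is_taylor f (co Y a) -> forall z, f z = evl Y z a.
Proof.
  intros A z; apply (tends_unique Y (fun N => vpoly Y (co Y a) N z)).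
  - apply is_pseries_poly; auto.
  - apply evl_tends.
Qed.

Lemma evl_inj (Y : HilbertSpace) (a b : l2 Y) : (forall z, evl Y z a = evl Y z b) -> a = b.
Proof.
  intros E; apply co_ext; apply (taylor_unique Y (fun z => evl Y z a)); [apply evl_taylor |].
  apply is_taylor_ext with (3 := evl_taylor Y b); auto.
Qed.

(* [T] is the multiplication operator by [S] between Hardy spaces, in terms of Taylor
   coefficients, and [d u] is the backward shift of [S u]. *)
Record symbol_operator (U Y : HilbertSpace) (S : disk -> U -> Y)
    (T : l2 U -> l2 Y) (d : U -> l2 Y) : Prop := {
  so_lin : is_linear T;
  so_contr : forall a, norm (T a) <= norm a;
  so_d_lin : is_linear d;
  so_S_lin : forall z, is_linear (S z);
  so_hd : forall a, hd Y (T a) = S disk0 (hd U a);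
  so_tl : forall a, tl Y (T a) = vplus (d (hd U a)) (T (tl U a));
  so_evl : forall z a, evl Y z (T a) = S z (evl U z a) }.

Section Multiplication.
Variables U Y : HilbertSpace.
Variable S : disk -> U -> Y.
Variable Sn : nat -> U -> Y.
Hypothesis Sn_lin : forall n, is_linear (Sn n).
Hypothesis S_taylor : forall u, is_taylor (fun z => S z u) (fun n => Sn n u).
Hypothesis S_contr : forall z, contraction (S z).

(** The Cauchy product, coefficients of S(z) a(z), with the first coefficient of [a] split off: this
    makes [tl_mulop] nearly definitional. *)
Fixpoint conv (a : nat -> U) (n : nat) : Y :=
  match n with
  | O => Sn 0 (a O)
  | Datatypes.S m => vplus (Sn n (a O)) (conv (fun k => a (Datatypes.S k)) m)
  end.

Lemma conv_ext n : forall a b, (forall k, (k <= n)%nat -> a k = b k) -> conv a n = conv b n.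
Proof.
  induction n; intros a b E; simpl.
  - rewrite E; trivial.
  - rewrite E by lia; f_equal; apply IHn; intros; apply E; lia.
Qed.

Lemma conv_zero n : conv (fun _ => vzero) n = vzero.
Proof.
  induction n; simpl; rewrite (lin_zero _ _ _ (Sn_lin _)); trivial.
  rewrite IHn; vec.
Qed.

Lemma conv_plus n : forall a b, conv (fun k => vplus (a k) (b k)) n = vplus (conv a n) (conv b n).
Proof.
  induction n; intros a b; simpl; rewrite (lin_plus _ _ _ (Sn_lin _)); trivial.
  rewrite IHn; vec.
Qed.

Lemma conv_scal n : forall c a, conv (fun k => vscal c (a k)) n = vscal c (conv a n).
Proof.
  induction n; intros c a; simpl; rewrite (lin_scal _ _ _ (Sn_lin _)); trivial.
  rewrite IHn; vec.
Qed.

Definition trunc (L : nat) (a : nat -> U) (n : nat) : U := if Nat.ltb n L then a n else vzero.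

(** Only for polynomial input, where S(z) (a_0 + z q) = S(z) a_0 + z S(z) q raises no question of
    convergence; the norm bound drawn from it then covers all of l2. *)
Lemma conv_taylor L : forall a,
  is_taylor (fun z => S z (vpoly U a L z)) (conv (trunc L a)).
Proof.
  induction L; intros a.
  - apply is_taylor_ext with (3 := S_taylor vzero); simpl; trivial.
    intros n; rewrite (lin_zero _ _ _ (Sn_lin n)); symmetry.
    apply (conv_zero n).
  - apply is_taylor_ext with (3 := is_taylor_plus _ _ _ _ _ (S_taylor (a O))
      (is_taylor_cons _ _ _ vzero (IHL (fun n => a (Datatypes.S n))))).
    + intros z; simpl; destruct (S_contr z) as [Lz _].
      rewrite (lin_plus _ _ _ Lz), (lin_scal _ _ _ Lz); vec.
    + intros [| n].
      * change (vplus (Sn 0 (a O)) vzero = Sn 0 (a O)); vec.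
      * reflexivity.
Qed.

(** The first L coefficients of the product depend only on the first L of [a], so [a] may be
    truncated to a polynomial. *)
Lemma conv_rsum a L :
  rsum (fun n => norm (conv a n) ^ 2) L <= rsum (fun n => norm (a n) ^ 2) L.
Proof.
  rewrite (rsum_ext _ (fun n => norm (conv (trunc L a) n) ^ 2)).
  - apply hardy_le with (1 := conv_taylor L a).
    intros z; apply S_contr.
  - intros n Hn; do 2 f_equal; apply conv_ext; intros k Hk.
    unfold trunc; replace (Nat.ltb k L) with true; trivial; symmetry; apply Nat.ltb_lt; lia.
Qed.

Lemma conv_bound (a : l2 U) N : sum_n (fun n => norm (conv (co U a) n) ^ 2) N <= norm a ^ 2.
Proof.
  rewrite sum_n_rsum; apply Rle_trans with (1 := conv_rsum _ _).
  rewrite <- sum_n_rsum, l2_norm.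
  apply (sum_n_le_Series (fun n => norm (co U a n) ^ 2)); [intros; apply pow2_ge_0 | apply co_sqsum].
Qed.

Lemma conv_sqsum (a : l2 U) : sqsum Y (conv (co U a)).
Proof.
  apply bounded_ex_series with (norm a ^ 2); [intros; apply pow2_ge_0 | apply conv_bound].
Qed.

Definition mulop (a : l2 U) : l2 Y := l2_of Y _ (conv_sqsum a).

Lemma mulop_contr a : norm (mulop a) <= norm a.
Proof.
  apply sq_le_inv; [apply norm_ge_0 |]; rewrite l2_norm.
  apply Series_le_bound; [apply conv_sqsum | apply conv_bound].
Qed.

Lemma mulop_linear : is_linear mulop.
Proof.
  apply linear_of with 1.
  - intros a b; apply co_ext; intros n; exact (conv_plus n (co U a) (co U b)).
  - intros c a; apply co_ext; intros n; exact (conv_scal n c (co U a)).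
  - intros a; rewrite Rmult_1_l; apply mulop_contr.
Qed.

Definition symbol_shift (u : U) : l2 Y := tl Y (mulop (single U u)).

Lemma symbol_shift_linear : is_linear symbol_shift.
Proof.
  apply (lin_comp U (l2 Y) (l2 Y) (fun u => mulop (single U u)) (tl Y)); [| apply tl_linear].
  apply (lin_comp U (l2 U) (l2 Y) (single U) mulop); [apply single_linear | apply mulop_linear].
Qed.

Lemma co_mulop_single u n : co Y (mulop (single U u)) n = Sn n u.
Proof.
  change (conv (co U (single U u)) n = Sn n u).
  destruct n; simpl; trivial.
  change (vplus (Sn (Datatypes.S n) u) (conv (fun _ => vzero) n) = Sn (Datatypes.S n) u).
  rewrite conv_zero; vec.
Qed.

Lemma tl_mulop a : tl Y (mulop a) = vplus (symbol_shift (hd U a)) (mulop (tl U a)).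
Proof.
  apply co_ext; intros n; rewrite co_plus.
  change (co Y (symbol_shift (hd U a)) n) with (co Y (mulop (single U (hd U a))) (Datatypes.S n)).
  rewrite co_mulop_single; reflexivity.
Qed.

Lemma evl_mulop_single z u : evl Y z (mulop (single U u)) = S z u.
Proof.
  symmetry; apply (evl_unique Y (fun z => S z u)).
  apply is_taylor_ext with (3 := S_taylor u); trivial.
  intros n; symmetry; apply co_mulop_single.
Qed.

Lemma S_disk0 u : S disk0 u = Sn 0 u.
Proof. rewrite <- evl_mulop_single, evl_disk0; apply co_mulop_single. Qed.

(* The defect [g a = (T a)(z) - S(z) a(z)] is bounded and satisfies [g a = z g (tl a)]. *)
Lemma evl_mulop z a : evl Y z (mulop a) = S z (evl U z a).
Proof.
  destruct (S_contr z) as [Lz _].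
  set (g := fun a => vminus (evl Y z (mulop a)) (S z (evl U z a))).
  assert (gl : is_linear g).
  { apply lin_comp_minus.
    - apply (lin_comp _ _ _ mulop (evl Y z)); [apply mulop_linear | apply evl_linear].
    - apply (lin_comp _ _ _ (evl U z) (S z)); [apply evl_linear | trivial]. }
  assert (step : forall a, g a = vscal (z : C) (g (tl U a))).
  { intros b; unfold g.
    rewrite (evl_cons Y z (mulop b)), tl_mulop, (lin_plus _ _ _ (evl_linear Y z)).
    rewrite (evl_cons U z b), (lin_plus _ _ _ Lz), (lin_scal _ _ _ Lz).
    assert (E := evl_mulop_single z (hd U b)).
    rewrite evl_cons in E; fold (symbol_shift (hd U b)) in E.
    change (hd Y (mulop (single U (hd U b)))) with (hd Y (mulop b)) in E.
    rewrite <- E; vec. }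
  apply minus_eq0, hilbert_norm0; fold (g a).
  assert (Le : forall N, norm (g a) <= norm (g (Nat.iter N (tl U) a))).
  { induction N; [apply Rle_refl |].
    apply Rle_trans with (1 := IHN).
    rewrite step, norm_scal'; generalize (disk_range z) (norm_ge_0 (g (tl U (Nat.iter N (tl U) a)))).
    change (Nat.iter (Datatypes.S N) (tl U) a) with (tl U (Nat.iter N (tl U) a)); intros; nra. }
  apply Rle_antisym; [| apply norm_ge_0].
  apply le_epsilon; intros e He.
  destruct (lin_tends _ _ g _ _ gl (tends_iter_tl U a) e He) as [N HN].
  specialize (HN N (le_n N)); rewrite (lin_zero _ _ _ gl), v_minus_zero_r in HN.
  generalize (Le N); lra.
Qed.

Lemma mulop_symbol : symbol_operator U Y S mulop symbol_shift.
Proof.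
  split.
  - apply mulop_linear.
  - apply mulop_contr.
  - apply symbol_shift_linear.
  - intros z; apply S_contr.
  - intros a; rewrite S_disk0; reflexivity.
  - apply tl_mulop.
  - apply evl_mulop.
Qed.

End Multiplication.

Lemma op_analytic_taylor (U Y : HilbertSpace) (S : disk -> U -> Y) (Sn : nat -> U -> Y) u :
  (forall (z : disk) (eps : posreal), eventually (fun N =>
      forall u : U,
        norm (minus (sum_n (fun n => scal (pow_n (z : C) n) (Sn n u)) N)
                    (S z u)) <= eps * norm u)) ->
  is_taylor (fun z => S z u) (fun n => Sn n u).
Proof.
  intros A z; apply is_pseries_poly; intros e He.
  assert (Nu := norm_ge_0 u).
  assert (Hd : 0 < e / (norm u + 1)) by (apply Rdiv_lt_0_compat; lra).
  destruct (A z (mkposreal _ Hd)) as [N HN].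
  exists (Datatypes.S N); intros [| n] Hn; [lia |].
  specialize (HN n ltac:(lia) u); simpl pos in HN.
  rewrite <- sum_n_poly.
  apply Rle_lt_trans with (1 := HN).
  apply Rlt_le_trans with (e / (norm u + 1) * (norm u + 1)); [nra | right; field; lra].
Qed.

Lemma Schur_symbol_operator (U Y : HilbertSpace) (S : disk -> U -> Y) :
  Schur S -> exists T d, symbol_operator U Y S T d.
Proof.
  intros [[Sn [L A]] C].
  exists (mulop U Y S Sn L (fun u => op_analytic_taylor U Y S Sn u A) C).
  eexists; apply mulop_symbol.
Qed.

Section SymbolOperator.
Variables U Y : HilbertSpace.
Variable S : disk -> U -> Y.
Variable T : l2 U -> l2 Y.
Variable d : U -> l2 Y.
Hypothesis so : symbol_operator U Y S T d.

Lemma so_d0 u : d u = tl Y (T (single U u)).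
Proof.
  rewrite (so_tl _ _ _ _ _ so); unfold single; rewrite tl_lcons, hd_lcons.
  rewrite (lin_zero _ _ _ (so_lin _ _ _ _ _ so)); vec.
Qed.

Lemma so_shift a : T (shift U a) = shift Y (T a).
Proof.
  rewrite <- (lcons_eta Y (T (shift U a))), (so_hd _ _ _ _ _ so), (so_tl _ _ _ _ _ so).
  unfold shift; rewrite tl_lcons, hd_lcons.
  rewrite (lin_zero _ _ _ (so_S_lin _ _ _ _ _ so disk0)), (lin_zero _ _ _ (so_d_lin _ _ _ _ _ so)).
  f_equal; vec.
Qed.

Lemma so_single_eval z u : evl Y z (T (single U u)) = S z u.
Proof.
  rewrite (so_evl _ _ _ _ _ so); f_equal.
  rewrite evl_cons; unfold single; rewrite tl_lcons, hd_lcons, (lin_zero _ _ _ (evl_linear U z)); vec.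
Qed.

Lemma so_adj_contr v : norm (adj T v) <= norm v.
Proof.
  rewrite <- (Rmult_1_l (norm v)); apply adj_bound; [apply so | lra |].
  intros x; rewrite Rmult_1_l; apply so.
Qed.

Lemma so_adj_shift v : adj T (shift Y v) = vplus (shift U (adj T v)) (single U (adj d v)).
Proof.
  apply adj_unique; [apply so |]; intros a.
  rewrite inner_shift_r, (so_tl _ _ _ _ _ so); autorewrite with hil.
  rewrite inner_shift_r, inner_single_r, (adjP _ _ (so_d_lin _ _ _ _ _ so)), (adjP _ _ (so_lin _ _ _ _ _ so)); ring.
Qed.

Lemma so_adj_single y : adj T (single Y y) = single U (adj (S disk0) y).
Proof.
  apply adj_unique; [apply so |]; intros a.
  rewrite !inner_single_r, (so_hd _ _ _ _ _ so); apply adjP, so.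
Qed.

(** Adjoint of [so_evl]: T^* sends kernel functions to kernel functions, whence the factor S(w)^* in
    the kernel of H(S). *)
Lemma so_adj_szego w y : adj T (szego Y w y) = szego U w (adj (S w) y).
Proof.
  apply adj_unique; [apply so |]; intros a.
  rewrite <- !evl_szego, (so_evl _ _ _ _ _ so); apply adjP, so.
Qed.

(** The dual of [so_shift]: T commutes with the forward shift, T^* with the backward one. *)
Lemma so_tl_adj v : tl U (adj T v) = adj T (tl Y v).
Proof.
  assert (E : v = vplus (single Y (hd Y v)) (shift Y (tl Y v))) by (now rewrite <- lcons_split, lcons_eta).
  transitivity (tl U (adj T (vplus (single Y (hd Y v)) (shift Y (tl Y v))))).
  { exact (f_equal (fun x => tl U (adj T x)) E). }
  assert (L := adj_linear _ _ _ (so_lin _ _ _ _ _ so)).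
  rewrite (lin_plus _ _ _ L), so_adj_single, so_adj_shift, !(lin_plus _ _ _ (tl_linear U)).
  unfold single, shift; rewrite !tl_lcons; vec.
Qed.

End SymbolOperator.

(** * The de Branges-Rovnyak norm *)

Lemma H2_l2 (Y : HilbertSpace) (f : disk -> Y) :
  H2 f <-> exists a : l2 Y, forall z, f z = evl Y z a.
Proof.
  split.
  - intros [a [A E]]; exists (l2_of Y a E); apply evl_unique; exact A.
  - intros [a A]; exists (co Y a); split; [| exact (co_sqsum Y a)].
    apply is_taylor_ext with (3 := evl_taylor Y a); auto.
Qed.

Lemma H2norm2_l2 (Y : HilbertSpace) (f : disk -> Y) (a : l2 Y) :
  (forall z, f z = evl Y z a) -> H2norm2 f = norm a ^ 2.
Proof.
  intros A; rewrite l2_norm; unfold H2norm2; apply Series_ext; intros n.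
  rewrite (taylor_eq Y f (co Y a)); trivial.
  apply is_taylor_ext with (3 := evl_taylor Y a); auto.
Qed.

Lemma is_lub_approx (E : R -> Prop) (s : R) : is_lub_Rbar E s ->
  forall e, 0 < e -> exists t, E t /\ s - e < t.
Proof.
  intros [_ Least] e He; apply Classical_Prop.NNPP; intros No.
  assert (B : Rbar_le s (s - e)); [| simpl in B; lra].
  apply Least; intros t Ht; apply Rnot_lt_le; intros Lt; apply No; now exists t.
Qed.

Section BranchesRovnyakNorm.
Variables U Y : HilbertSpace.
Variable S : disk -> U -> Y.
Variable T : l2 U -> l2 Y.
Variable d : U -> l2 Y.
Hypothesis so : symbol_operator U Y S T d.

Let T_lin := so_lin _ _ _ _ _ so.
Let Ta_lin : is_linear (adj T) := adj_linear _ _ _ T_lin.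

Definition br_gain (a : l2 Y) (g : l2 U) : R := norm (vplus a (T g)) ^ 2 - norm g ^ 2.

Lemma HSnorm2_lub (f : disk -> Y) (a : l2 Y) : (forall z, f z = evl Y z a) ->
  is_lub_Rbar (fun t => exists g, t = br_gain a g) (HSnorm2 S f).
Proof.
  intros A; unfold HSnorm2.
  rewrite (Lub_Rbar_eqset _ (fun t => exists g, t = br_gain a g)); [apply Lub_Rbar_correct |].
  intros t; split.
  - intros [g [Hg ->]]; apply H2_l2 in Hg; destruct Hg as [b Hb]; exists b.
    unfold br_gain; rewrite (H2norm2_l2 U g b), (H2norm2_l2 Y _ (vplus a (T b))); trivial.
    intros z; rewrite (lin_plus _ _ _ (evl_linear Y z)), A, Hb, (so_evl _ _ _ _ _ so); reflexivity.
  - intros [b ->]; exists (fun z => evl U z b); split.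
    + apply H2_l2; now exists b.
    + unfold br_gain; rewrite (H2norm2_l2 U _ b), (H2norm2_l2 Y _ (vplus a (T b))); trivial.
      intros z; rewrite (lin_plus _ _ _ (evl_linear Y z)), A, (so_evl _ _ _ _ _ so); reflexivity.
Qed.

Lemma HS_gain (f : disk -> Y) :
  HS S f <-> exists a q, (forall z, f z = evl Y z a) /\ forall g, br_gain a g <= q.
Proof.
  split.
  - intros [Hf Fin]; apply H2_l2 in Hf; destruct Hf as [a A]; exists a.
    destruct (HSnorm2_lub f a A) as [Up _].
    destruct (HSnorm2 S f) as [q | |]; simpl in Fin; try tauto.
    + exists q; split; trivial; intros g; exact (Up _ (ex_intro _ g eq_refl)).
    (* The set of gains is nonempty, so its supremum is not minus infinity. *)
    + exfalso; exact (Up _ (ex_intro _ vzero eq_refl)).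
  - intros [a [q [A Q]]]; split; [apply H2_l2; now exists a |].
    destruct (HSnorm2_lub f a A) as [_ Least].
    assert (B : Rbar_le (HSnorm2 S f) q).
    { apply Least; intros t [g ->]; apply Q. }
    destruct (HSnorm2 S f); simpl in *; tauto || trivial.
Qed.

Lemma HSnorm2_gain (f : disk -> Y) (a : l2 Y) (q : R) : (forall z, f z = evl Y z a) ->
  HSnorm2 S f = Finite q <->
  (forall g, br_gain a g <= q) /\ (forall e, 0 < e -> exists g, q - e < br_gain a g).
Proof.
  intros A; assert (L := HSnorm2_lub f a A); split.
  - intros E; rewrite E in L; split.
    + intros g; exact (proj1 L _ (ex_intro _ g eq_refl)).
    + intros e He; destruct (is_lub_approx _ _ L e He) as [t [[g ->] Ht]]; now exists g.
  - intros [Up Ap].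
    assert (L' : is_lub_Rbar (fun t => exists g, t = br_gain a g) q).
    { split.
      - intros t [g ->]; apply Up.
      - intros [b | |] Hb; simpl; trivial.
        + apply le_epsilon; intros e He; destruct (Ap e He) as [g Hg].
          generalize (Hb _ (ex_intro _ g eq_refl)); simpl; lra.
        + exact (Hb _ (ex_intro _ vzero eq_refl)). }
    rewrite <- (is_lub_Rbar_unique _ _ L); apply is_lub_Rbar_unique, L'.
Qed.

Definition br_defect (v : l2 Y) : l2 Y := vminus v (T (adj T v)).

Lemma br_defect_linear : is_linear br_defect.
Proof.
  apply lin_comp_minus; [exact is_linear_id |].
  exact (lin_comp _ _ _ _ _ Ta_lin T_lin).
Qed.

Lemma br_defect_inner v : inner (br_defect v) v = RtoC (norm v ^ 2 - norm (adj T v) ^ 2).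
Proof.
  unfold br_defect; rewrite inner_minus_l, adjP, !inner_norm by exact T_lin.
  now rewrite <- RtoC_minus.
Qed.

(* Translating [f] by [(1 - T T^* ) v] amounts to translating the maximizing [g] by [- T^* v]. *)
Lemma br_gain_defect f v g :
  br_gain (vplus f (br_defect v)) (vplus g (adj T v)) =
  br_gain f g + 2 * Re (inner f v) + (norm v ^ 2 - norm (adj T v) ^ 2).
Proof.
  unfold br_gain.
  replace (vplus (vplus f (br_defect v)) (T (vplus g (adj T v)))) with (vplus (vplus f (T g)) v).
  - rewrite norm2_plus, (norm2_plus g), inner_plus_l, (adjP _ _ T_lin); unfold Re; simpl; ring.
  - rewrite (lin_plus _ _ _ T_lin); unfold br_defect; vec.
Qed.

Lemma br_gain_zero g : br_gain vzero g <= 0.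
Proof.
  unfold br_gain; rewrite v_plus0l.
  generalize (so_contr _ _ _ _ _ so g) (norm_ge_0 (T g)) (norm_ge_0 g); intros; nra.
Qed.

(** The interface through which H(S) is used: [bc_adj] is c c^* = I - T T^*, while [bc_gain] and
    [bc_ex] are the two halves of the description of the squared norm as a supremum of gains. *)
Record br_coefficients (H : FunHilbert disk Y) (c : H -> l2 Y) : Prop := {
  bc_lin : is_linear c;
  bc_ev : forall h z, ev h z = evl Y z (c h);
  bc_adj : forall v, c (adj c v) = br_defect v;
  bc_gain : forall h g, br_gain (c h) g <= norm h ^ 2;
  bc_ex : forall a q, (forall g, br_gain a g <= q) -> exists h, c h = a /\ norm h ^ 2 <= q }.

Lemma bc_inj H c : br_coefficients H c -> forall h k, c h = c k -> h = k.
Proof. intros bc h k E; apply ev_inj; intros z; now rewrite !(bc_ev _ _ bc), E. Qed.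

Lemma deBranges_Rovnyak_coefficients (H : FunHilbert disk Y) :
  is_deBranges_Rovnyak S H -> exists c, br_coefficients H c.
Proof.
  intros [E N].
  assert (HH : forall h : H, exists a, forall z, ev h z = evl Y z a).
  { intros h; apply H2_l2, (proj2 (E (ev h))); now exists h. }
  set (c := fun h => proj1_sig (constructive_indefinite_description _ (HH h))).
  assert (Ec : forall h z, ev h z = evl Y z (c h)).
  { intros h; exact (proj2_sig (constructive_indefinite_description _ (HH h))). }
  clearbody c; clear HH.
  assert (NG : forall h, (forall g, br_gain (c h) g <= norm h ^ 2) /\
     (forall e, 0 < e -> exists g, norm h ^ 2 - e < br_gain (c h) g)).
  { intros h; apply (HSnorm2_gain (ev h) (c h)); auto. }
  assert (Lc : is_linear c).
  { apply linear_of with 1.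
    - intros x y; apply evl_inj; intros z.
      rewrite (lin_plus _ _ _ (evl_linear Y z)), <- !Ec; apply ev_plus.
    - intros a x; apply evl_inj; intros z.
      rewrite (lin_scal _ _ _ (evl_linear Y z)), <- !Ec; apply ev_scal.
    - intros x; rewrite Rmult_1_l; apply sq_le_inv; [apply norm_ge_0 |].
      generalize (proj1 (NG x) vzero); unfold br_gain.
      rewrite (lin_zero _ _ _ T_lin), v_plus0r, norm_zero'; lra. }
  assert (Ex : forall a q, (forall g, br_gain a g <= q) -> exists h, c h = a /\ norm h ^ 2 <= q).
  { intros a q Q.
    assert (A : HS S (fun z => evl Y z a)) by (apply HS_gain; exists a, q; auto).
    apply E in A; destruct A as [h Hh]; exists h.
    assert (Ea : c h = a) by (apply evl_inj; intros z; rewrite <- Ec; auto).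
    split; trivial.
    apply le_epsilon; intros e He; destruct (proj2 (NG h) e He) as [g Hg].
    rewrite Ea in Hg; generalize (Q g); lra. }
  exists c; split; trivial; [| intros h; apply NG].
  intros v.
  (* The gains of zero are nonpositive since T is a contraction; translating by [v] bounds those of
     (I - T T^* ) v. *)
  destruct (Ex (br_defect v) (norm v ^ 2 - norm (adj T v) ^ 2)) as [k [Ek Nk]].
  { intros g.
    replace (br_gain (br_defect v) g) with (br_gain (vplus vzero (br_defect v)) (vplus (vminus g (adj T v)) (adj T v))).
    - rewrite br_gain_defect, inner_zero_l; generalize (br_gain_zero (vminus g (adj T v))); simpl; lra.
    - f_equal; vec. }
  replace (adj c v) with k; trivial; symmetry; apply adj_unique; trivial.
  (* A near-maximizer g for h, translated by T^* w, is a test function for h + l. *)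
  assert (Ge : forall w h l, c l = br_defect w ->
     norm h ^ 2 + 2 * Re (inner (c h) w) + (norm w ^ 2 - norm (adj T w) ^ 2) <= norm (vplus h l) ^ 2).
  { intros w h l El; apply le_epsilon; intros e He.
    destruct (proj2 (NG h) e He) as [g Hg].
    assert (A := proj1 (NG (vplus h l)) (vplus g (adj T w))).
    rewrite (lin_plus _ _ _ Lc), El, br_gain_defect in A; lra. }
  assert (Kn : norm k ^ 2 = norm v ^ 2 - norm (adj T v) ^ 2).
  { apply Rle_antisym.
    - exact Nk.
    - generalize (Ge v vzero k Ek); rewrite (lin_zero _ _ _ Lc), inner_zero_l, norm_zero', v_plus0l; simpl; lra. }
  (* [Ge] for h and v gives one inequality; for h + k and - v, which leads back to h, it gives the
     other. *)
  assert (Re_eq : forall h, Re (inner (c h) v) = Re (inner h k)).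
  { intros h.
    assert (A := Ge v h k Ek).
    assert (B := Ge (vopp v) (vplus h k) (vopp k)).
    replace (vplus (vplus h k) (vopp k)) with h in B by vec.
    rewrite (lin_plus _ _ _ Lc), Ek, inner_opp_r, inner_plus_l, br_defect_inner, norm_opp' in B.
    replace (adj T (vopp v)) with (vopp (adj T v)) in B by (rewrite !(scal_m1), (lin_scal _ _ _ Ta_lin); trivial).
    rewrite norm_opp' in B.
    rewrite norm2_plus in A, B; rewrite Kn in A, B.
    assert (B' := B ltac:(rewrite !scal_m1, (lin_scal _ _ _ Lc), (lin_scal _ _ _ br_defect_linear), Ek; trivial)).
    unfold Re in *; simpl in *; lra. }
  intros h; apply injective_projections.
  - apply (Re_eq h).
  - assert (A := Re_eq (vscal Ci h)); rewrite (lin_scal _ _ _ Lc), !inner_scal_l in A.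
    unfold Re, Ci in A; simpl in A. lra.
Qed.

(** * H(S) recovered from an injective operator c with c c^* = I - T T^* *)

Section Model.
Variable X : HilbertSpace.
Variable c : X -> l2 Y.
Hypothesis c_lin : is_linear c.
Hypothesis c_inj : forall x y, c x = c y -> x = y.
Hypothesis c_adj : forall v, norm (adj c v) ^ 2 = norm v ^ 2 - norm (adj T v) ^ 2.

Definition model_space : FunHilbert disk Y.
Proof.
  refine (@Build_FunHilbert disk Y X (fun x z => evl Y z (c x)) _ _ _).
  - intros f g z; now rewrite (lin_plus _ _ _ c_lin), (lin_plus _ _ _ (evl_linear Y z)).
  - intros a f z; now rewrite (lin_scal _ _ _ c_lin), (lin_scal _ _ _ (evl_linear Y z)).
  - intros f g E; apply c_inj, evl_inj, E.
Defined.

(** The test function g = T^* v, with |y|^2 >= 2 Re <y, v> - |v|^2 for y = a + T T^* v. *)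
Lemma model_gain_ge a v : 2 * Re (inner a v) - norm (adj c v) ^ 2 <= br_gain a (adj T v).
Proof.
  rewrite c_adj; unfold br_gain.
  assert (A := Re_inner_am _ (vplus a (T (adj T v))) v).
  rewrite inner_plus_l, (adjP _ _ T_lin), inner_norm in A.
  unfold Re in *; simpl in *; lra.
Qed.

(** The row (c, T) is coisometric, hence contractive: |c x + T g|^2 <= |x|^2 + |g|^2. *)
Lemma model_gain_le x g : br_gain (c x) g <= norm x ^ 2.
Proof.
  unfold br_gain; set (y := vplus (c x) (T g)).
  assert (A : norm y ^ 2 = Re (inner x (adj c y)) + Re (inner g (adj T y))).
  { rewrite norm2_inner; unfold y at 1; rewrite inner_plus_l, !adjP by trivial; reflexivity. }
  generalize (Re_inner_am _ x (adj c y)) (Re_inner_am _ g (adj T y)) (c_adj y); lra.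
Qed.

(** [range_criterion] at f = c x yields a preimage that is a limit of vectors c^* v; by injectivity
    it is x. *)
Lemma model_dense x e : 0 < e -> exists v, norm (vminus x (adj c v)) < e.
Proof.
  intros He.
  destruct (range_criterion X (l2 Y) c (norm x ^ 2) (c x) c_lin) as [x' [Ex D]].
  - intros v; apply Rle_trans with (1 := model_gain_ge (c x) v); apply model_gain_le.
  - apply c_inj in Ex; subst; auto.
Qed.

(** 2 Re <x, c^* v> - |c^* v|^2 = |x|^2 - |x - c^* v|^2, and the last square is below [e] once |x -
    c^* v| < min(1, e). *)
Lemma model_gain_sup x e : 0 < e -> exists g, norm x ^ 2 - e < br_gain (c x) g.
Proof.
  intros He.
  destruct (model_dense x (Rmin 1 e)) as [v Hv]; [apply Rmin_pos; lra |].
  exists (adj T v).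
  apply Rlt_le_trans with (2 := model_gain_ge (c x) v).
  rewrite adjP by trivial.
  assert (A := norm2_minus x (adj c v)).
  generalize (norm_ge_0 (vminus x (adj c v))) (Rmin_l 1 e) (Rmin_r 1 e); intros.
  nra.
Qed.

Lemma model_space_dBR : is_deBranges_Rovnyak S model_space.
Proof.
  split.
  - intros f; rewrite HS_gain; split.
    + intros [a [q [A Q]]].
      destruct (range_criterion X (l2 Y) c q a c_lin) as [x [Ex _]].
      * intros v; apply Rle_trans with (1 := model_gain_ge a v); apply Q.
      * exists (x : model_space); intros z; simpl; now rewrite Ex, A.
    + intros [x Hx]; exists (c x), (norm x ^ 2); split; [| apply model_gain_le].
      intros z; symmetry; apply Hx.
  - intros x; apply (HSnorm2_gain (ev x) (c x)); trivial; split; [apply model_gain_le |].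
    exact (model_gain_sup x).
Qed.

End Model.

Lemma deBranges_Rovnyak_exists : exists H : FunHilbert disk Y, is_deBranges_Rovnyak S H.
Proof.
  destruct (operator_sqrt (l2 Y) (fun v => T (adj T v))) as [D [LD [SD DD]]].
  - exact (lin_comp _ _ _ _ _ Ta_lin T_lin).
  - intros x; apply Rle_trans with (1 := so_contr _ _ _ _ _ so _), (so_adj_contr U Y S T d so).
  - intros x y; now rewrite (adjP _ _ T_lin), (adjPr _ _ T _ _ T_lin).
  - set (K := fun y => D y = vzero).
    set (c := fun w : orth_compl (l2 Y) K => D (orth_val _ _ w)).
    assert (Lc : is_linear c) by exact (lin_comp _ _ _ _ _ (orth_val_linear _ _) LD).
    assert (Ic : forall x y, c x = c y -> x = y).
    { intros x y E; apply minus_eq0, orth_val_inj, inner_scal_0.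
      apply orth_val_orth; unfold K.
      change (D (orth_val (l2 Y) K (vminus x y)) = vzero).
      rewrite (lin_minus _ _ _ (orth_val_linear _ _)), (lin_minus _ _ _ LD).
      fold (c x) (c y); rewrite E; apply v_minus_self. }
    assert (Ac : forall v, norm (adj c v) ^ 2 = norm v ^ 2 - norm (adj T v) ^ 2).
    { intros v.
      (* D is symmetric, so its range is orthogonal to its kernel and c^* v is D v itself. *)
      assert (O : orth (l2 Y) K (D v)).
      { intros y Hy; rewrite SD, Hy; apply inner_zero_r. }
      destruct (orth_val_ex _ _ _ O) as [w Hw].
      assert (E : adj c v = w).
      { apply adj_unique; trivial; intros x; unfold c; rewrite SD, <- Hw; apply orth_val_inner. }
      rewrite E, norm2_inner, <- orth_val_inner, Hw, SD, DD, inner_minus_r.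
      rewrite (adjPr _ _ T _ _ T_lin), !inner_norm; reflexivity. }
    exists (model_space _ c Lc Ic); now apply model_space_dBR.
Qed.

End BranchesRovnyakNorm.

(** * The canonical colligation *)

Section HilbertSum.
Variables H1 H2 : HilbertSpace.

Lemma hsum_norm2 (p : hsum H1 H2) : norm p ^ 2 = norm (fst p) ^ 2 + norm (snd p) ^ 2.
Proof. rewrite (norm2_inner p), !norm2_inner; reflexivity. Qed.

Lemma hsum_inner_eq (p q : hsum H1 H2) :
  inner p q = Cplus (inner (fst p) (fst q)) (inner (snd p) (snd q)).
Proof. reflexivity. Qed.

End HilbertSum.

Section Block.
Variables H1 H2 K1 K2 : HilbertSpace.
Variables (A : H1 -> K1) (B : H2 -> K1) (C : H1 -> K2) (D : H2 -> K2).
Hypotheses (LA : is_linear A) (LB : is_linear B) (LC : is_linear C) (LD : is_linear D).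

Lemma pair_linear (K : HilbertSpace) (F : K -> H1) (G : K -> H2) :
  is_linear F -> is_linear G -> is_linear (fun x => (F x, G x) : hsum H1 H2).
Proof.
  intros LF LG; destruct (lin_bound _ _ _ LF) as [M [HM BF]], (lin_bound _ _ _ LG) as [N [HN BG]].
  apply linear_of with (M + N).
  - intros x y; apply injective_projections; [exact (lin_plus _ _ _ LF x y) | exact (lin_plus _ _ _ LG x y)].
  - intros c x; apply injective_projections; [exact (lin_scal _ _ _ LF c x) | exact (lin_scal _ _ _ LG c x)].
  - intros x; apply sq_le_inv; [apply Rmult_le_pos; [lra | apply norm_ge_0] |].
    rewrite hsum_norm2; simpl fst; simpl snd.
    generalize (BF x) (BG x) (norm_ge_0 x) (norm_ge_0 (F x)) (norm_ge_0 (G x)); intros.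
    assert (norm (F x) ^ 2 <= (M * norm x) ^ 2) by (apply pow_incr; lra).
    assert (norm (G x) ^ 2 <= (N * norm x) ^ 2) by (apply pow_incr; lra).
    assert (0 <= (M * norm x) * (N * norm x)) by (apply Rmult_le_pos; apply Rmult_le_pos; lra).
    lra.
Qed.

Lemma hsum_linear (K : HilbertSpace) (F : H1 -> K) (G : H2 -> K) :
  is_linear F -> is_linear G -> is_linear (fun p : hsum H1 H2 => vplus (F (fst p)) (G (snd p))).
Proof.
  intros LF LG; destruct (lin_bound _ _ _ LF) as [M [HM BF]], (lin_bound _ _ _ LG) as [N [HN BG]].
  apply linear_of with (M + N).
  - intros x y; change (vplus (F (vplus (fst x) (fst y))) (G (vplus (snd x) (snd y)))
      = vplus (vplus (F (fst x)) (G (snd x))) (vplus (F (fst y)) (G (snd y)))).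
    rewrite (lin_plus _ _ _ LF), (lin_plus _ _ _ LG); vec.
  - intros c x; change (vplus (F (vscal c (fst x))) (G (vscal c (snd x)))
      = vscal c (vplus (F (fst x)) (G (snd x)))).
    rewrite (lin_scal _ _ _ LF), (lin_scal _ _ _ LG); vec.
  - intros x.
    assert (E := hsum_norm2 H1 H2 x).
    assert (norm (fst x) <= norm x) by (apply sq_le_inv; [apply norm_ge_0 |]; generalize (pow2_ge_0 (norm (snd x))); lra).
    assert (norm (snd x) <= norm x) by (apply sq_le_inv; [apply norm_ge_0 |]; generalize (pow2_ge_0 (norm (fst x))); lra).
    assert (M * norm (fst x) <= M * norm x) by (apply Rmult_le_compat_l; lra).
    assert (N * norm (snd x) <= N * norm x) by (apply Rmult_le_compat_l; lra).
    generalize (norm_triangle' K (F (fst x)) (G (snd x))) (BF (fst x)) (BG (snd x)); lra.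
Qed.

End Block.

Lemma block_linear (H1 H2 K1 K2 : HilbertSpace)
  (A : H1 -> K1) (B : H2 -> K1) (C : H1 -> K2) (D : H2 -> K2) :
  is_linear A -> is_linear B -> is_linear C -> is_linear D -> is_linear (block A B C D).
Proof.
  intros LA LB LC LD.
  exact (pair_linear K1 K2 _ _ _ (hsum_linear _ _ _ _ _ LA LB) (hsum_linear _ _ _ _ _ LC LD)).
Qed.

Lemma block_adj (H1 H2 K1 K2 : HilbertSpace)
  (A : H1 -> K1) (B : H2 -> K1) (C : H1 -> K2) (D : H2 -> K2) (q : hsum K1 K2) :
  is_linear A -> is_linear B -> is_linear C -> is_linear D ->
  adj (block A B C D) q =
  ((vplus (adj A (fst q)) (adj C (snd q)), vplus (adj B (fst q)) (adj D (snd q))) : hsum H1 H2).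
Proof.
  intros LA LB LC LD; apply adj_unique; [now apply block_linear |].
  intros p; rewrite !hsum_inner_eq; unfold block; simpl fst; simpl snd.
  rewrite !inner_plus_l, !inner_plus_r.
  rewrite (adjP _ _ LA), (adjP _ _ LB), (adjP _ _ LC), (adjP _ _ LD); ring.
Qed.

Section Coisometric.
Variables H K : HilbertSpace.
Variable A : H -> K.
Hypothesis cA : coisometric A.

Lemma coisometric_adj_norm y : norm (adj A y) ^ 2 = norm y ^ 2.
Proof.
  destruct cA as [L E].
  now rewrite !norm2_inner, <- (adjP _ _ L), E.
Qed.

(** |A x|^2 = Re <x, A^* A x> <= (|x|^2 + |A^* A x|^2) / 2, and |A^* A x| = |A x|. *)
Lemma coisometric_contr x : norm (A x) ^ 2 <= norm x ^ 2.
Proof.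
  destruct cA as [L E].
  assert (B := Re_inner_am H x (adj A (A x))).
  rewrite <- (adjP _ _ L), coisometric_adj_norm in B.
  rewrite (norm2_inner (A x)) in *; lra.
Qed.

End Coisometric.

(** I - z R and its adjoint are both bounded below by k = 1 - |z|. The first bound gives injectivity
    and the norm 1 / k of the inverse, the second gives surjectivity through [range_criterion]. *)
Lemma inverse_one_minus (X : HilbertSpace) (R : X -> X) (z : disk) :
  is_linear R -> (forall x, norm (R x) <= norm x) ->
  exists V, is_inverse (fun x => minus x (scal (z : C) (R x))) V.
Proof.
  intros LR CR.
  set (A := fun x => vminus x (vscal (z : C) (R x))).
  assert (LA : is_linear A).
  { apply lin_comp_minus; [exact is_linear_id | now apply lin_comp_scal]. }
  set (k := 1 - Cmod z).
  assert (Hk : 0 < k) by (unfold k; generalize (disk_range z); lra).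
  assert (Hz : forall x, norm (vscal (z : C) (R x)) <= (1 - k) * norm x).
  { intros x; rewrite norm_scal'; unfold k.
    replace (1 - (1 - Cmod z)) with (Cmod z) by ring.
    apply Rmult_le_compat_l; [apply Cmod_ge_0 | apply CR]. }
  assert (BA : forall x, k * norm x <= norm (A x)).
  { intros x; assert (E : x = vplus (A x) (vscal (z : C) (R x))) by (unfold A; vec).
    assert (T := norm_triangle' X (A x) (vscal (z : C) (R x))); rewrite <- E in T.
    generalize (Hz x); lra. }
  assert (BC : forall v, k * norm v <= norm (adj A v)).
  { intros v.
    assert (I : norm v ^ 2 - (1 - k) * norm v * norm v <= norm (adj A v) * norm v).
    { apply Rle_trans with (Re (inner (adj A v) v)).
      - rewrite <- (adjPr _ _ _ _ _ LA); unfold A; rewrite inner_minus_r, inner_norm.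
        assert (P := Re_inner_le X v (vscal (z : C) (R v))).
        assert (P' := Rle_abs (Re (inner v (vscal (z : C) (R v))))).
        assert (norm v * norm (vscal (z : C) (R v)) <= norm v * ((1 - k) * norm v))
          by (apply Rmult_le_compat_l; [apply norm_ge_0 | apply Hz]).
        unfold Re in *; simpl; simpl in P, P'; lra.
      - apply Rle_trans with (1 := Rle_abs _); apply Re_inner_le. }
    destruct (Req_dec (norm v) 0) as [Z | Z].
    - rewrite Z, Rmult_0_r; apply norm_ge_0.
    - apply Rmult_le_reg_r with (norm v); [generalize (norm_ge_0 v); lra | lra]. }
  assert (Inj : forall x y, A x = A y -> x = y).
  { intros x y E; apply minus_eq0, hilbert_norm0.
    assert (B := BA (vminus x y)); rewrite (lin_minus _ _ _ LA), E, v_minus_self, norm_zero' in B.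
    generalize (norm_ge_0 (vminus x y)); intros; nra. }
  assert (Sur : forall f, exists x, A x = f).
  { intros f.
    destruct (range_criterion X X A (norm f ^ 2 / k ^ 2) f LA) as [x [Ex _]]; [| now exists x].
    intros v; assert (B := BC v).
    assert (P := Re_inner_le X f v); assert (P' := Rle_abs (Re (inner f v))).
    assert (Nv := norm_ge_0 v); assert (Nf := norm_ge_0 f).
    assert (Q : (k * norm v) ^ 2 <= norm (adj A v) ^ 2).
    { apply pow_incr; split; [apply Rmult_le_pos; lra | trivial]. }
    replace (norm f ^ 2 / k ^ 2) with ((norm f / k) ^ 2) by (field; lra).
    generalize (pow2_ge_0 (norm f / k - k * norm v)).
    replace ((norm f / k - k * norm v) ^ 2) with ((norm f / k) ^ 2 + (k * norm v) ^ 2 - 2 * norm f * norm v) by (field; lra).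
    lra. }
  set (V := fun f => proj1_sig (constructive_indefinite_description _ (Sur f))).
  assert (HV : forall f, A (V f) = f).
  { intros f; exact (proj2_sig (constructive_indefinite_description _ (Sur f))). }
  exists V; split; [| split].
  - apply linear_of with (/ k).
    + intros x y; apply Inj; now rewrite (lin_plus _ _ _ LA), !HV.
    + intros a x; apply Inj; now rewrite (lin_scal _ _ _ LA), !HV.
    + intros x; apply Rmult_le_reg_l with k; [trivial |].
      rewrite <- Rmult_assoc, Rinv_r, Rmult_1_l by lra.
      apply Rle_trans with (1 := BA (V x)); rewrite HV; apply Rle_refl.
  - intros x; apply Inj; apply HV.
  - exact HV.
Qed.

Lemma of_fun_ev (Omega : Type) (Y : HilbertSpace) (H : FunHilbert Omega Y) (f : Omega -> Y) (h : H) :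
  (forall z, ev h z = f z) -> of_fun H f = h.
Proof.
  intros E.
  assert (X : exists! k : H, forall z, ev k z = f z).
  { exists h; split; trivial; intros k Hk; apply ev_inj; intros z; now rewrite E, Hk. }
  apply ev_inj; intros z; rewrite E; exact (iota_correct _ X z).
Qed.

Lemma backward_shift_l2 (Y : HilbertSpace) (f : disk -> Y) (a : l2 Y) :
  (forall z, f z = evl Y z a) -> forall z, backward_shift f z = evl Y z (tl Y a).
Proof.
  intros A z; unfold backward_shift; destruct (Ceq_dec z 0) as [Z | Z].
  - rewrite (taylor_eq Y f (co Y a)).
    + rewrite evl_cons, Z; change (co Y a 1) with (hd Y (tl Y a)); vec.
    + apply is_taylor_ext with (3 := evl_taylor Y a); auto.
  - rewrite !A, evl_disk0, (evl_cons Y z a).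
    apply inner_ext; intros w.
    change (inner (vscal (/ (z : C))%C (vminus (vplus (hd Y a) (vscal (z : C) (evl Y z (tl Y a)))) (hd Y a))) w
      = inner (evl Y z (tl Y a)) w).
    autorewrite with hil; field; exact Z.
Qed.

(** * The operators R_0, tau and e(0) on H(S) *)

Section CanonicalModel.
Variables U Y : HilbertSpace.
Variable S : disk -> U -> Y.
Variable T : l2 U -> l2 Y.
Variable d : U -> l2 Y.
Hypothesis so : symbol_operator U Y S T d.
Variable H : FunHilbert disk Y.
Variable c : H -> l2 Y.
Hypothesis bc : br_coefficients U Y T H c.

Let T_lin := so_lin _ _ _ _ _ so.
Let d_lin := so_d_lin _ _ _ _ _ so.
Let S0 := S disk0.
Let S0_lin : is_linear S0 := so_S_lin _ _ _ _ _ so disk0.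
Let c_lin : is_linear c := bc_lin _ _ _ _ _ bc.
Let Ta_lin : is_linear (adj T) := adj_linear _ _ _ T_lin.

Lemma cm_kernel : reproducing_kernel H (deBranges_Rovnyak_kernel S).
Proof.
  split.
  - intros z w.
    apply (lin_comp_scal Y Y (/ (1 - z * Cconj w))%C (fun y => minus y (S z (adj (S w) y)))).
    apply lin_comp_minus; [exact is_linear_id |].
    apply (lin_comp Y U Y (adj (S w)) (S z)); [apply adj_linear |]; apply so.
  (* The kernel element is the image under c^* of the kernel of H^2; c c^* = I - T T^* gives its
     values. *)
  - intros w y; exists (adj c (szego Y w y)); split.
    + intros z; rewrite (bc_ev _ _ _ _ _ bc), (bc_adj _ _ _ _ _ bc).
      unfold br_defect; rewrite (so_adj_szego _ _ _ _ _ so).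
      rewrite (lin_minus _ _ _ (evl_linear Y z)), (so_evl _ _ _ _ _ so).
      assert (Nz : (1 - z * Cconj w)%C <> 0).
      { intros E.
        assert (M : Cmod (z * Cconj w) = 1).
        { replace (z * Cconj w)%C with (Cminus 1 (1 - z * Cconj w)) by ring.
          rewrite E; replace (1 - 0)%C with (RtoC 1) by ring; apply Cmod_1. }
        rewrite Cmod_mult, Cmod_conj in M.
        generalize (disk_range z) (disk_range w); intros; nra. }
      assert (G : forall (K : HilbertSpace) (x : K), evl K z (szego K w x) = vscal (/ (1 - z * Cconj w))%C x).
      { intros K x; assert (E := evl_cons K z (szego K w x)).
        rewrite hd_szego, tl_szego, (lin_scal _ _ _ (evl_linear K z)) in E.
        set (e := evl K z (szego K w x)) in *.
        assert (Ex : x = vscal (1 - z * Cconj w)%C e).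
        { apply inner_ext; intros v; assert (F := f_equal (fun e => inner e v) E); cbv beta in F.
          autorewrite with hil in F |- *.
          replace (inner x v) with (Cminus (inner e v) (z * (Cconj w * inner e v))%C) by (rewrite F at 1; ring); ring. }
        rewrite Ex; apply inner_ext; intros v; autorewrite with hil; field; exact Nz. }
      rewrite !G, (lin_scal _ _ _ (so_S_lin _ _ _ _ _ so z)); unfold deBranges_Rovnyak_kernel.
      apply inner_ext; intros v; autorewrite with hil.
      change (minus y (S z (adj (S w) y))) with (vminus y (S z (adj (S w) y))).
      autorewrite with hil; ring.
    + intros f; rewrite <- (adjP _ _ c_lin), <- evl_szego, (bc_ev _ _ _ _ _ bc); reflexivity.
Qed.

(** Restricting the supremum for [a] to functions vanishing at the origin splits off |a_0|^2: this
    is the source of the norm inequality for R_0. *)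
Lemma br_gain_tl a g : br_gain U Y T a (shift U g) = norm (hd Y a) ^ 2 + br_gain U Y T (tl Y a) g.
Proof.
  unfold br_gain.
  rewrite (so_shift _ _ _ _ _ so), norm_shift, (l2_norm_hd_tl Y (vplus a (shift Y (T g)))).
  rewrite (lin_plus _ _ _ (hd_linear Y)), (lin_plus _ _ _ (tl_linear Y)).
  unfold shift; rewrite hd_lcons, tl_lcons, v_plus0r; ring.
Qed.

Lemma cm_shift_ex (h : H) : exists k : H,
  c k = tl Y (c h) /\ norm k ^ 2 <= norm h ^ 2 - norm (hd Y (c h)) ^ 2.
Proof.
  apply (bc_ex _ _ _ _ _ bc); intros g.
  generalize (bc_gain _ _ _ _ _ bc h (shift U g)); rewrite br_gain_tl; lra.
Qed.

Lemma cm_shift (h : H) :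
  c (shift_op H h) = tl Y (c h) /\ norm (shift_op H h) ^ 2 <= norm h ^ 2 - norm (hd Y (c h)) ^ 2.
Proof.
  destruct (cm_shift_ex h) as [k [Ek Nk]].
  replace (shift_op H h) with k; auto; symmetry; apply of_fun_ev.
  intros z; rewrite (bc_ev _ _ _ _ _ bc), Ek; symmetry; apply backward_shift_l2, (bc_ev _ _ _ _ _ bc).
Qed.

(** |T (u + z g)|^2 = |S(0) u|^2 + |d u + T g|^2 is at most |u|^2 + |g|^2; dropping |S(0) u|^2
    bounds the gains of d u by |u|^2. *)
Lemma cm_tau_ex (u : U) : exists k : H, c k = d u /\ norm k ^ 2 <= norm u ^ 2.
Proof.
  apply (bc_ex _ _ _ _ _ bc); intros g.
  assert (A := so_contr _ _ _ _ _ so (lcons U u g)).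
  assert (B : norm (T (lcons U u g)) ^ 2 <= norm (lcons U u g) ^ 2) by (apply pow_incr; split; [apply norm_ge_0 | trivial]).
  rewrite l2_norm_cons, l2_norm_hd_tl, (so_tl _ _ _ _ _ so), hd_lcons, tl_lcons in B.
  unfold br_gain; generalize (pow2_ge_0 (norm (hd Y (T (lcons U u g))))); lra.
Qed.

Lemma so_backward_shift u z : backward_shift (fun z => S z u) z = evl Y z (d u).
Proof.
  rewrite (so_d0 _ _ _ _ _ so); apply backward_shift_l2.
  intros w; symmetry; apply (so_single_eval _ _ _ _ _ so).
Qed.

Lemma cm_tau (u : U) : c (tau S H u) = d u /\ norm (tau S H u) ^ 2 <= norm u ^ 2.
Proof.
  destruct (cm_tau_ex u) as [k [Ek Nk]].
  replace (tau S H u) with k; auto; symmetry; apply of_fun_ev.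
  intros z; rewrite (bc_ev _ _ _ _ _ bc), Ek; symmetry; apply so_backward_shift.
Qed.

Lemma cm_ev0 (h : H) : ev0 H h = hd Y (c h).
Proof. unfold ev0; now rewrite (bc_ev _ _ _ _ _ bc), evl_disk0. Qed.

Let Rs : H -> H := shift_op H.
Let t : U -> H := tau S H.
Let e0 : H -> Y := ev0 H.

Let c_inj : forall h k : H, c h = c k -> h = k := bc_inj _ _ _ _ _ bc.
Let cR h : c (Rs h) = tl Y (c h) := proj1 (cm_shift h).
Let ct u : c (t u) = d u := proj1 (cm_tau u).

Lemma cm_shift_linear : is_linear (shift_op H).
Proof.
  apply linear_of with 1.
  - intros x y; apply c_inj; fold (Rs x) (Rs y) (Rs (vplus x y)).
    now rewrite (lin_plus _ _ _ c_lin), !cR, (lin_plus _ _ _ c_lin), (lin_plus _ _ _ (tl_linear Y)).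
  - intros a x; apply c_inj; fold (Rs x) (Rs (vscal a x)).
    now rewrite (lin_scal _ _ _ c_lin), !cR, (lin_scal _ _ _ c_lin), (lin_scal _ _ _ (tl_linear Y)).
  - intros x; rewrite Rmult_1_l; apply sq_le_inv; [apply norm_ge_0 |].
    generalize (proj2 (cm_shift x)) (pow2_ge_0 (norm (hd Y (c x)))); lra.
Qed.
Let R_lin : is_linear Rs := cm_shift_linear.

Lemma cm_tau_linear : is_linear (tau S H).
Proof.
  apply linear_of with 1.
  - intros x y; apply c_inj; fold t.
    now rewrite (lin_plus _ _ _ c_lin), !ct, (lin_plus _ _ _ d_lin).
  - intros a x; apply c_inj; fold t.
    now rewrite (lin_scal _ _ _ c_lin), !ct, (lin_scal _ _ _ d_lin).
  - intros x; rewrite Rmult_1_l; apply sq_le_inv; [apply norm_ge_0 | apply cm_tau].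
Qed.
Let t_lin : is_linear t := cm_tau_linear.

Lemma cm_ev0_linear : is_linear (ev0 H).
Proof.
  apply (is_linear_ext (fun h => hd Y (c h))); [intros h; symmetry; apply cm_ev0 |].
  apply (lin_comp _ _ _ c (hd Y)); [exact c_lin | apply hd_linear].
Qed.
Let e0_lin : is_linear e0 := cm_ev0_linear.

Let inner_shift_l (a b : l2 Y) : inner (shift Y a) b = inner a (tl Y b).
Proof. rewrite inner_conj, inner_shift_r, <- inner_conj; trivial. Qed.

Let inner_single_l (a : l2 U) y : inner (single U y) a = inner y (hd U a).
Proof. rewrite inner_conj, inner_single_r, <- inner_conj; trivial. Qed.

(** On the vectors c^* v the operator R_0 is explicit, because tl (T T^* v) = d ((T^* v)_0) + T T^*
    (tl v). Dualizing this identity gives the formula for R_0^* in [cm_c_adj_shift]. *)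
Lemma cm_shift_adj_c v : Rs (adj c v) = vminus (adj c (tl Y v)) (t (hd U (adj T v))).
Proof.
  apply c_inj.
  rewrite cR, (lin_minus _ _ _ c_lin), ct, !(bc_adj _ _ _ _ _ bc); unfold br_defect.
  rewrite (lin_minus _ _ _ (tl_linear Y)), (so_tl _ _ _ _ _ so), (so_tl_adj _ _ _ _ _ so).
  vec.
Qed.

Lemma cm_c_adj_shift h : c (adj Rs h) = vminus (shift Y (c h)) (T (single U (adj t h))).
Proof.
  apply inner_ext; intros v.
  rewrite (adjP _ _ c_lin), <- (adjPr _ _ _ _ _ R_lin), cm_shift_adj_c.
  rewrite inner_minus_r, inner_minus_l, <- (adjP _ _ c_lin), (adjPr _ _ _ _ _ t_lin).
  now rewrite inner_shift_l, (adjP _ _ T_lin), inner_single_l.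
Qed.

Lemma cm_adj_ev0 y : adj e0 y = adj c (single Y y).
Proof.
  apply adj_unique; trivial; intros h.
  unfold e0; rewrite cm_ev0, <- (adjP _ _ c_lin), inner_single_r; trivial.
Qed.

(** Upper left entry of U_S U_S^* = I; the next three lemmas are the other entries. *)
Lemma cm_coiso11 h : vplus (Rs (adj Rs h)) (t (adj t h)) = h.
Proof.
  apply c_inj.
  rewrite (lin_plus _ _ _ c_lin), cR, ct, cm_c_adj_shift, (lin_minus _ _ _ (tl_linear Y)).
  rewrite <- (so_d0 _ _ _ _ _ so); unfold shift; rewrite tl_lcons; vec.
Qed.

Lemma cm_coiso12 y : vplus (Rs (adj e0 y)) (t (adj S0 y)) = vzero.
Proof.
  apply c_inj.
  rewrite (lin_plus _ _ _ c_lin), cR, ct, cm_adj_ev0, (bc_adj _ _ _ _ _ bc), (lin_zero _ _ _ c_lin).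
  unfold br_defect; rewrite (so_adj_single _ _ _ _ _ so), (lin_minus _ _ _ (tl_linear Y)).
  rewrite <- (so_d0 _ _ _ _ _ so); unfold single at 1, S0; rewrite tl_lcons; vec.
Qed.

Lemma cm_coiso21 h : vplus (e0 (adj Rs h)) (S0 (adj t h)) = vzero.
Proof.
  unfold e0; rewrite cm_ev0, cm_c_adj_shift, (lin_minus _ _ _ (hd_linear Y)), (so_hd _ _ _ _ _ so).
  unfold shift, single, S0; rewrite !hd_lcons; vec.
Qed.

Lemma cm_coiso22 y : vplus (e0 (adj e0 y)) (S0 (adj S0 y)) = y.
Proof.
  unfold e0 at 1; rewrite cm_ev0, cm_adj_ev0, (bc_adj _ _ _ _ _ bc); unfold br_defect.
  rewrite (so_adj_single _ _ _ _ _ so), (lin_minus _ _ _ (hd_linear Y)), (so_hd _ _ _ _ _ so).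
  unfold single; rewrite !hd_lcons; unfold S0; vec.
Qed.

Lemma cm_coisometric : coisometric (canonical_colligation S H).
Proof.
  split; [now apply block_linear |].
  intros [h y].
  change (block Rs t e0 S0 (adj (block Rs t e0 S0) ((h, y) : hsum H Y)) = (h, y)).
  rewrite block_adj by trivial; unfold block; simpl fst; simpl snd.
  rewrite (lin_plus _ _ _ R_lin), (lin_plus _ _ _ t_lin), (lin_plus _ _ _ e0_lin), (lin_plus _ _ _ S0_lin).
  apply injective_projections; simpl fst; simpl snd.
  - transitivity (vplus (vplus (Rs (adj Rs h)) (t (adj t h))) (vplus (Rs (adj e0 y)) (t (adj S0 y)))).
    + vec.
    + rewrite cm_coiso11, cm_coiso12; vec.
  - transitivity (vplus (vplus (e0 (adj Rs h)) (S0 (adj t h))) (vplus (e0 (adj e0 y)) (S0 (adj S0 y)))).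
    + unfold S0; vec.
    + rewrite cm_coiso21, cm_coiso22; vec.
Qed.

Lemma cm_ev_adj_shift (f : H) z :
  ev (adj (shift_op H) f) z = vminus (vscal (z : C) (ev f z)) (S z (adj (tau S H) f)).
Proof.
  rewrite !(bc_ev _ _ _ _ _ bc); fold Rs t.
  rewrite cm_c_adj_shift, (lin_minus _ _ _ (evl_linear Y z)), (so_single_eval _ _ _ _ _ so).
  rewrite evl_cons; unfold shift; rewrite hd_lcons, tl_lcons; vec.
Qed.

(** Pair R_0 R_0^* + tau tau^* = I, which is [cm_coiso11], with [f]. *)
Lemma cm_norm_adj_shift (f : H) :
  norm (adj (shift_op H) f) ^ 2 = norm f ^ 2 - norm (adj (tau S H) f) ^ 2.
Proof.
  fold Rs t.
  assert (E := f_equal (fun h => Re (inner h f)) (cm_coiso11 f)); cbv beta in E.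
  rewrite inner_plus_l, (adjP _ _ R_lin), (adjP _ _ t_lin), !inner_norm in E.
  simpl in E |- *; lra.
Qed.

(** The value of (I - z R_0) g at z is g(z) - (g(z) - g(0)) = g(0). For g = (I - z R_0)^(-1) tau u
    it is also (tau u)(z), and S(0) u + z (tau u)(z) = S(z) u. *)
Lemma cm_transfer (z : disk) : exists V : H -> H,
  is_inverse (fun f : H => minus f (scal (z : C) (shift_op H f))) V /\
  forall u : U, S z u = plus (S disk0 u) (scal (z : C) (ev0 H (V (tau S H u)))).
Proof.
  destruct (inverse_one_minus H Rs z R_lin) as [V IV].
  { intros h; apply sq_le_inv; [apply norm_ge_0 |].
    generalize (proj2 (cm_shift h)) (pow2_ge_0 (norm (hd Y (c h)))); unfold Rs; lra. }
  exists V; split; [exact IV |]; intros u.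
  destruct IV as [_ [_ Inv]]; assert (E := Inv (t u)).
  change (vminus (V (t u)) (vscal (z : C) (Rs (V (t u)))) = t u) in E.
  fold t; set (g := V (t u)) in *.
  change (S z u = vplus (S disk0 u) (vscal (z : C) (ev0 H g))).
  assert (Eg : ev0 H g = evl Y z (d u)).
  { rewrite <- ct, <- E, (lin_minus _ _ _ c_lin), (lin_scal _ _ _ c_lin), cR.
    rewrite (lin_minus _ _ _ (evl_linear Y z)), (lin_scal _ _ _ (evl_linear Y z)).
    rewrite cm_ev0, (evl_cons Y z (c g)); vec. }
  rewrite Eg, <- (so_single_eval _ _ _ _ _ so z), evl_cons, (so_d0 _ _ _ _ _ so).
  rewrite (so_hd _ _ _ _ _ so); reflexivity.
Qed.

Lemma cm_single_HS u : HS S (fun z => S z u) -> exists k : H, c k = T (single U u).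
Proof.
  intros Hu; apply (HS_gain _ _ _ _ _ so) in Hu; destruct Hu as [a [q [A Q]]].
  destruct (bc_ex _ _ _ _ _ bc a q Q) as [k [Ek _]]; exists k; rewrite Ek.
  apply evl_inj; intros z; rewrite <- A; symmetry; apply (so_single_eval _ _ _ _ _ so).
Qed.

Lemma cm_HS_single u (k : H) : c k = T (single U u) -> HS S (fun z => S z u).
Proof.
  intros E; apply (HS_gain _ _ _ _ _ so); exists (c k), (norm k ^ 2); split; [| apply bc].
  intros z; rewrite E; symmetry; apply (so_single_eval _ _ _ _ _ so).
Qed.

(* The colligation is contractive and maps [(s k, - u)] to [(s - 1) (R_0 k, k(0))] when
   [k = S u]; if its first column is isometric this forces [k = 0] as [s -> - infinity]. *)
Lemma cm_equality_necessary :
  (forall f : H, norm (shift_op H f) ^ 2 = norm f ^ 2 - norm (ev0 H f) ^ 2) ->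
  forall u, HS S (fun z => S z u) -> forall z, S z u = zero.
Proof.
  intros Eq u Hu z.
  destruct (cm_single_HS u Hu) as [k Ek].
  assert (Rk : Rs k = t u) by (apply c_inj; rewrite cR, ct, Ek; symmetry; apply (so_d0 _ _ _ _ _ so)).
  assert (Ck : e0 k = S0 u).
  { unfold e0; rewrite cm_ev0, Ek, (so_hd _ _ _ _ _ so); reflexivity. }
  assert (B : forall s : R, (s - 1) ^ 2 * norm k ^ 2 <= s ^ 2 * norm k ^ 2 + norm u ^ 2).
  { intros s.
    assert (A := coisometric_contr _ _ _ cm_coisometric ((vscal (RtoC s) k, vopp u) : hsum H U)).
    rewrite !hsum_norm2 in A.
    change (norm (vplus (Rs (vscal (RtoC s) k)) (t (vopp u))) ^ 2 + norm (vplus (e0 (vscal (RtoC s) k)) (S0 (vopp u))) ^ 2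
      <= norm (vscal (RtoC s) k) ^ 2 + norm (vopp u) ^ 2) in A.
    rewrite !scal_m1, (lin_scal _ _ _ R_lin), (lin_scal _ _ _ t_lin), (lin_scal _ _ _ e0_lin), (lin_scal _ _ _ S0_lin) in A.
    rewrite <- Rk, <- Ck in A.
    replace (vplus (vscal (RtoC s) (Rs k)) (vscal (RtoC (-1)) (Rs k))) with (vscal (RtoC (s - 1)) (Rs k)) in A
      by (vec; apply injective_projections; simpl; ring).
    replace (vplus (vscal (RtoC s) (e0 k)) (vscal (RtoC (-1)) (e0 k))) with (vscal (RtoC (s - 1)) (e0 k)) in A
      by (vec; apply injective_projections; simpl; ring).
    rewrite !norm2_scal, !Cmod_R, <- !Rsqr_pow2, <- !Rsqr_abs, !Rsqr_pow2 in A.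
    assert (E := Eq k); fold (Rs k) (e0 k) in E; rewrite E in A; lra. }
  assert (K0 : norm k ^ 2 = 0).
  { apply Rle_antisym; [| apply pow2_ge_0]; apply Rnot_lt_le; intros P.
    (* At this s the inequality reduces to 2 |u|^2 + |k|^2 <= |u|^2. *)
    specialize (B (- (norm u ^ 2 / norm k ^ 2))).
    assert (F : norm u ^ 2 / norm k ^ 2 * norm k ^ 2 = norm u ^ 2) by (field; intros Z; rewrite Z in P; lra).
    assert (Pu := pow2_ge_0 (norm u)).
    set (w := norm u ^ 2 / norm k ^ 2) in *; clearbody w.
    set (K := norm k ^ 2) in *; set (L := norm u ^ 2) in *; clearbody K L.
    replace ((- w - 1) ^ 2 * K) with ((- w) ^ 2 * K + 2 * (w * K) + K) in B by ring.
    rewrite F in B; lra. }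
  rewrite <- (so_single_eval _ _ _ _ _ so), <- Ek.
  rewrite (norm_sq_eq0 _ _ K0), (lin_zero _ _ _ c_lin); apply (lin_zero _ _ _ (evl_linear Y z)).
Qed.

(* The defect of the first column at [h] is [<h, h'>], where [(h', u')] is the projection of
   [(h, 0)] on the kernel of the colligation, that is [h' = - S u']. *)
Lemma cm_equality_sufficient :
  (forall u, HS S (fun z => S z u) -> forall z, S z u = zero) ->
  forall f : H, norm (shift_op H f) ^ 2 = norm f ^ 2 - norm (ev0 H f) ^ 2.
Proof.
  intros Hyp h; fold (Rs h) (e0 h).
  set (h' := vminus (vminus h (adj Rs (Rs h))) (adj e0 (e0 h))).
  (* Here [u'] is the opposite of the second component of the projection, so that h' = S u'. *)
  set (u' := vplus (adj t (Rs h)) (adj S0 (e0 h))).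
  assert (E1 : Rs h' = t u').
  { unfold h', u'; rewrite !(lin_minus _ _ _ R_lin), (lin_plus _ _ _ t_lin).
    apply minus_eq0.
    transitivity (vminus (vminus (Rs h) (vplus (Rs (adj Rs (Rs h))) (t (adj t (Rs h))))) (vplus (Rs (adj e0 (e0 h))) (t (adj S0 (e0 h))))); [vec |].
    rewrite cm_coiso11, cm_coiso12; vec. }
  assert (E2 : e0 h' = S0 u').
  { unfold h', u'; rewrite !(lin_minus _ _ _ e0_lin), (lin_plus _ _ _ S0_lin).
    apply minus_eq0.
    transitivity (vminus (vminus (e0 h) (vplus (e0 (adj Rs (Rs h))) (S0 (adj t (Rs h))))) (vplus (e0 (adj e0 (e0 h))) (S0 (adj S0 (e0 h))))); [vec |].
    rewrite cm_coiso21, cm_coiso22; vec. }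
  assert (E3 : c h' = T (single U u')).
  { rewrite <- (lcons_eta Y (c h')), <- (lcons_eta Y (T (single U u'))); f_equal.
    - rewrite <- cm_ev0, (so_hd _ _ _ _ _ so); exact E2.
    - rewrite <- cR, E1, ct; apply (so_d0 _ _ _ _ _ so). }
  assert (Z : h' = vzero).
  { apply ev_inj; intros z.
    rewrite !(bc_ev _ _ _ _ _ bc), E3, (so_single_eval _ _ _ _ _ so), (lin_zero _ _ _ c_lin).
    rewrite (lin_zero _ _ _ (evl_linear Y z)); apply (Hyp u' (cm_HS_single u' h' E3)). }
  assert (I : inner h h' = 0) by (rewrite Z; apply inner_zero_r).
  unfold h' in I; rewrite !inner_minus_r, <- (adjP _ _ R_lin), <- (adjP _ _ e0_lin), !inner_norm in I.
  apply (f_equal Re) in I; simpl in I |- *; lra.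
Qed.

End CanonicalModel.

(** * Realization of completely non-isometric contractions *)

Lemma co_bound (Y : HilbertSpace) n (a : l2 Y) : norm (co Y a n) <= norm a.
Proof.
  replace (co Y a n) with (hd Y (Nat.iter n (tl Y) a)).
  - apply Rle_trans with (1 := norm_hd _ _), norm_iter_tl.
  - unfold hd; rewrite co_iter_tl, Nat.add_0_r; trivial.
Qed.

Lemma co_linear (Y : HilbertSpace) n : is_linear (fun a : l2 Y => co Y a n).
Proof.
  apply linear_of with 1.
  - intros; apply co_plus.
  - intros; apply co_scal.
  - intros a; rewrite Rmult_1_l; apply co_bound.
Qed.

Section Realization.
Variables X U Y : HilbertSpace.
Variables (A : X -> X) (B : U -> X) (C : X -> Y) (D : U -> Y).
Hypotheses (LA : is_linear A) (LB : is_linear B) (LC : is_linear C) (LD : is_linear D).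
Hypothesis coiso : coisometric (block A B C D).
Hypothesis observable : forall x, (forall n, C (Nat.iter n A x) = zero) -> x = zero.

Let column_contr x : norm (A x) ^ 2 + norm (C x) ^ 2 <= norm x ^ 2.
Proof.
  assert (E := coisometric_contr _ _ _ coiso ((x, vzero) : hsum X U)).
  rewrite !hsum_norm2 in E; unfold block in E; simpl fst in E; simpl snd in E.
  rewrite (lin_zero _ _ _ LB), (lin_zero _ _ _ LD), !v_plus0r, norm_zero' in E; lra.
Qed.

Let A_contr x : norm (A x) <= norm x.
Proof.
  apply sq_le_inv; [apply norm_ge_0 |]; generalize (column_contr x) (pow2_ge_0 (norm (C x))); lra.
Qed.

(** |C y|^2 <= |y|^2 - |A y|^2, which telescopes along y = A^n x. *)
Let obs_sum x N : sum_n (fun n => norm (C (Nat.iter n A x)) ^ 2) N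
  <= norm x ^ 2 - norm (Nat.iter (S N) A x) ^ 2.
Proof.
  induction N.
  - rewrite sum_n_0; generalize (column_contr x); simpl Nat.iter; lra.
  - rewrite sum_n_S; generalize (column_contr (Nat.iter (S N) A x)).
    change (Nat.iter (S (S N)) A x) with (A (Nat.iter (S N) A x)); lra.
Qed.

Let obs_sqsum x : sqsum Y (fun n => C (Nat.iter n A x)).
Proof.
  apply bounded_ex_series with (norm x ^ 2); [intros; apply pow2_ge_0 |].
  intros N; generalize (obs_sum x N) (pow2_ge_0 (norm (Nat.iter (S N) A x))); lra.
Qed.

Definition observability (x : X) : l2 Y := l2_of Y _ (obs_sqsum x).
Let O := observability.

Let hd_obs x : hd Y (O x) = C x. Proof. reflexivity. Qed.

Let tl_obs x : tl Y (O x) = O (A x).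
Proof.
  apply co_ext; intros n.
  change (C (Nat.iter (S n) A x) = C (Nat.iter n A (A x))).
  now rewrite Nat.iter_succ_r.
Qed.

Let iter_plus n x y : Nat.iter n A (vplus x y) = vplus (Nat.iter n A x) (Nat.iter n A y).
Proof. induction n; simpl; trivial; now rewrite IHn, (lin_plus _ _ _ LA). Qed.

Let iter_scal n a x : Nat.iter n A (vscal a x) = vscal a (Nat.iter n A x).
Proof. induction n; simpl; trivial; now rewrite IHn, (lin_scal _ _ _ LA). Qed.

Let obs_contr x : norm (O x) <= norm x.
Proof.
  apply sq_le_inv; [apply norm_ge_0 |]; rewrite l2_norm.
  apply Series_le_bound; [apply obs_sqsum |]; intros N.
  generalize (obs_sum x N) (pow2_ge_0 (norm (Nat.iter (S N) A x))).
  change (fun n => norm (co Y (O x) n) ^ 2) with (fun n => norm (C (Nat.iter n A x)) ^ 2); lra.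
Qed.

Let obs_linear : is_linear O.
Proof.
  apply linear_of with 1.
  - intros x y; apply co_ext; intros n; rewrite co_plus.
    change (C (Nat.iter n A (vplus x y)) = vplus (C (Nat.iter n A x)) (C (Nat.iter n A y))).
    now rewrite iter_plus, (lin_plus _ _ _ LC).
  - intros a x; apply co_ext; intros n; rewrite co_scal.
    change (C (Nat.iter n A (vscal a x)) = vscal a (C (Nat.iter n A x))).
    now rewrite iter_scal, (lin_scal _ _ _ LC).
  - intros x; rewrite Rmult_1_l; apply obs_contr.
Qed.

Let obs_inj x y : O x = O y -> x = y.
Proof.
  intros E; apply minus_eq0, observable; intros n.
  change (co Y (O (vminus x y)) n = vzero).
  rewrite (lin_minus _ _ _ obs_linear), E, v_minus_self; apply co_zero.
Qed.

(** The impulse response D u, C B u, C A B u, ...: the Taylor coefficients of D + z C (I - z A)^(-1)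
    B applied to [u]. *)
Definition impulse (u : U) : l2 Y := lcons Y (D u) (O (B u)).

Let impulse_linear : is_linear impulse.
Proof.
  apply (is_linear_ext (fun u => vplus (single Y (D u)) (shift Y (O (B u))))).
  - intros u; symmetry; apply lcons_split.
  - apply lin_comp_plus.
    + exact (lin_comp _ _ _ _ _ LD (single_linear Y)).
    + exact (lin_comp _ _ _ _ _ (lin_comp _ _ _ _ _ LB obs_linear) (shift_linear Y)).
Qed.

Definition transfer (z : disk) (u : U) : Y := evl Y z (impulse u).

Lemma transfer_analytic : op_analytic transfer.
Proof.
  exists (fun n u => co Y (impulse u) n); split.
  - intros n; exact (lin_comp _ _ _ _ _ impulse_linear (co_linear Y n)).
  - intros z eps.
    destruct (lin_bound _ _ _ (evl_linear Y z)) as [M [HM BM]].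
    destruct (lin_bound _ _ _ impulse_linear) as [K [HK BK]].
    assert (G := geom_null z (M * K)); apply is_lim_seq_spec in G.
    destruct (G eps) as [N HN]; exists N; intros n Hn u.
    assert (Hn' := HN (S n) ltac:(lia)).
    rewrite Rminus_0_r in Hn'; apply Rabs_def2 in Hn'.
    apply Rle_trans with (Cmod z ^ S n * (M * norm (impulse u))).
    + assert (E := evl_error Y z M (S n) (impulse u) (Rlt_le _ _ HM) BM).
      rewrite <- sum_n_poly in E; exact E.
    + assert (P : 0 <= Cmod z ^ S n) by (apply pow_le, Cmod_ge_0).
      apply Rle_trans with (Cmod z ^ S n * (M * K) * norm u).
      * rewrite !Rmult_assoc; apply Rmult_le_compat_l; trivial.
        apply Rmult_le_compat_l; [lra | apply BK].
      * apply Rmult_le_compat_r; [apply norm_ge_0 | lra].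
Qed.

(** With x = (I - z A)^(-1) B u the colligation sends (z x, u) to (x, S(z) u), so |x|^2 + |S(z) u|^2
    <= |z|^2 |x|^2 + |u|^2. *)
Lemma transfer_contraction z : contraction (transfer z).
Proof.
  split; [exact (lin_comp _ _ _ _ _ impulse_linear (evl_linear Y z)) |].
  intros u.
  destruct (inverse_one_minus X A z LA A_contr) as [V [_ [_ HV]]].
  set (x := V (B u)).
  assert (Ex : vminus x (vscal (z : Complex.C) (A x)) = B u) by exact (HV (B u)).
  assert (Et : transfer z u = vplus (vscal (z : Complex.C) (C x)) (D u)).
  { unfold transfer, impulse; rewrite evl_cons, hd_lcons, tl_lcons.
    rewrite <- Ex, (lin_minus _ _ _ obs_linear), (lin_scal _ _ _ obs_linear).
    rewrite (lin_minus _ _ _ (evl_linear Y z)), (lin_scal _ _ _ (evl_linear Y z)).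
    rewrite (evl_cons Y z (O x)), hd_obs, tl_obs; vec. }
  assert (E := coisometric_contr _ _ _ coiso ((vscal (z : Complex.C) x, u) : hsum X U)).
  rewrite !hsum_norm2 in E; unfold block in E; simpl fst in E; simpl snd in E.
  rewrite (lin_scal _ _ _ LA), (lin_scal _ _ _ LC), <- Et, <- Ex in E.
  replace (vplus (vscal (z : Complex.C) (A x)) (vminus x (vscal (z : Complex.C) (A x)))) with x in E by vec.
  rewrite norm2_scal in E.
  apply sq_le_inv; [apply norm_ge_0 |].
  assert (Cmod z ^ 2 <= 1) by (generalize (disk_range z); intros; nra).
  generalize (pow2_ge_0 (norm x)); intros; nra.
Qed.

Lemma transfer_Schur : Schur transfer.
Proof. split; [exact transfer_analytic | exact transfer_contraction]. Qed.

Section Symbol.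
Variable T : l2 U -> l2 Y.
Variable d : U -> l2 Y.
Hypothesis so : symbol_operator U Y transfer T d.

Let T_single u : T (single U u) = impulse u.
Proof. apply evl_inj; intros z; apply (so_single_eval _ _ _ _ _ so). Qed.

Let d_obs u : d u = O (B u).
Proof. rewrite (so_d0 _ _ _ _ _ so), T_single; unfold impulse; apply tl_lcons. Qed.

Let S0_D u : transfer disk0 u = D u.
Proof. unfold transfer; rewrite evl_disk0; reflexivity. Qed.

Let adj_obs_lcons y v : adj O (lcons Y y v) = vplus (adj A (adj O v)) (adj C y).
Proof.
  apply adj_unique; trivial; intros x.
  rewrite l2_inner, hd_lcons, tl_lcons, hd_obs, tl_obs, inner_plus_r.
  rewrite (adjP _ _ LC), (adjP _ _ obs_linear), (adjP _ _ LA); ring.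
Qed.

(** Together with [adj_obs_lcons]: prepending y to v turns (O^* v, y) into its image under the
    adjoint colligation, the second component being the new first coefficient of T^*. *)
Let adj_T_lcons y v : adj T (lcons Y y v) = lcons U (vplus (adj B (adj O v)) (adj D y)) (adj T v).
Proof.
  rewrite lcons_split, (lin_plus _ _ _ (adj_linear _ _ _ (so_lin _ _ _ _ _ so))).
  rewrite (so_adj_single _ _ _ _ _ so), (so_adj_shift _ _ _ _ _ so), (lcons_split U).
  replace (adj d v) with (adj B (adj O v)).
  - replace (adj (transfer disk0) y) with (adj D y).
    + rewrite (lin_plus _ _ _ (single_linear U)); vec.
    + symmetry; apply adj_unique; [apply transfer_contraction |].
      intros u; rewrite S0_D; apply adjP, LD.
  - symmetry; apply adj_unique; [apply so |].
    intros u; rewrite d_obs, (adjP _ _ obs_linear), (adjP _ _ LB); trivial.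
Qed.

Let defect (v : l2 Y) := norm (adj O v) ^ 2 + norm (adj T v) ^ 2 - norm v ^ 2.

(** The adjoint colligation preserves norms, so the first coefficient y of v adds |y|^2 to both
    sides of the balance. *)
Let defect_tl v : defect v = defect (tl Y v).
Proof.
  rewrite <- (lcons_eta Y v), tl_lcons.
  set (y := hd Y v); set (w := tl Y v).
  unfold defect; rewrite adj_obs_lcons, adj_T_lcons, !l2_norm_cons.
  assert (E := coisometric_adj_norm _ _ _ coiso ((adj O w, y) : hsum X Y)).
  rewrite block_adj, !hsum_norm2 in E by trivial; simpl fst in E; simpl snd in E; lra.
Qed.

(** The defect is unchanged along the backward shifts of v and bounded by the squared norm, which
    tends to zero. *)
Lemma observability_adj v : norm (adj O v) ^ 2 = norm v ^ 2 - norm (adj T v) ^ 2.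
Proof.
  assert (It : forall N, defect v = defect (Nat.iter N (tl Y) v)).
  { induction N; [reflexivity |]; rewrite IHN; apply defect_tl. }
  assert (Bd : forall w, Rabs (defect w) <= norm w ^ 2).
  { intros w; unfold defect.
    assert (N1 : norm (adj O w) <= 1 * norm w).
    { apply adj_bound; [trivial | lra |]; intros x; rewrite Rmult_1_l; apply obs_contr. }
    assert (N2 := so_adj_contr _ _ _ _ _ so w).
    assert (norm (adj O w) ^ 2 <= norm w ^ 2) by (apply pow_incr; split; [apply norm_ge_0 | lra]).
    assert (norm (adj T w) ^ 2 <= norm w ^ 2) by (apply pow_incr; split; [apply norm_ge_0 | lra]).
    generalize (pow2_ge_0 (norm (adj O w))) (pow2_ge_0 (norm (adj T w))); intros.
    apply Rabs_le; lra. }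
  assert (Z : Rabs (defect v) <= 0).
  { apply le_epsilon; intros e He.
    destruct (tends_iter_tl Y v (Rmin 1 e)) as [N HN]; [apply Rmin_pos; lra |].
    specialize (HN N (le_n N)); rewrite v_minus_zero_r in HN.
    rewrite (It N); apply Rle_trans with (1 := Bd _).
    generalize (Rmin_l 1 e) (Rmin_r 1 e) (norm_ge_0 (Nat.iter N (tl Y) v)); intros; nra. }
  assert (Z' : defect v = 0).
  { destruct (Req_dec (defect v) 0) as [E | E]; trivial.
    apply Rabs_pos_lt in E; lra. }
  unfold defect in Z'; lra.
Qed.

End Symbol.

Lemma realization : exists (S : disk -> U -> Y) (H : FunHilbert disk Y) (V : X -> H),
  Schur S /\ is_deBranges_Rovnyak S H /\ unitary V /\ forall x, V (A x) = shift_op H (V x).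
Proof.
  destruct (Schur_symbol_operator U Y transfer transfer_Schur) as [T [d so]].
  set (H := model_space Y X O obs_linear obs_inj).
  (* The model space is X itself with point evaluations added, so the unitary is the identity. *)
  exists transfer, H, (fun x => x : H); split; [exact transfer_Schur | split; [| split]].
  - apply (model_space_dBR U Y transfer T d so); exact (observability_adj T d so).
  - split; [exact is_linear_id | split]; [reflexivity |].
    intros y; now exists y.
  - intros x; symmetry; apply of_fun_ev; intros z.
    change (evl Y z (O (A x)) = backward_shift (fun z => evl Y z (O x)) z).
    rewrite <- tl_obs; symmetry; now apply backward_shift_l2.
Qed.

End Realization.

Section Completion.
Variable X : HilbertSpace.
Variable T : X -> X.
Hypothesis T_contr : contraction T.
Hypothesis T_cni : completely_nonisometric T.

(* With [D^2 = 1 - T^* T] the column [V = (T, D)] is isometric, and the row [(V, 1 - V V^* )]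
   is a coisometric completion of it. *)
Lemma completely_nonisometric_model :
  exists (U Y : HilbertSpace) (S : disk -> U -> Y) (H : FunHilbert disk Y) (V : X -> H),
    Schur S /\ is_deBranges_Rovnyak S H /\ unitary V /\ forall x : X, V (T x) = shift_op H (V x).
Proof.
  destruct T_contr as [LT CT].
  assert (LTa : is_linear (adj T)) by now apply adj_linear.
  destruct (operator_sqrt X (fun x => adj T (T x))) as [D [LD [SD DD]]].
  - exact (lin_comp _ _ _ _ _ LT LTa).
  - intros x; apply Rle_trans with (1 * norm (T x)); [| rewrite Rmult_1_l; apply CT].
    apply adj_bound; [trivial | lra |]; intros y; rewrite Rmult_1_l; apply CT.
  - intros x y; now rewrite <- (adjPr _ _ T _ _ LT), <- (adjP _ _ LT).
  - set (V := fun x => (T x, D x) : hsum X X).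
    assert (LV : is_linear V) by exact (pair_linear _ _ _ _ _ LT LD).
    assert (LVa : is_linear (adj V)) by now apply adj_linear.
    assert (VV : forall x, adj V (V x) = x).
    { intros x; apply adj_unique; trivial; intros y.
      rewrite hsum_inner_eq; unfold V; simpl fst; simpl snd.
      rewrite SD, DD, inner_minus_r, <- (adjP _ _ LT); ring. }
    set (P := fun q : hsum X X => vminus q (V (adj V q))).
    assert (LP : is_linear P).
    { apply lin_comp_minus; [exact is_linear_id | exact (lin_comp _ _ _ _ _ LVa LV)]. }
    assert (SP : forall p q, inner (P p) q = inner p (P q)).
    { intros p q; unfold P; rewrite inner_minus_l, inner_minus_r, (adjP _ _ LV), (adjPr _ _ V _ _ LV); trivial. }
    assert (PP : forall q, P (P q) = P q).
    { intros q; unfold P at 1; unfold P at 2; rewrite (lin_minus _ _ _ LVa), VV, v_minus_self.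
      rewrite (lin_zero _ _ _ LV); apply v_minus_zero_r. }
    assert (L1 : is_linear (fun p : hsum X X => fst p : X)) by exact is_linear_fst.
    assert (L2 : is_linear (fun p : hsum X X => snd p : X)) by exact is_linear_snd.
    set (B := fun p : hsum X X => fst (P p) : X).
    set (E := fun p : hsum X X => snd (P p) : X).
    assert (LB : is_linear B) by exact (lin_comp _ _ _ _ _ LP L1).
    assert (LE : is_linear E) by exact (lin_comp _ _ _ _ _ LP L2).
    (* P = I - V V^* acts on the sum of two copies of X, which serves as input space; the outputs
       are those of D, in X. *)
    exists (hsum X X), X.
    apply (realization X (hsum X X) X T B D E LT LB LD LE).
    + assert (LW : is_linear (block T B D E)) by now apply block_linear.
      split; trivial; intros q.
      assert (Ea : adj (block T B D E) q = ((adj V q, P q) : hsum X (hsum X X))).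
      { apply adj_unique; trivial; intros [x p].
        change (inner (vplus (V x) (P p)) q = Cplus (inner x (adj V q)) (inner p (P q))).
        now rewrite inner_plus_l, (adjP _ _ LV), SP. }
      rewrite Ea.
      change (vplus (V (adj V q)) (P (P q)) = q); rewrite PP; unfold P; vec.
    (* |D y|^2 = |y|^2 - |T y|^2, so if every D T^n x vanishes, no norm is lost along the orbit of
       x. *)
    + intros x Z; apply T_cni.
      assert (ND : forall y, norm (D y) ^ 2 = norm y ^ 2 - norm (T y) ^ 2).
      { intros y; rewrite norm2_inner, SD, DD, inner_minus_r, <- (adjP _ _ LT), !inner_norm; reflexivity. }
      induction n; [reflexivity |].
      rewrite <- IHn; simpl.
      assert (Q := ND (Nat.iter n T x)); rewrite Z in Q.
      change (norm (vzero : X) ^ 2 = norm (Nat.iter n T x) ^ 2 - norm (T (Nat.iter n T x)) ^ 2) in Q.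
      rewrite norm_zero' in Q.
      apply Rle_antisym; apply sq_le_inv; try apply norm_ge_0; lra.
Qed.

End Completion.

(** * Complete non-isometry of the backward shift on H(S) *)

Section ModelIsCompletelyNonisometric.
Variables U Y : HilbertSpace.
Variable S : disk -> U -> Y.
Variable H : FunHilbert disk Y.
Hypothesis Sch : Schur S.
Hypothesis dBR : is_deBranges_Rovnyak S H.

Lemma shift_contraction : contraction (shift_op H).
Proof.
  destruct (Schur_symbol_operator U Y S Sch) as [T [d so]].
  destruct (deBranges_Rovnyak_coefficients U Y S T d so H dBR) as [c bc].
  split; [exact (cm_shift_linear U Y S T d so H c bc) |].
  intros h; apply sq_le_inv; [apply norm_ge_0 |].
  generalize (proj2 (cm_shift U Y S T d so H c bc h)) (pow2_ge_0 (norm (hd Y (c h)))); lra.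
Qed.

(** If no iterate loses norm, the inequality for R_0 forces (R_0^n h)(0) = 0 for all n, and these
    values are the Taylor coefficients of h. *)
Lemma shift_completely_nonisometric : completely_nonisometric (shift_op H).
Proof.
  destruct (Schur_symbol_operator U Y S Sch) as [T [d so]].
  destruct (deBranges_Rovnyak_coefficients U Y S T d so H dBR) as [c bc].
  intros h N.
  assert (It : forall n, c (Nat.iter n (shift_op H) h) = Nat.iter n (tl Y) (c h)).
  { induction n; [reflexivity |].
    change (c (shift_op H (Nat.iter n (shift_op H) h)) = tl Y (Nat.iter n (tl Y) (c h))).
    now rewrite (proj1 (cm_shift U Y S T d so H c bc _)), IHn. }
  apply (bc_inj U Y T H c bc).
  rewrite (lin_zero _ _ _ (bc_lin _ _ _ _ _ bc)).
  apply co_ext; intros n; rewrite co_zero.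
  replace (co Y (c h) n) with (hd Y (c (Nat.iter n (shift_op H) h))).
  - apply norm_sq_eq0, Rle_antisym; [| apply pow2_ge_0].
    assert (A := proj2 (cm_shift U Y S T d so H c bc (Nat.iter n (shift_op H) h))).
    assert (E := N (Datatypes.S n)).
    change (norm (shift_op H (Nat.iter n (shift_op H) h)) = norm h) in E.
    rewrite E, N in A; lra.
  - rewrite It; unfold hd; rewrite co_iter_tl, Nat.add_0_r; trivial.
Qed.

End ModelIsCompletelyNonisometric.

(** * Unitary equivalence and the five assertions on H(S) *)

Lemma unitary_norm (H K : HilbertSpace) (V : H -> K) x : unitary V -> norm (V x) = norm x.
Proof. intros [_ [I _]]; now rewrite !norm_sqrt_inner, I. Qed.

Theorem theorem2p1 :
  (forall (U Y : HilbertSpace) (S : disk -> U -> Y), Schur S ->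
    (exists H : FunHilbert disk Y, is_deBranges_Rovnyak S H) /\
    forall H : FunHilbert disk Y, is_deBranges_Rovnyak S H ->
      (* (1) *)
      reproducing_kernel H (deBranges_Rovnyak_kernel S) /\
      (* (2) *)
      ((forall f : disk -> Y, HS S f -> HS S (backward_shift f)) /\
       (forall f : H,
          norm (shift_op H f) ^ 2 <= norm f ^ 2 - norm (ev0 H f) ^ 2) /\
       ((forall f : H,
           norm (shift_op H f) ^ 2 = norm f ^ 2 - norm (ev0 H f) ^ 2) <->
        (forall u : U, HS S (fun z => S z u) ->
           forall z : disk, S z u = zero))) /\
      (* (3) *)
      ((forall u : U, HS S (backward_shift (fun z => S z u))) /\
       is_linear (tau S H) /\
       (forall (f : H) (z : disk),
          ev (adj (shift_op H) f) z =
          minus (scal (z : C) (ev f z)) (S z (adj (tau S H) f))) /\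
       (forall f : H,
          norm (adj (shift_op H) f) ^ 2 =
          norm f ^ 2 - norm (adj (tau S H) f) ^ 2)) /\
      (* (4) *)
      (coisometric (canonical_colligation S H) /\
       forall z : disk, exists V : H -> H,
         is_inverse (fun f : H => minus f (scal (z : C) (shift_op H f))) V /\
         forall u : U,
           S z u = plus (S disk0 u) (scal (z : C) (ev0 H (V (tau S H u)))))) /\
  (* (5) *)
  (forall (X : HilbertSpace) (T : X -> X), is_linear T ->
    ((exists (U Y : HilbertSpace) (S : disk -> U -> Y)
             (H : FunHilbert disk Y) (V : X -> H),
        Schur S /\ is_deBranges_Rovnyak S H /\
        unitary V /\ forall x : X, V (T x) = shift_op H (V x)) <->
     (contraction T /\ completely_nonisometric T))).
Proof.
  split.
  - intros U Y S Sch.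
    destruct (Schur_symbol_operator U Y S Sch) as [T [d so]].
    split; [exact (deBranges_Rovnyak_exists U Y S T d so) |].
    intros H dBR.
    destruct (deBranges_Rovnyak_coefficients U Y S T d so H dBR) as [c bc].
    assert (Mem : forall (f : disk -> Y) (h : H), (forall z, ev h z = f z) -> HS S f).
    { intros f h E; apply (proj1 dBR); now exists h. }
    split; [exact (cm_kernel U Y S T d so H c bc) |].
    split; [split; [| split; [| split]] |].
    + intros f Hf; apply (proj1 dBR) in Hf; destruct Hf as [h Hh].
      apply (Mem _ (shift_op H h)); intros z.
      rewrite (bc_ev _ _ _ _ _ bc), (proj1 (cm_shift U Y S T d so H c bc h)).
      symmetry; apply backward_shift_l2; intros w; rewrite <- Hh; apply (bc_ev _ _ _ _ _ bc).
    + intros f; rewrite (cm_ev0 U Y T H c bc f); apply (cm_shift U Y S T d so H c bc f).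
    + exact (cm_equality_necessary U Y S T d so H c bc).
    + exact (cm_equality_sufficient U Y S T d so H c bc).
    + split; [split; [| split; [| split]] |].
      * intros u; apply (Mem _ (tau S H u)); intros z.
        rewrite (bc_ev _ _ _ _ _ bc), (proj1 (cm_tau U Y S T d so H c bc u)).
        symmetry; apply (so_backward_shift U Y S T d so).
      * exact (cm_tau_linear U Y S T d so H c bc).
      * exact (cm_ev_adj_shift U Y S T d so H c bc).
      * exact (cm_norm_adj_shift U Y S T d so H c bc).
      * split; [exact (cm_coisometric U Y S T d so H c bc) | exact (cm_transfer U Y S T d so H c bc)].
  - intros X T LT; split.
    + intros [U [Y [S [H [V [Sch [dBR [uV VT]]]]]]]].
      assert (It : forall n x, V (Nat.iter n T x) = Nat.iter n (shift_op H) (V x)).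
      { induction n; intros x; simpl; trivial; now rewrite VT, IHn. }
      split.
      * split; trivial; intros x.
        rewrite <- (unitary_norm _ _ V (T x) uV), <- (unitary_norm _ _ V x uV), VT.
        apply (shift_contraction U Y S H Sch dBR).
      * intros x N.
        assert (Z : V x = zero).
        { apply (shift_completely_nonisometric U Y S H Sch dBR); intros n.
          rewrite <- It, !(unitary_norm _ _ V _ uV); apply N. }
        apply hilbert_norm0; rewrite <- (unitary_norm _ _ V x uV), Z; apply norm_zero'.
    + intros [CT NT]; now apply completely_nonisometric_model.
Qed.
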